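(* Let $m\ge1$ be an integer and $f(z)=\sum_{n\ge0}a_nz^{-n/m}\in\mathbb{C}[[z^{-1/m}]]$ a Gevrey-1 series whose Borel transform $\widetilde f(\zeta)=\sum_{n\ge1}\frac{a_n\zeta^{n/m-1}}{\Gamma(n/m)}$ extends analytically to $\Omega^\star$, with $$\exists A>0,\ \exists B>0,\ \forall\zeta\in\Omega^\star:\ |\widetilde f(\zeta)\zeta^{\frac{m-1}{m}}|\le Ae^{B|\zeta|}.$$ Define the coefficients $d_n$ ($n\ge1$) as follows: for $l=1,\dots,m$ let $\widetilde g_l(\xi)=\big(\frac{\xi}{1-e^{-\xi}}\big)^{\frac lm-1}\sum_{k\ge0}\frac{a_{l+mk}\xi^k}{\Gamma(\frac lm+k)}$ (principal branch), which extends holomorphically to $\Delta$, and let $d_{l+mj}$, $j\ge0$, be given by the Taylor expansion $\widetilde g_l(-\ln s)=\sum_{j\ge0}d_{l+mj}(1-s)^j$ for $s\in D(1,1)$. Then the generalized factorial series $$a_0+\sum_{n=1}^{+\infty}\frac{\Gamma(\frac nm)\Gamma(z)\,d_n}{\Gamma(z+\frac nm)}$$ converges absolutely for $z\in P(\max(B,1))$ and its sum equals the Borel sum $\mathrm{S}_0f(z)=a_0+\int_0^{+\infty}\widetilde f(\zeta)e^{-z\zeta}d\zeta$ there.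
   Context: $\Delta$ is the image of the open disc $D(1,1)=\{s:|s-1|<1\}$ under $s\mapsto-\ln s$ (principal logarithm); $\Delta^\star=\Delta\setminus\{0\}$. $\mathbb{C}_m^\star$ is the $m$-sheeted covering of $\mathbb{C}^\star$: points $x=(|x|,\arg x)$, $\arg x\in\mathbb{R}/2\pi m\mathbb{Z}$, projection $\pi(x)=\dot x=|x|e^{i\arg x}$; $|\arg x|$ uses the representative in $]-m\pi,m\pi]$; $x^{k/m}$ has modulus $|x|^{k/m}$ and argument $\frac km\arg x$; complex values (e.g. $e^{-z\zeta}$, $\Gamma(z)$) are read via the projection. $\Omega^\star=\pi^{-1}(\Delta^\star)$. $P(B)=\{z\in\mathbb{C}_m^\star:|\arg z|\le\pi/2,\ \Re(\dot z)>B\}$. Gevrey-1 means $|a_n|\le CK^n\Gamma(1+n/m)$ for some constants. The Laplace integral is along the ray $\arg\zeta=0$. Equivalently, $\widetilde f(\zeta)=\sum_{n\ge1}d_n(1-e^{-\zeta})^{\frac nm-1}$ on $\Omega^\star$. *)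

(* Defs.v *)
From Stdlib Require Import Reals ClassicalEpsilon.
From Coquelicot Require Import Coquelicot.

Open Scope C_scope.

Definition cexp (z : C) : C :=
  (exp (Re z) * cos (Im z), exp (Re z) * sin (Im z))%R.

Definition Carg (z : C) : R :=
  let x := Re z in let y := Im z in
  if Rlt_dec 0 x then atan (y / x)
  else if Rlt_dec x 0 then
    (if Rle_dec 0 y then (atan (y / x) + PI)%R else (atan (y / x) - PI)%R)
  else if Rlt_dec 0 y then (PI / 2)%R
  else if Rlt_dec y 0 then (- (PI / 2))%R else 0%R.

(** Principal logarithm (used only at nonzero points). *)
Definition Cln (z : C) : C := (ln (Cmod z), Carg z).

(** Principal power b^e := exp (e Ln b) (used only for b <> 0). *)
Definition cpowc (b e : C) : C := cexp (e * Cln b).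

(** Euler Gamma function, defined by the (improper) Euler integral;
    it is only ever evaluated at arguments with positive real part. *)
Definition RGamma (x : R) : R :=
  RInt_gen (fun t => Rpower t (x - 1) * exp (- t))%R
           (at_right 0) (Rbar_locally p_infty).

Definition CGamma (z : C) : C :=
  @RInt_gen C_R_CompleteNormedModule
    (fun t => cexp ((z - 1) * RtoC (ln t)) * RtoC (exp (- t)))
    (at_right 0) (Rbar_locally p_infty).

Definition gevrey1 (m : nat) (a : nat -> C) : Prop :=
  exists Cc K : R, forall n : nat,
    (Cmod (a n) <= Cc * K ^ n * RGamma (1 + INR n / INR m))%R.

Definition in_Delta (xi : C) : Prop :=
  exists s : C, (Cmod (s - 1) < 1)%R /\ xi = - Cln s.

(** The m-sheeted covering C_m^star is identified with C^star through the chart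
    x |-> w = x^{1/m} (modulus |x|^{1/m}, argument arg(x)/m in ]-PI,PI]),
    whose inverse is w |-> (|w|^m, m Arg w); the projection is pi(x) = w^m
    and x^{k/m} = w^k.  In this chart Omega^star = pi^{-1}(Delta^star) becomes: *)
Definition in_Omega_chart (m : nat) (w : C) : Prop :=
  w <> 0 /\ in_Delta (w ^ m).

(** n-th term (n = k+1 >= 1) of the Borel transform
    a_n zeta^{n/m - 1} / Gamma(n/m), written in the chart zeta^{1/m} = w. *)
Definition borel_term (m : nat) (a : nat -> C) (w : C) (k : nat) : C :=
  a (S k) * w ^ (S k) / (w ^ m * RtoC (RGamma (INR (S k) / INR m))).

(** xi / (1 - e^{-xi}), extended by its limit 1 at xi = 0. *)
Definition qfun (xi : C) : C :=
  if excluded_middle_informative (xi = 0) then 1 else xi / (1 - cexp (- xi)).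

Definition taylor_coeffs_d (m : nat) (a d : nat -> C) (l : nat) : Prop :=
  exists r : R, (0 < r)%R /\
    forall s : C, (Cmod (s - 1) < r)%R ->
      let xi := - Cln s in
      exists sig : C,
        is_series (fun k => a (l + m * k)%nat * xi ^ k
                             / RtoC (RGamma (INR l / INR m + INR k))) sig /\
        is_series (fun j => d (l + m * j)%nat * (1 - s) ^ j)
                  (cpowc (qfun xi) (RtoC (INR l / INR m - 1)) * sig).

Definition fact_term (m : nat) (d : nat -> C) (z : C) (n : nat) : C :=
  RtoC (RGamma (INR n / INR m)) * CGamma z * d n
  / CGamma (z + RtoC (INR n / INR m)).

(* Main.v *)
Require Import Defs.
From Stdlib Require Import Reals Lra Lia ClassicalEpsilon.
From Coquelicot Require Import Coquelicot.

Open Scope C_scope.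

(** Put [sigma^m = 1 - e^{-zeta}]. In the coordinate [sigma] the Borel transform
    becomes [H(sigma) = F(zeta^{1/m}) sigma^{m-1}], holomorphic on the punctured unit disc
    and equal near [0] to [sum_n d_{n+1} sigma^n], so that all residue classes of
    [n] modulo [m] are treated at once.

    Goursat's theorem in the coordinate [log sigma] gives Cauchy's formula for the
    coefficients and, through Moebius maps, the maximum principle; hence the power
    series represents [H] on the whole real interval [(0,1)]. As
    [|H| <= C |1 - sigma^m|^{-B}] with [B > 1] without loss of generality, averaging over
    circles of radius [1 - 1/n] gives [d_n = O(n^{B-1})]; the pointwise bound would only
    give [O(n^B)] and lose the half-plane [B < Re z <= B + 1].

    Integrating term by term produces [B(z, b) = int_0^oo e^{-zt} (1 - e^{-t})^{b-1} dt]
    with [b = n/m], which is [O(n^{-Re z})]; this gives absolute convergence and the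
    interchange of sum and integral. The identity [B(z,b) Gamma(z+b) = Gamma(z) Gamma(b)]
    and [Gamma <> 0] follow from the recursion in [b] and Gauss's limit
    [n^w B(w, n+1+c) --> Gamma(w)], without Fubini. *)

(** The chart would be multivalued if [zeta / sigma^m] could wind around 0. It cannot: [-ln(1-u)/u]
    has positive real part on the punctured unit disc, so its principal m-th root is holomorphic
    there and no continuation along the covering is needed; the same logarithm gives the principal
    powers that define the [d n].

    The [d n] are fixed only by germs at 0, and complex differentiability comes without continuity
    of the derivative. Hence Goursat's subdivision, and hence the Taylor quotients
    [(H - P N) / q^N]: filled in by [c N] at 0, they are holomorphic on the whole disc, so that the
    mean value gives Cauchy's formula and the maximum principle gives convergence of the series. The
    Laplace integral runs over real [zeta], so real points of the disc suffice.

    The threshold [max(B, 1)] reflects the kernel [|1 - rho e^(it)|^(-B)], whose mean over a circle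
    has order [(1 - rho)^(1-B)] only for [B > 1]. Convergence of the Laplace integral is a
    by-product of the summable majorant of the terms, through Tannery's theorem. *)

Lemma ex_derive_cont (f : R -> R) t : ex_derive f t -> continuous f t.
Proof. apply (ex_derive_continuous (V := R_NormedModule)). Qed.

Lemma continuous_is_RInt (g : R -> R) a b :
  (forall t, Rmin a b <= t <= Rmax a b -> continuous g t) -> is_RInt g a b (RInt g a b).
Proof.
  intros H; apply (RInt_correct (V := R_CompleteNormedModule)).
  now apply (ex_RInt_continuous (V := R_CompleteNormedModule)).
Qed.

Lemma exp_le_compat a b : (a <= b -> exp a <= exp b).
Proof. intros [H| ->]; [left; now apply exp_increasing|right; reflexivity]. Qed.

Lemma exp_le1 a : (a <= 0 -> exp a <= 1).
Proof. rewrite <- exp_0; apply exp_le_compat. Qed.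

(** Splits a tolerance [e] by a factor [K] that may vanish: the [+ 1] keeps the division
    legitimate. *)
Lemma mul_div_succ_lt K e : (0 <= K -> 0 < e -> K * (e / (K + 1)) < e).
Proof.
  intros HK He; apply Rmult_lt_reg_r with (K + 1)%R; [lra|].
  replace (K * (e / (K + 1)) * (K + 1))%R with (K * e)%R by (field; lra); nra.
Qed.

Lemma div_lt1 a b : (0 <= a < b -> 0 <= a / b < 1).
Proof.
  intros H; split; [apply Rmult_le_pos; [lra|left; apply Rinv_0_lt_compat; lra]|].
  apply Rmult_lt_reg_r with b; [lra|]; unfold Rdiv; rewrite Rmult_assoc, Rinv_l; lra.
Qed.

(** * Continuity and complex differentiability *)

Lemma Cmod_sub_sym (x y : C) : Cmod (x - y) = Cmod (y - x).
Proof. rewrite <- Cmod_opp; f_equal; ring. Qed.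

Lemma Cmod_le_add (x y : C) : Cmod x <= Cmod y + Cmod (x - y).
Proof. replace x with (y + (x - y)) at 1 by ring; apply Cmod_triangle. Qed.

Lemma Cmod_sub_tri (x y z : C) : Cmod (x - z) <= Cmod (x - y) + Cmod (y - z).
Proof. replace (x - z) with ((x - y) + (y - z)) by ring; apply Cmod_triangle. Qed.

Lemma RtoC_neq0 (x : R) : x <> 0%R -> RtoC x <> 0.
Proof. intros H E; apply H; injection E; auto. Qed.

Lemma im_le_Cmod (c : C) : Rabs (Im c) <= Cmod c.
Proof.
  eapply Rle_trans; [apply (Rmax_r (Rabs (fst c)) (Rabs (snd c)))|apply Rmax_Cmod].
Qed.

Lemma Cmod_le_re_im (c : C) : Cmod c <= Rabs (Re c) + Rabs (Im c).
Proof.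
  replace c with (RtoC (Re c) + Ci * RtoC (Im c)).
  2:{ destruct c as [u v]; unfold Ci, RtoC, Cplus, Cmult; simpl; f_equal; ring. }
  eapply Rle_trans; [apply Cmod_triangle|].
  rewrite Cmod_mult, Cmod_Ci, !Cmod_R.
  destruct c as [u v]; simpl. 
  replace (u + (0 * v - 1 * 0))%R with u by ring.
  replace (0 + (0 * 0 + 1 * v))%R with v by ring. lra.
Qed.

Lemma Cmod_small_eq0 (x : C) : (forall eps, 0 < eps -> Cmod x <= eps) -> x = 0.
Proof.
  intros H; apply Cmod_eq_0; apply Rle_antisym; [|apply Cmod_ge_0].
  apply le_epsilon; intros e He; rewrite Rplus_0_l; auto.
Qed.

(** The distance [D] is a parameter so that the algebra of continuous functions is proved once for
    real paths and for functions on C. It obeys no axiom; this is why [cont_at_ext_loc] asks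
    separately for agreement at the point itself. *)
Definition cont_at {T : Type} (D : T -> T -> R) (f : T -> C) (x : T) : Prop :=
  forall eps : R, 0 < eps -> exists del : R, (0 < del) /\
    forall y, D x y < del -> Cmod (f y - f x) < eps.

Section ContAt.
Context {T : Type} (D : T -> T -> R).

Lemma cont_at_const (c : C) x : cont_at D (fun _ => c) x.
Proof.
  intros e He; exists 1%R; split; [lra|]; intros y _.
  replace (c - c) with (RtoC 0) by ring; rewrite Cmod_0; exact He.
Qed.

Lemma cont_at_plus f g x :
  cont_at D f x -> cont_at D g x -> cont_at D (fun y => f y + g y) x.
Proof.
  intros Hf Hg e He.
  destruct (Hf (e/2)%R) as [d1 [P1 H1]]; [lra|].
  destruct (Hg (e/2)%R) as [d2 [P2 H2]]; [lra|].
  exists (Rmin d1 d2); split; [now apply Rmin_pos|]; intros y Hy.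
  specialize (H1 y (Rlt_le_trans _ _ _ Hy (Rmin_l _ _))).
  specialize (H2 y (Rlt_le_trans _ _ _ Hy (Rmin_r _ _))).
  replace (f y + g y - (f x + g x)) with ((f y - f x) + (g y - g x)) by ring.
  eapply Rle_lt_trans; [apply Cmod_triangle|lra].
Qed.

Lemma cont_at_mult f g x :
  cont_at D f x -> cont_at D g x -> cont_at D (fun y => f y * g y) x.
Proof.
  intros Hf Hg e He.
  set (M := (Cmod (f x) + Cmod (g x) + 1)%R).
  assert (HM : 1 <= M).
  { unfold M; pose proof (Cmod_ge_0 (f x)); pose proof (Cmod_ge_0 (g x)); lra. }
  (* As [e' <= 1], the product of the two increments is below [e'], so the three error terms add up
     to less than [e' * M <= e / 2]. *)
  set (e' := Rmin 1 (e / (2 * M))).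
  assert (He' : 0 < e').
  { apply Rmin_pos; [lra|]; apply Rdiv_lt_0_compat; lra. }
  destruct (Hf e' He') as [d1 [P1 H1]].
  destruct (Hg e' He') as [d2 [P2 H2]].
  exists (Rmin d1 d2); split; [now apply Rmin_pos|]; intros y Hy.
  specialize (H1 y (Rlt_le_trans _ _ _ Hy (Rmin_l _ _))).
  specialize (H2 y (Rlt_le_trans _ _ _ Hy (Rmin_r _ _))).
  replace (f y * g y - f x * g x)
    with ((f y - f x) * (g y - g x) + ((f y - f x) * g x + f x * (g y - g x))) by ring.
  eapply Rle_lt_trans; [apply Cmod_triangle|].
  eapply Rle_lt_trans; [apply Rplus_le_compat_l, Cmod_triangle|].
  rewrite !Cmod_mult.
  assert (A1 : e' <= 1) by apply Rmin_l.
  assert (A2 : e' * (2 * M) <= e).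
  { apply Rle_trans with (e / (2 * M) * (2 * M))%R.
    - apply Rmult_le_compat_r; [lra|apply Rmin_r].
    - right; field; lra. }
  pose proof (Cmod_ge_0 (f x)); pose proof (Cmod_ge_0 (g x)).
  pose proof (Cmod_ge_0 (f y - f x)); pose proof (Cmod_ge_0 (g y - g x)).
  unfold M in *. nra.
Qed.

Lemma cont_at_inv f x :
  cont_at D f x -> f x <> 0 -> cont_at D (fun y => / f y) x.
Proof.
  intros Hf H0 e He.
  assert (Hm : 0 < Cmod (f x)) by now apply Cmod_gt_0.
  set (m := Cmod (f x)) in *.
  (* The first bound keeps [|f y|] above [m / 2]; the second then gives an error below
     [(e m^2 / 2) / ((m / 2) m) = e]. *)
  destruct (Hf (Rmin (m / 2) (e * m * m / 2))) as [d [P H]].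
  { apply Rmin_pos; [lra|]. assert (0 < e * m * m) by (repeat apply Rmult_lt_0_compat; lra). lra. }
  exists d; split; [exact P|]; intros y Hy; specialize (H y Hy).
  pose proof (Rlt_le_trans _ _ _ H (Rmin_l _ _)) as Ha.
  pose proof (Rlt_le_trans _ _ _ H (Rmin_r _ _)) as Hb.
  assert (Hy2 : m / 2 < Cmod (f y)).
  { pose proof (Cmod_le_add (f x) (f y)) as HH. rewrite Cmod_sub_sym in HH. fold m in HH; lra. }
  assert (Hy0 : f y <> 0) by (apply Cmod_gt_0; lra).
  replace (/ f y - / f x) with ((f x - f y) / (f y * f x)) by (field; auto).
  rewrite Cmod_div by (now apply Cmult_neq_0).
  rewrite Cmod_mult, Cmod_sub_sym; fold m.
  assert (Hp : 0 < Cmod (f y) * m) by (apply Rmult_lt_0_compat; lra).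
  apply Rmult_lt_reg_r with (Cmod (f y) * m)%R; [exact Hp|].
  unfold Rdiv; rewrite Rmult_assoc, (Rinv_l _ (Rgt_not_eq _ _ Hp)).
  assert (0 < e * m) by now apply Rmult_lt_0_compat. nra.
Qed.

Lemma cont_at_comp f (g : C -> C) x :
  cont_at D f x -> cont_at (fun a b => Cmod (b - a)) g (f x) ->
  cont_at D (fun y => g (f y)) x.
Proof.
  intros Hf Hg e He; destruct (Hg e He) as [d [P H]].
  destruct (Hf d P) as [d' [P' H']]; exists d'; split; auto.
Qed.

Lemma cont_at_ext_loc f g x r :
  (0 < r) -> f x = g x -> (forall y, D x y < r -> f y = g y) ->
  cont_at D f x -> cont_at D g x.
Proof.
  intros Hr H0 E Hf e He; destruct (Hf e He) as [d [P H]].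
  exists (Rmin d r); split; [now apply Rmin_pos|]; intros y Hy.
  rewrite <- H0, <- E.
  - apply H; eapply Rlt_le_trans; [exact Hy|apply Rmin_l].
  - eapply Rlt_le_trans; [exact Hy|apply Rmin_r].
Qed.

End ContAt.

Lemma cont_at_neq0_near {T} (D : T -> T -> R) f x :
  cont_at D f x -> f x <> 0 -> exists r, 0 < r /\ forall y, D x y < r -> f y <> 0.
Proof.
  intros Hf H0; destruct (Hf (Cmod (f x))) as [r [Hr Hn]]; [now apply Cmod_gt_0|].
  exists r; split; [exact Hr|]; intros y Hy Z; specialize (Hn y Hy).
  rewrite Z, Cmod_sub_sym in Hn; replace (f x - 0) with (f x) in Hn by ring; lra.
Qed.

Notation ccont := (cont_at (fun a b => Cmod (b - a))).
Notation rcont := (cont_at (fun a b : R => Rabs (b - a))).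

Lemma ccont_id x : ccont (fun y => y) x.
Proof. intros e He; exists e; auto. Qed.

(** Carathéodory's form of complex differentiability: it makes products,
    inverses and compositions reduce to continuity. *)
Definition cdiff (f : C -> C) (p : C) : Prop :=
  exists phi : C -> C, ccont phi p /\ forall q, f q - f p = phi q * (q - p).

Lemma cdiff_cont f p : cdiff f p -> ccont f p.
Proof.
  intros [phi [Hc He]].
  assert (E : forall q, f p + phi q * (q - p) = f q).
  { intro q; rewrite <- He; ring. }
  apply (cont_at_ext_loc _ (fun q => f p + phi q * (q - p)) f p 1); try lra; auto.
  apply cont_at_plus; [apply cont_at_const|].
  apply cont_at_mult; [exact Hc|].
  apply (cont_at_plus _ (fun q => q) (fun _ => - p)); [apply ccont_id|apply cont_at_const].
Qed.

Lemma cdiff_const c p : cdiff (fun _ => c) p.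
Proof. exists (fun _ => 0); split; [apply cont_at_const|intro; ring]. Qed.

Lemma cdiff_id p : cdiff (fun q => q) p.
Proof. exists (fun _ => 1); split; [apply cont_at_const|intro; ring]. Qed.

Lemma cdiff_plus f g p : cdiff f p -> cdiff g p -> cdiff (fun q => f q + g q) p.
Proof.
  intros [u [Hu Eu]] [v [Hv Ev]]; exists (fun q => u q + v q); split.
  - now apply cont_at_plus.
  - intro q; replace (f q + g q - (f p + g p)) with ((f q - f p) + (g q - g p)) by ring.
    rewrite Eu, Ev; ring.
Qed.

Lemma cdiff_mult f g p : cdiff f p -> cdiff g p -> cdiff (fun q => f q * g q) p.
Proof.
  intros Hf Hg; pose proof (cdiff_cont _ _ Hg) as Cg.
  destruct Hf as [u [Hu Eu]]; destruct Hg as [v [Hv Ev]].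
  exists (fun q => u q * g q + f p * v q); split.
  - apply cont_at_plus; apply cont_at_mult; auto using @cont_at_const.
  - intro q; replace (f q * g q - f p * g p) with ((f q - f p) * g q + f p * (g q - g p)) by ring.
    rewrite Eu, Ev; ring.
Qed.

Lemma cdiff_opp f p : cdiff f p -> cdiff (fun q => - f q) p.
Proof.
  intros [u [Hu Eu]]; exists (fun q => - (1) * u q); split.
  - apply cont_at_mult; auto using @cont_at_const.
  - intro q; replace (- f q - - f p) with (- (f q - f p)) by ring; rewrite Eu; ring.
Qed.

(** The factorization in [cdiff] is required at every [q], not only near [p]; the new slope is
    therefore the difference quotient of [g], which coincides with the old slope near [p]. *)
Lemma cdiff_ext_loc f g p r :
  (0 < r) -> (forall q, Cmod (q - p) < r -> f q = g q) -> cdiff f p -> cdiff g p.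
Proof.
  intros Hr E [u [Hu Eu]].
  assert (Ep : f p = g p).
  { apply E; replace (p - p) with (RtoC 0) by ring; rewrite Cmod_0; exact Hr. }
  exists (fun q => if excluded_middle_informative (q = p) then u p else (g q - g p) / (q - p)).
  split.
  - apply (cont_at_ext_loc _ u _ p r Hr); [destruct (excluded_middle_informative _); [auto|tauto]| |exact Hu].
    intros q Hq; destruct (excluded_middle_informative _) as [->|n]; auto.
    rewrite <- E, <- Ep, Eu by exact Hq; field; intro Z; apply n.
    replace q with (p + (q - p)) by ring; rewrite Z; ring.
  - intro q; destruct (excluded_middle_informative _) as [->|n]; [ring|].
    field; intro Z; apply n; replace q with (p + (q - p)) by ring; rewrite Z; ring.
Qed.

Lemma cdiff_comp f g p : cdiff f p -> cdiff g (f p) -> cdiff (fun q => g (f q)) p.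
Proof.
  intros Hf [v [Hv Ev]]; pose proof (cdiff_cont _ _ Hf) as Cf.
  destruct Hf as [u [Hu Eu]]; exists (fun q => v (f q) * u q); split.
  - apply cont_at_mult; auto. now apply cont_at_comp.
  - intro q; rewrite Ev, Eu; ring.
Qed.

Lemma cdiff_inv f p : cdiff f p -> f p <> 0 -> cdiff (fun q => / f q) p.
Proof.
  intros Hf H0; pose proof (cdiff_cont _ _ Hf) as Cf.
  destruct (cont_at_neq0_near _ f p Cf H0) as [r [Hr Nz]].
  destruct Hf as [u [Hu Eu]].
  (* The candidate is written so that its factorization holds everywhere by construction; it has to
     equal [/ f q] only near [p], where [f] does not vanish. *)
  apply (cdiff_ext_loc (fun q => / f p + (- (u q / (f p * f q))) * (q - p)) _ p r Hr).
  - intros q Hq; specialize (Nz q Hq).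
    replace (- (u q / (f p * f q)) * (q - p)) with (- ((u q * (q - p)) / (f p * f q)))
      by (field; auto).
    rewrite <- Eu; field; auto.
  - exists (fun q => - (u q / (f p * f q))); split.
    + apply (cont_at_ext_loc _ (fun q => - (1) * (u q * (/ f p * / f q))) _ p r Hr).
      * field; auto.
      * intros q Hq; field; auto.
      * repeat apply cont_at_mult; auto using @cont_at_const. now apply cont_at_inv.
    + intro q; ring.
Qed.

Lemma cdiff_pow f p n : cdiff f p -> cdiff (fun q => f q ^ n) p.
Proof.
  intros Hf; induction n; simpl; [apply cdiff_const|now apply cdiff_mult].
Qed.

Lemma cdiff_div f g p : cdiff f p -> cdiff g p -> g p <> 0 -> cdiff (fun q => f q / g q) p.
Proof. intros; apply cdiff_mult; auto; now apply cdiff_inv. Qed.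

Lemma cdiff_minus f g p : cdiff f p -> cdiff g p -> cdiff (fun q => f q - g q) p.
Proof. intros; apply cdiff_plus; auto; now apply cdiff_opp. Qed.

(** The balls of the product uniform structure are squares; they compare with the discs of [Cmod] up
    to the factor [sqrt 2]. *)
Lemma locally_Cmod (x : C) (P : C -> Prop) :
  locally (T := C_UniformSpace) x P <->
  exists d, (0 < d) /\ forall y, Cmod (y - x) < d -> P y.
Proof.
  split.
  - intros [e He]; exists e; split; [apply cond_pos|].
    intros y Hy; apply He; apply C_NormedModule_mixin_compat1; exact Hy.
  - intros [d [Hd H]].
    assert (H2 : 0 < d / sqrt 2) by (apply Rdiv_lt_0_compat; [exact Hd|apply sqrt_lt_R0; lra]).
    exists (mkposreal _ H2); intros y Hy; apply H.
    pose proof (C_NormedModule_mixin_compat2 x y (mkposreal _ H2) Hy) as HH.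
    change (Cmod (y - x) < sqrt 2 * (d / sqrt 2)) in HH.
    replace (sqrt 2 * (d / sqrt 2))%R with d in HH; [exact HH|].
    field; apply Rgt_not_eq; apply sqrt_lt_R0; lra.
Qed.

(** The value [phi p = l] is exported because differentiating the logarithm means inverting the
    slope of [cexp], which must be known to be nonzero. *)
Lemma caratheodory_of_eps (f : C -> C) (p l : C) :
  (forall eps, 0 < eps -> exists d, 0 < d /\ forall q, Cmod (q - p) < d ->
     Cmod (f q - f p - l * (q - p)) <= eps * Cmod (q - p)) ->
  exists phi, ccont phi p /\ phi p = l /\ forall q, f q - f p = phi q * (q - p).
Proof.
  intros H.
  exists (fun q => if excluded_middle_informative (q = p) then l else (f q - f p) / (q - p)).
  split; [|split].
  - intros e He; destruct (H (e/2)%R) as [d [Hd Hq]]; [lra|].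
    exists d; split; [exact Hd|]; intros q Hqd.
    destruct (excluded_middle_informative (p = p)) as [_|n]; [|tauto].
    destruct (excluded_middle_informative _) as [->|n].
    { replace (l - l) with (RtoC 0) by ring; rewrite Cmod_0; lra. }
    assert (Z : q - p <> 0).
    { intro Z; apply n; replace q with (p + (q - p)) by ring; rewrite Z; ring. }
    replace ((f q - f p) / (q - p) - l) with ((f q - f p - l * (q - p)) / (q - p)) by (field; auto).
    rewrite Cmod_div by exact Z.
    apply Cmod_gt_0 in Z.
    apply Rmult_lt_reg_r with (Cmod (q - p)); [exact Z|].
    unfold Rdiv; rewrite Rmult_assoc, Rinv_l by lra.
    specialize (Hq q Hqd); nra.
  - destruct (excluded_middle_informative _); [reflexivity|tauto].
  - intro q; destruct (excluded_middle_informative _) as [->|n]; [ring|].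
    field; intro Z; apply n; replace q with (p + (q - p)) by ring; rewrite Z; ring.
Qed.

Lemma cdiff_of_is_derive_eps (f : C -> C) (p l : C) :
  (forall eps, 0 < eps -> exists d, 0 < d /\ forall q, Cmod (q - p) < d ->
     Cmod (f q - f p - l * (q - p)) <= eps * Cmod (q - p)) -> cdiff f p.
Proof.
  intros H; destruct (caratheodory_of_eps f p l H) as [phi [Hc [_ E]]]; exists phi; auto.
Qed.

Lemma cdiff_of_ex_derive (f : C -> C) (p : C) :
  @ex_derive C_AbsRing C_NormedModule f p -> cdiff f p.
Proof.
  intros [l [_ Hl]]; apply cdiff_of_is_derive_eps with l; intros e He.
  specialize (Hl p (fun P H => H) (mkposreal e He)).
  destruct Hl as [d H]; exists d; split; [apply cond_pos|].
  intros q Hq; specialize (H q Hq).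
  change (Cmod (f q - f p - (q - p) * l) <= e * Cmod (q - p)) in H.
  now rewrite (Cmult_comm l).
Qed.

Lemma rcont_continuous (f : R -> C) t :
  rcont f t -> @continuous R_UniformSpace C_UniformSpace f t.
Proof.
  intros H P HP; apply locally_Cmod in HP; destruct HP as [d [Hd HP]].
  destruct (H d Hd) as [e [He H']]; exists (mkposreal e He); intros y Hy.
  apply HP, H', Hy.
Qed.

Lemma rcont_RtoC (f : R -> R) t : continuous f t -> rcont (fun s => RtoC (f s)) t.
Proof.
  intros H e He; destruct (H (fun y => Rabs (y - f t) < e)%R) as [d Hd].
  - exists (mkposreal e He); auto.
  - exists d; split; [apply cond_pos|]; intros y Hy.
    rewrite <- RtoC_minus, Cmod_R; apply Hd, Hy.
Qed.

Lemma rcont_pair (f g : R -> R) t :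
  continuous f t -> continuous g t -> rcont (fun s => (f s, g s)) t.
Proof.
  intros Hf Hg.
  apply (cont_at_ext_loc _ (fun s => RtoC (f s) + Ci * RtoC (g s)) _ t 1); try lra;
    try (intros; unfold Ci, RtoC, Cplus, Cmult; simpl; f_equal; ring);
    try (unfold Ci, RtoC, Cplus, Cmult; simpl; f_equal; ring).
  apply cont_at_plus; [now apply rcont_RtoC|].
  apply cont_at_mult; [apply cont_at_const|now apply rcont_RtoC].
Qed.

(** * The complex exponential *)

Lemma cexp_plus x y : cexp (x + y) = cexp x * cexp y.
Proof.
  destruct x as [a b], y as [c d]; unfold cexp, Cmult, Cplus; simpl.
  rewrite exp_plus, cos_plus, sin_plus; f_equal; ring.
Qed.

Lemma cexp_0 : cexp 0 = 1.
Proof. unfold cexp; simpl; rewrite exp_0, cos_0, sin_0; unfold RtoC; f_equal; ring. Qed.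

Lemma Cmod_cexp x : Cmod (cexp x) = exp (Re x).
Proof.
  unfold cexp, Cmod; simpl.
  set (E := exp (Re x)).
  replace (E * cos (Im x) * (E * cos (Im x) * 1) + E * sin (Im x) * (E * sin (Im x) * 1))%R
    with (E * E * (Rsqr (sin (Im x)) + Rsqr (cos (Im x))))%R by (unfold Rsqr; ring).
  rewrite sin2_cos2, Rmult_1_r; apply sqrt_square; left; apply exp_pos.
Qed.

Lemma cexp_neq0 x : cexp x <> 0.
Proof. apply Cmod_gt_0; rewrite Cmod_cexp; apply exp_pos. Qed.

Lemma cexp_RtoC x : cexp (RtoC x) = RtoC (exp x).
Proof. unfold cexp, RtoC; simpl; rewrite cos_0, sin_0; f_equal; ring. Qed.

Lemma cexp_opp x : cexp (- x) = / cexp x.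
Proof.
  assert (H : cexp (- x) * cexp x = 1).
  { rewrite <- cexp_plus; replace (- x + x) with (RtoC 0) by ring; apply cexp_0. }
  replace (/ cexp x) with ((cexp (- x) * cexp x) / cexp x) by (rewrite H; field; apply cexp_neq0).
  field; apply cexp_neq0.
Qed.

Lemma cexp_pow x n : cexp x ^ n = cexp (RtoC (INR n) * x).
Proof.
  induction n; simpl Cpow.
  - simpl INR; replace (RtoC 0 * x) with (RtoC 0) by ring; now rewrite cexp_0.
  - rewrite IHn, <- cexp_plus, S_INR, RtoC_plus; f_equal; ring.
Qed.

Lemma Rabs_mult_self x : (Rabs x * Rabs x = x * x)%R.
Proof. rewrite <- Rabs_mult; apply Rabs_pos_eq, Rle_0_sqr. Qed.

Lemma Rabs_sin_le x : Rabs (sin x) <= Rabs x.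
Proof.
  destruct (MVT_gen sin 0 x cos) as [c [Hc E]].
  { intros; auto_derive; auto; ring. }
  { intros; apply continuity_pt_filterlim, (ex_derive_continuous sin); auto_derive; auto. }
  rewrite sin_0, !Rminus_0_r in E; rewrite E, Rabs_mult.
  assert (Rabs (cos c) <= 1) by (apply Rabs_le, COS_bound).
  pose proof (Rabs_pos x); nra.
Qed.

(** * Integrals of complex-valued functions, Goursat's theorem *)

Notation is_CInt := (@is_RInt C_R_NormedModule).
Definition CInt (f : R -> C) (a b : R) : C := @RInt C_R_CompleteNormedModule f a b.

Lemma is_CInt_pair (f : R -> C) a b (l : C) :
  is_CInt f a b l <->
  is_RInt (fun t => Re (f t)) a b (Re l) /\ is_RInt (fun t => Im (f t)) a b (Im l).
Proof.
  split.
  - intros H; split.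
    + exact (is_RInt_fct_extend_fst (U := R_NormedModule) (V := R_NormedModule) f a b l H).
    + exact (is_RInt_fct_extend_snd (U := R_NormedModule) (V := R_NormedModule) f a b l H).
  - intros [H1 H2]; destruct l as [l1 l2].
    exact (is_RInt_fct_extend_pair (U := R_NormedModule) (V := R_NormedModule) f a b l1 l2 H1 H2).
Qed.

Lemma is_CInt_unique f a b l : is_CInt f a b l -> CInt f a b = l.
Proof. intros H; exact (is_RInt_unique (V := C_R_CompleteNormedModule) f a b l H). Qed.

Lemma CInt_correct f a b :
  (forall t, Rmin a b <= t <= Rmax a b -> rcont f t) -> is_CInt f a b (CInt f a b).
Proof.
  intros H; apply (RInt_correct (V := C_R_CompleteNormedModule)), 
    (ex_RInt_continuous (V := C_R_CompleteNormedModule)).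
  intros t Ht; apply rcont_continuous, H, Ht.
Qed.

Lemma is_CInt_plus f g a b l l' :
  is_CInt f a b l -> is_CInt g a b l' -> is_CInt (fun t => f t + g t) a b (l + l').
Proof. intros; exact (is_RInt_plus (V := C_R_NormedModule) f g a b l l' H H0). Qed.

Lemma is_CInt_scal (c : C) f a b l : is_CInt f a b l -> is_CInt (fun t => c * f t) a b (c * l).
Proof.
  intros H; apply is_CInt_pair in H; destruct H as [H1 H2]; apply is_CInt_pair.
  destruct c as [u v]; split; simpl.
  - exact (is_RInt_minus (V := R_NormedModule) _ _ a b _ _
      (is_RInt_scal (V := R_NormedModule) _ a b u _ H1) (is_RInt_scal (V := R_NormedModule) _ a b v _ H2)).
  - exact (is_RInt_plus (V := R_NormedModule) _ _ a b _ _
      (is_RInt_scal (V := R_NormedModule) _ a b u _ H2) (is_RInt_scal (V := R_NormedModule) _ a b v _ H1)).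
Qed.

Lemma is_CInt_minus f g a b l l' :
  is_CInt f a b l -> is_CInt g a b l' -> is_CInt (fun t => f t - g t) a b (l - l').
Proof. intros; exact (is_RInt_minus (V := C_R_NormedModule) f g a b l l' H H0). Qed.

Lemma is_CInt_ext f g a b l :
  (forall t, Rmin a b < t < Rmax a b -> f t = g t)%R -> is_CInt f a b l -> is_CInt g a b l.
Proof. exact (is_RInt_ext (V := C_R_NormedModule) f g a b l). Qed.

Lemma CInt_ext f g a b :
  (forall t, Rmin a b < t < Rmax a b -> f t = g t)%R -> CInt f a b = CInt g a b.
Proof. exact (RInt_ext (V := C_R_CompleteNormedModule) f g a b). Qed.

Lemma is_CInt_Chasles f a b c l l' :
  is_CInt f a b l -> is_CInt f b c l' -> is_CInt f a c (l + l').
Proof. exact (is_RInt_Chasles (V := C_R_NormedModule) f a b c l l'). Qed.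

Lemma is_CInt_norm f g a b l lg : a <= b ->
  (forall t, a <= t <= b -> Cmod (f t) <= g t) ->
  is_CInt f a b l -> is_RInt g a b lg -> Cmod l <= lg.
Proof.
  intros Hab Hfg Hf Hg.
  assert (N : forall c : C, Cmod c = @norm R_AbsRing C_R_NormedModule c).
  { intros c; unfold norm; simpl; unfold prod_norm, Cmod; f_equal.
    unfold norm; simpl; unfold abs; simpl; rewrite !Rmult_1_r, !Rabs_mult_self; reflexivity. }
  rewrite N; apply (norm_RInt_le (V := C_R_NormedModule) f g a b l lg Hab); auto.
  intros; rewrite <- N; auto.
Qed.

Lemma is_CInt_const (c : C) a b : is_CInt (fun _ => c) a b (RtoC (b - a) * c).
Proof.
  replace (RtoC (b - a) * c) with (@scal R_AbsRing C_R_NormedModule (b - a)%R c).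
  - apply (is_RInt_const (V := C_R_NormedModule)).
  - destruct c as [u v]; unfold scal; simpl; unfold prod_scal, Cmult, RtoC; simpl.
    unfold scal; simpl; unfold mult; simpl; f_equal; ring.
Qed.

Lemma is_CInt_norm_const f a b l K : a <= b ->
  (forall t, a <= t <= b -> Cmod (f t) <= K) -> is_CInt f a b l -> Cmod l <= (b - a) * K.
Proof.
  intros Hab HK Hf; apply (is_CInt_norm f (fun _ => K) a b l); auto.
  apply (is_RInt_const (V := R_NormedModule)).
Qed.

Lemma is_CInt_RtoC (f : R -> R) a b l :
  is_RInt f a b l -> is_CInt (fun t => RtoC (f t)) a b (RtoC l).
Proof.
  intros H; apply is_CInt_pair; split; simpl; [exact H|].
  pose proof (is_RInt_const (V := R_NormedModule) a b 0%R) as H0.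
  unfold scal in H0; simpl in H0; unfold mult in H0; simpl in H0; now rewrite Rmult_0_r in H0.
Qed.

(** Kept componentwise, so that [auto_derive] and the real fundamental theorem of calculus apply to
    each part. *)
Definition is_rderiv (f : R -> C) (t : R) (l : C) : Prop :=
  is_derive (fun s => Re (f s)) t (Re l) /\ is_derive (fun s => Im (f s)) t (Im l).

Lemma is_rderiv_const c t : is_rderiv (fun _ => c) t 0.
Proof. split; exact (is_derive_const (V := R_NormedModule) _ t). Qed.

Lemma is_rderiv_RtoC (f : R -> R) t l : is_derive f t l -> is_rderiv (fun s => RtoC (f s)) t (RtoC l).
Proof. split; [exact H|exact (is_derive_const (V := R_NormedModule) 0%R t)]. Qed.

Lemma is_rderiv_plus f g t l l' :
  is_rderiv f t l -> is_rderiv g t l' -> is_rderiv (fun s => f s + g s) t (l + l').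
Proof.
  intros [H1 H2] [H3 H4]; split.
  - exact (is_derive_plus (V := R_NormedModule) _ _ t _ _ H1 H3).
  - exact (is_derive_plus (V := R_NormedModule) _ _ t _ _ H2 H4).
Qed.

Lemma is_derive_mulR (u v : R -> R) t lu lv :
  is_derive u t lu -> is_derive v t lv ->
  is_derive (fun s => u s * v s)%R t (lu * v t + u t * lv)%R.
Proof.
  intros Hu Hv; auto_derive; [split; [|split; [|exact I]]; eexists; eassumption|].
  change (fun x => u x) with u; change (fun x => v x) with v.
  rewrite (is_derive_unique _ _ _ Hu), (is_derive_unique _ _ _ Hv); ring.
Qed.

Lemma is_rderiv_mult f g t l l' :
  is_rderiv f t l -> is_rderiv g t l' -> is_rderiv (fun s => f s * g s) t (l * g t + f t * l').
Proof.
  intros [H1 H2] [H3 H4]; split.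
  - replace (Re (l * g t + f t * l')) with
      ((Re l * Re (g t) + Re (f t) * Re l') - (Im l * Im (g t) + Im (f t) * Im l'))%R
      by (simpl; unfold Re, Im; ring).
    exact (is_derive_minus (V := R_NormedModule) _ _ t _ _
      (is_derive_mulR _ _ t _ _ H1 H3) (is_derive_mulR _ _ t _ _ H2 H4)).
  - replace (Im (l * g t + f t * l')) with
      ((Re l * Im (g t) + Re (f t) * Im l') + (Im l * Re (g t) + Im (f t) * Re l'))%R
      by (simpl; unfold Re, Im; ring).
    exact (is_derive_plus (V := R_NormedModule) _ _ t _ _
      (is_derive_mulR _ _ t _ _ H1 H4) (is_derive_mulR _ _ t _ _ H2 H3)).
Qed.

Lemma is_rderiv_cexp g t l :
  is_rderiv g t l -> is_rderiv (fun s => cexp (g s)) t (l * cexp (g t)).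
Proof.
  assert (A : forall (u v : R -> R) lu lv, is_derive u t lu -> is_derive v t lv ->
    is_derive (fun s => exp (u s) * cos (v s))%R t (lu * (exp (u t) * cos (v t)) - lv * (exp (u t) * sin (v t)))%R
    /\ is_derive (fun s => exp (u s) * sin (v s))%R t (lu * (exp (u t) * sin (v t)) + lv * (exp (u t) * cos (v t)))%R).
  { intros u v lu lv Hu Hv; split; auto_derive;
    try (split; [|split; [|exact I]]; eexists; eassumption);
    change (fun x => u x) with u; change (fun x => v x) with v;
    rewrite (is_derive_unique _ _ _ Hu), (is_derive_unique _ _ _ Hv); ring. }
  intros [H1 H2]; destruct (A _ _ _ _ H1 H2) as [A1 A2]; split.
  - exact A1.
  - replace (Im (l * cexp (g t))) with (Re l * (exp (Re (g t)) * sin (Im (g t))) + Im l * (exp (Re (g t)) * cos (Im (g t))))%R; [exact A2|].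
    simpl; unfold Re, Im; ring.
Qed.

Lemma rcont_Re f t : rcont f t -> continuous (fun s => Re (f s)) t.
Proof.
  intros H P [e He]; destruct (H e (cond_pos e)) as [d [Hd H']].
  exists (mkposreal d Hd); intros s Hs; apply He.
  change (Rabs (Re (f s) - Re (f t)) < e).
  eapply Rle_lt_trans; [|apply H', Hs]. apply (re_le_Cmod (f s - f t)).
Qed.

Lemma rcont_Im f t : rcont f t -> continuous (fun s => Im (f s)) t.
Proof.
  intros H P [e He]; destruct (H e (cond_pos e)) as [d [Hd H']].
  exists (mkposreal d Hd); intros s Hs; apply He.
  change (Rabs (Im (f s) - Im (f t)) < e).
  eapply Rle_lt_trans; [|apply H', Hs]. apply (im_le_Cmod (f s - f t)).
Qed.

Lemma is_rderiv_rcont f t l : is_rderiv f t l -> rcont f t.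
Proof.
  intros [H1 H2].
  apply (cont_at_ext_loc _ (fun s => (Re (f s), Im (f s))) f t 1); [lra| | |].
  - unfold Re, Im; symmetry; apply surjective_pairing.
  - intros; unfold Re, Im; symmetry; apply surjective_pairing.
  - apply rcont_pair; apply ex_derive_cont; eexists; eassumption.
Qed.

Lemma is_CInt_derive f df a b :
  (forall t, Rmin a b <= t <= Rmax a b -> is_rderiv f t (df t)) ->
  (forall t, Rmin a b <= t <= Rmax a b -> rcont df t) ->
  is_CInt df a b (f b - f a).
Proof.
  intros H Hc; apply is_CInt_pair; split; simpl.
  - apply (is_RInt_derive (V := R_CompleteNormedModule) (fun t => Re (f t))); intros t Ht.
    + apply H, Ht.
    + now apply rcont_Re, Hc.
  - apply (is_RInt_derive (V := R_CompleteNormedModule) (fun t => Im (f t))); intros t Ht.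
    + apply H, Ht.
    + now apply rcont_Im, Hc.
Qed.

Lemma is_rderiv_cexp_lin (a : C) t : is_rderiv (fun t => cexp (a * RtoC t)) t (a * cexp (a * RtoC t)).
Proof.
  apply (is_rderiv_cexp (fun t => a * RtoC t)).
  assert (D : is_rderiv (fun t => a * RtoC t) t (0 * RtoC t + a * RtoC 1)).
  { apply (is_rderiv_mult (fun _ => a) (fun t => RtoC t)); [apply is_rderiv_const|].
    apply (is_rderiv_RtoC (fun t => t)); auto_derive; auto. }
  replace (0 * RtoC t + a * RtoC 1) with a in D by ring; exact D.
Qed.

(** Takes the place of the exponential series: estimating this integral along the segment from 0 to
    [h] gives the first-order bound, and inserting that bound once more gives the second-order
    one. *)
Lemma is_CInt_cexp_path h :
  is_CInt (fun t => h * cexp (h * RtoC t)) 0 1 (cexp h - 1).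
Proof.
  replace (cexp h - 1) with (cexp (h * RtoC 1) - cexp (h * RtoC 0)).
  2:{ rewrite Cmult_1_r, Cmult_0_r, cexp_0; reflexivity. }
  apply (is_CInt_derive (fun t => cexp (h * RtoC t))); intros t _; [apply is_rderiv_cexp_lin|].
  apply cont_at_mult; [apply cont_at_const|eapply is_rderiv_rcont, is_rderiv_cexp_lin].
Qed.

Lemma cexp_sub1_le h : Cmod h <= 1 -> Cmod (cexp h - 1) <= 3 * Cmod h.
Proof.
  intros Hh.
  replace (3 * Cmod h)%R with ((1 - 0) * (3 * Cmod h))%R by ring.
  eapply is_CInt_norm_const; [lra| |apply is_CInt_cexp_path].
  intros t Ht; cbv beta; rewrite Cmod_mult, Cmod_cexp, Rmult_comm.
  apply Rmult_le_compat_r; [apply Cmod_ge_0|].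
  apply Rle_trans with (exp 1); [apply exp_le_compat|apply exp_le_3].
  eapply Rle_trans; [apply Rle_abs|]; eapply Rle_trans; [apply re_le_Cmod|].
  rewrite Cmod_mult, Cmod_R, Rabs_pos_eq by lra; pose proof (Cmod_ge_0 h); nra.
Qed.

Lemma cexp_sub1_bound h : Cmod h <= 1 -> Cmod (cexp h - 1 - h) <= 3 * (Cmod h * Cmod h).
Proof.
  intros Hh; pose proof (Cmod_ge_0 h).
  assert (I := is_CInt_minus _ _ _ _ _ _ (is_CInt_cexp_path h) (is_CInt_const h 0 1)).
  replace (cexp h - 1 - RtoC (1 - 0) * h) with (cexp h - 1 - h) in I by (rewrite Rminus_0_r; ring).
  replace (3 * (Cmod h * Cmod h))%R with ((1 - 0) * (Cmod h * (3 * Cmod h)))%R by ring.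
  eapply is_CInt_norm_const; [lra| |exact I].
  intros t Ht; cbv beta; replace (h * cexp (h * RtoC t) - h) with (h * (cexp (h * RtoC t) - 1)) by ring.
  rewrite Cmod_mult; apply Rmult_le_compat_l; [lra|].
  assert (Hht : Cmod (h * RtoC t) <= Cmod h) by (rewrite Cmod_mult, Cmod_R, Rabs_pos_eq by lra; nra).
  eapply Rle_trans; [apply cexp_sub1_le|]; lra.
Qed.

Lemma cexp_caratheodory p :
  exists phi, ccont phi p /\ phi p = cexp p /\ forall q, cexp q - cexp p = phi q * (q - p).
Proof.
  apply caratheodory_of_eps; intros e He.
  set (K := (3 * Cmod (cexp p) + 1)%R).
  assert (HK : 1 <= K) by (unfold K; pose proof (Cmod_ge_0 (cexp p)); lra).
  exists (Rmin 1 (e / K)); split; [apply Rmin_pos; [lra|apply Rdiv_lt_0_compat; lra]|].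
  intros q Hq.
  pose proof (Rlt_le_trans _ _ _ Hq (Rmin_l _ _)) as H1.
  pose proof (Rlt_le_trans _ _ _ Hq (Rmin_r _ _)) as H2.
  replace (cexp q - cexp p - cexp p * (q - p)) with (cexp p * (cexp (q - p) - 1 - (q - p))).
  2:{ replace q with (p + (q - p)) at 3 by ring; rewrite cexp_plus; ring. }
  rewrite Cmod_mult.
  pose proof (cexp_sub1_bound (q - p) ltac:(lra)) as HB.
  pose proof (Cmod_ge_0 (cexp p)); pose proof (Cmod_ge_0 (q - p)).
  assert (H3 : Cmod (q - p) * K <= e).
  { apply Rle_trans with (e / K * K)%R; [nra|right; field; lra]. }
  apply Rle_trans with (Cmod (cexp p) * (3 * (Cmod (q - p) * Cmod (q - p))))%R; [nra|].
  unfold K in H3; nra.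
Qed.

Lemma cdiff_cexp p : cdiff cexp p.
Proof. destruct (cexp_caratheodory p) as [phi [Hc [_ E]]]; exists phi; auto. Qed.

(** * Goursat's theorem on rectangles *)

Lemma nested_intervals (a b : nat -> R) :
  (forall n, a n <= a (S n)) -> (forall n, b (S n) <= b n) -> (forall n, a n <= b n) ->
  exists p, forall n, a n <= p <= b n.
Proof.
  intros Ha Hb Hab.
  assert (Ma : forall n k, a n <= a (n + k)%nat).
  { intros n; induction k; [rewrite Nat.add_0_r; lra|].
    rewrite Nat.add_succ_r; specialize (Ha (n + k)%nat); lra. }
  assert (Mb : forall n k, b (n + k)%nat <= b n).
  { intros n; induction k; [rewrite Nat.add_0_r; lra|].
    rewrite Nat.add_succ_r; specialize (Hb (n + k)%nat); lra. }
  assert (Mab : forall n k, a n <= b k).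
  { intros n k; specialize (Ma n k); specialize (Mb k n); specialize (Hab (n + k)%nat).
    rewrite (Nat.add_comm k n) in Mb; lra. }
  destruct (completeness (fun x => exists n, x = a n)) as [p [Hp1 Hp2]].
  - exists (b 0%nat); intros x [n ->]; apply Mab.
  - exists (a 0%nat), 0%nat; reflexivity.
  - exists p; intros n; split.
    + apply Hp1; exists n; reflexivity.
    + apply Hp2; intros x [k ->]; apply Mab.
Qed.

Definition rect_int (f : C -> C) (x1 x2 y1 y2 : R) : C :=
  CInt (fun x => f (x, y1)) x1 x2 + Ci * CInt (fun y => f (x2, y)) y1 y2
  - CInt (fun x => f (x, y2)) x1 x2 - Ci * CInt (fun y => f (x1, y)) y1 y2.

Definition rect_cont (f : C -> C) (x1 x2 y1 y2 : R) : Prop :=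
  forall x y, x1 <= x <= x2 -> y1 <= y <= y2 -> ccont f (x, y).

Lemma rect_side_h f x1 x2 y1 y2 y : rect_cont f x1 x2 y1 y2 -> x1 <= x2 -> y1 <= y <= y2 ->
  forall u v, x1 <= u <= v -> v <= x2 ->
  is_CInt (fun x => f (x, y)) u v (CInt (fun x => f (x, y)) u v).
Proof.
  intros H Hx Hy u v Hu Hv; apply CInt_correct; intros t Ht.
  rewrite Rmin_left, Rmax_right in Ht by lra.
  apply (cont_at_comp _ (fun x => (x, y)) f); [|apply H; lra].
  apply rcont_pair; [apply continuous_id|apply continuous_const].
Qed.

Lemma rect_side_v f x1 x2 y1 y2 x : rect_cont f x1 x2 y1 y2 -> y1 <= y2 -> x1 <= x <= x2 ->
  forall u v, y1 <= u <= v -> v <= y2 ->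
  is_CInt (fun y => f (x, y)) u v (CInt (fun y => f (x, y)) u v).
Proof.
  intros H Hx Hy u v Hu Hv; apply CInt_correct; intros t Ht.
  rewrite Rmin_left, Rmax_right in Ht by lra.
  apply (cont_at_comp _ (fun y => (x, y)) f); [|apply H; lra].
  apply rcont_pair; [apply continuous_const|apply continuous_id].
Qed.

Lemma rect_int_split_h f x1 x2 y1 y2 m : rect_cont f x1 x2 y1 y2 ->
  (x1 <= m <= x2) -> y1 <= y2 ->
  rect_int f x1 x2 y1 y2 = rect_int f x1 m y1 y2 + rect_int f m x2 y1 y2.
Proof.
  intros H Hm Hy; unfold rect_int.
  assert (S1 : forall y, y1 <= y <= y2 -> CInt (fun x => f (x, y)) x1 x2 =
     CInt (fun x => f (x, y)) x1 m + CInt (fun x => f (x, y)) m x2).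
  { intros y Hy'; apply is_CInt_unique; apply is_CInt_Chasles with m;
     eapply rect_side_h; try eassumption; lra. }
  rewrite !S1 by lra; ring.
Qed.

Lemma rect_int_split_v f x1 x2 y1 y2 m : rect_cont f x1 x2 y1 y2 ->
  (y1 <= m <= y2) -> x1 <= x2 ->
  rect_int f x1 x2 y1 y2 = rect_int f x1 x2 y1 m + rect_int f x1 x2 m y2.
Proof.
  intros H Hm Hy; unfold rect_int.
  assert (S1 : forall x, x1 <= x <= x2 -> CInt (fun y => f (x, y)) y1 y2 =
     CInt (fun y => f (x, y)) y1 m + CInt (fun y => f (x, y)) m y2).
  { intros y Hy'; apply is_CInt_unique; apply is_CInt_Chasles with m;
     eapply rect_side_v; try eassumption; lra. }
  rewrite !S1 by lra; ring.
Qed.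

Lemma rect_int_minus f g x1 x2 y1 y2 :
  rect_cont f x1 x2 y1 y2 -> rect_cont g x1 x2 y1 y2 -> x1 <= x2 -> y1 <= y2 ->
  rect_int (fun q => f q - g q) x1 x2 y1 y2 = rect_int f x1 x2 y1 y2 - rect_int g x1 x2 y1 y2.
Proof.
  intros Hf Hg Hx Hy; unfold rect_int.
  assert (S1 : forall x, x1 <= x <= x2 -> CInt (fun y => f (x, y) - g (x, y)) y1 y2 =
     CInt (fun y => f (x, y)) y1 y2 - CInt (fun y => g (x, y)) y1 y2).
  { intros x Hx'; apply is_CInt_unique, is_CInt_minus; eapply rect_side_v; try eassumption; lra. }
  assert (S2 : forall y, y1 <= y <= y2 -> CInt (fun x => f (x, y) - g (x, y)) x1 x2 =
     CInt (fun x => f (x, y)) x1 x2 - CInt (fun x => g (x, y)) x1 x2).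
  { intros x Hx'; apply is_CInt_unique, is_CInt_minus; eapply rect_side_h; try eassumption; lra. }
  rewrite !S1, !S2 by lra; ring.
Qed.

Lemma rect_int_bound f x1 x2 y1 y2 K :
  rect_cont f x1 x2 y1 y2 -> x1 <= x2 -> y1 <= y2 ->
  (forall x y, x1 <= x <= x2 -> y1 <= y <= y2 -> Cmod (f (x, y)) <= K) ->
  (Cmod (rect_int f x1 x2 y1 y2) <= 2 * K * ((x2 - x1) + (y2 - y1))).
Proof.
  intros Hf Hx Hy HK; unfold rect_int.
  assert (S1 : forall x, x1 <= x <= x2 -> (Cmod (CInt (fun y => f (x, y)) y1 y2) <= (y2 - y1) * K)%R).
  { intros x Hx'; eapply is_CInt_norm_const; [exact Hy| |eapply rect_side_v; try eassumption; lra].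
    intros; apply HK; lra. }
  assert (S2 : forall y, y1 <= y <= y2 -> (Cmod (CInt (fun x => f (x, y)) x1 x2) <= (x2 - x1) * K)%R).
  { intros x Hx'; eapply is_CInt_norm_const; [exact Hx| |eapply rect_side_h; try eassumption; lra].
    intros; apply HK; lra. }
  unfold Cminus.
  eapply Rle_trans; [apply Cmod_triangle|].
  eapply Rle_trans; [apply Rplus_le_compat_r, Cmod_triangle|].
  eapply Rle_trans; [apply Rplus_le_compat_r, Rplus_le_compat_r, Cmod_triangle|].
  rewrite !Cmod_opp, !Cmod_mult, Cmod_Ci.
  pose proof (S1 x1 ltac:(lra)); pose proof (S1 x2 ltac:(lra)).
  pose proof (S2 y1 ltac:(lra)); pose proof (S2 y2 ltac:(lra)). lra.
Qed.

Lemma ccont_affine a b q : ccont (fun w => a + b * w) q.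
Proof.
  apply cont_at_plus; [apply cont_at_const|apply cont_at_mult; [apply cont_at_const|apply ccont_id]].
Qed.

(** Along a path of constant velocity [h] the integrand has the primitive [a w + (b/2) w^2]. With
    [h = 1] and [h = Ci] on the sides of a rectangle, the corner values cancel. *)
Lemma CInt_affine_path a b g h u v : (forall t, is_rderiv g t h) ->
  h * CInt (fun t => a + b * g t) u v =
    (a * g v + b / 2 * (g v * g v)) - (a * g u + b / 2 * (g u * g u)).
Proof.
  intros Hg.
  assert (Hc : forall t, rcont (fun t => a + b * g t) t).
  { intros t; apply (cont_at_comp _ g (fun w => a + b * w)); [|apply ccont_affine].
    eapply is_rderiv_rcont, Hg. }
  rewrite <- (is_CInt_unique _ _ _ _ (is_CInt_scal h _ u v _ (CInt_correct _ u v (fun t _ => Hc t)))).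
  apply is_CInt_unique, (is_CInt_derive (fun t => a * g t + b / 2 * (g t * g t))); intros t _.
  - replace (h * (a + b * g t)) with ((0 * g t + a * h) + (0 * (g t * g t) + b / 2 * (h * g t + g t * h))) by field.
    apply is_rderiv_plus; apply (is_rderiv_mult (fun _ => _)); try apply is_rderiv_const; [apply Hg|].
    now apply is_rderiv_mult.
  - apply cont_at_mult; [apply cont_at_const|apply Hc].
Qed.

Lemma rect_int_affine a b x1 x2 y1 y2 : rect_int (fun q => a + b * q) x1 x2 y1 y2 = 0.
Proof.
  assert (Dx : forall y t, is_rderiv (fun x => (x, y)) t 1).
  { intros y t; split; [exact (is_derive_id (K := R_AbsRing) t)|exact (is_derive_const (V := R_NormedModule) y t)]. }
  assert (Dy : forall x t, is_rderiv (fun y => (x, y)) t Ci).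
  { intros x t; split; [exact (is_derive_const (V := R_NormedModule) x t)|exact (is_derive_id (K := R_AbsRing) t)]. }
  unfold rect_int.
  rewrite !(CInt_affine_path a b _ Ci _ _ (Dy _)).
  rewrite <- (Cmult_1_l (CInt _ x1 x2)), <- (Cmult_1_l (CInt (fun x => a + b * (x, y2)) x1 x2)).
  rewrite !(CInt_affine_path a b _ 1 _ _ (Dx _)); ring.
Qed.

(** The ordering of the sides of [r] is included, so [subrect r r] says that [r] is a possibly
    degenerate rectangle, and [subrect (x, x, y, y) r] that a point lies in [r]. *)
Definition subrect (r s : R * R * R * R) : Prop :=
  let '(x1, x2, y1, y2) := r in let '(u1, u2, v1, v2) := s in
  (u1 <= x1 /\ x1 <= x2 /\ x2 <= u2 /\ v1 <= y1 /\ y1 <= y2 /\ y2 <= v2).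

Definition rect_size (r : R * R * R * R) : R :=
  let '(x1, x2, y1, y2) := r in ((x2 - x1) + (y2 - y1))%R.

Definition rint (f : C -> C) (r : R * R * R * R) : C :=
  let '(x1, x2, y1, y2) := r in rect_int f x1 x2 y1 y2.

(** Halving both sides divides [rect_size r ^ 2] by four, the number of pieces; if every quarter
    respected the bound, the whole rectangle would too. *)
Lemma goursat_step f r eps :
  subrect r r -> (forall x y, subrect (x, x, y, y) r -> ccont f (x, y)) ->
  (eps * rect_size r ^ 2 < Cmod (rint f r)) ->
  exists r', subrect r' r /\ rect_size r' = (rect_size r / 2)%R /\
    (eps * rect_size r' ^ 2 < Cmod (rint f r')).
Proof.
  destruct r as [[[x1 x2] y1] y2]; simpl; intros [_ [Hx [_ [_ [Hy _]]]]] Hc Hlt.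
  set (mx := ((x1 + x2) / 2)%R); set (my := ((y1 + y2) / 2)%R).
  assert (Mx : x1 <= mx <= x2) by (unfold mx; lra).
  assert (My : y1 <= my <= y2) by (unfold my; lra).
  assert (RC : forall u1 u2 v1 v2, x1 <= u1 <= u2 -> u2 <= x2 -> y1 <= v1 <= v2 -> v2 <= y2 ->
     rect_cont f u1 u2 v1 v2).
  { intros u1 u2 v1 v2 H1 H2 H3 H4 x y Hx' Hy'; apply Hc; lra. }
  assert (E : rect_int f x1 x2 y1 y2 = (rect_int f x1 mx y1 my + rect_int f x1 mx my y2)
     + (rect_int f mx x2 y1 my + rect_int f mx x2 my y2)).
  { rewrite (rect_int_split_h f x1 x2 y1 y2 mx) by (try apply RC; lra).
    rewrite (rect_int_split_v f x1 mx y1 y2 my) by (try apply RC; lra).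
    rewrite (rect_int_split_v f mx x2 y1 y2 my) by (try apply RC; lra). reflexivity. }
  set (T := (eps * ((x2 - x1 + (y2 - y1)) / 2) ^ 2)%R).
  assert (HT : (4 * T = eps * ((x2 - x1 + (y2 - y1)) * ((x2 - x1 + (y2 - y1)) * 1)))%R) by (unfold T; field).
  assert (Go : forall u1 u2 v1 v2, subrect (u1, u2, v1, v2) (x1, x2, y1, y2) ->
     (u2 - u1 + (v2 - v1) = (x2 - x1 + (y2 - y1)) / 2)%R -> T < Cmod (rect_int f u1 u2 v1 v2) ->
     exists r', subrect r' (x1, x2, y1, y2) /\ rect_size r' = ((x2 - x1 + (y2 - y1)) / 2)%R /\
       (eps * rect_size r' ^ 2 < Cmod (rint f r'))).
  { intros u1 u2 v1 v2 H1 H2 H3; exists (u1, u2, v1, v2); split; [exact H1|]; simpl rect_size.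
    rewrite H2; split; [reflexivity|exact H3]. }
  destruct (Rlt_dec T (Cmod (rect_int f x1 mx y1 my))) as [H|N1];
    [apply (Go x1 mx y1 my); [simpl; lra|unfold mx, my; field|exact H]|].
  destruct (Rlt_dec T (Cmod (rect_int f x1 mx my y2))) as [H|N2];
    [apply (Go x1 mx my y2); [simpl; lra|unfold mx, my; field|exact H]|].
  destruct (Rlt_dec T (Cmod (rect_int f mx x2 y1 my))) as [H|N3];
    [apply (Go mx x2 y1 my); [simpl; lra|unfold mx, my; field|exact H]|].
  destruct (Rlt_dec T (Cmod (rect_int f mx x2 my y2))) as [H|N4];
    [apply (Go mx x2 my y2); [simpl; lra|unfold mx, my; field|exact H]|].
  exfalso; rewrite E in Hlt.
  pose proof (Cmod_triangle (rect_int f x1 mx y1 my + rect_int f x1 mx my y2)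
     (rect_int f mx x2 y1 my + rect_int f mx x2 my y2)).
  pose proof (Cmod_triangle (rect_int f x1 mx y1 my) (rect_int f x1 mx my y2)).
  pose proof (Cmod_triangle (rect_int f mx x2 y1 my) (rect_int f mx x2 my y2)). lra.
Qed.

Lemma goursat f x1 x2 y1 y2 : x1 <= x2 -> y1 <= y2 ->
  (forall x y, x1 <= x <= x2 -> y1 <= y <= y2 -> cdiff f (x, y)) ->
  rect_int f x1 x2 y1 y2 = 0.
Proof.
  intros Hx Hy Hd.
  set (D := ((x2 - x1) + (y2 - y1))%R).
  enough (Main : forall eps, 0 < eps -> Cmod (rect_int f x1 x2 y1 y2) <= eps * D ^ 2).
  { apply Cmod_small_eq0; intros e He.
    assert (HD : 0 <= D) by (unfold D; lra).
    eapply Rle_trans; [apply (Main (e / (D ^ 2 + 1)))%R|].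
    - apply Rdiv_lt_0_compat; [exact He|nra].
    - unfold Rdiv; rewrite Rmult_assoc.
      assert (/ (D ^ 2 + 1) * D ^ 2 <= 1).
      { apply Rmult_le_reg_l with (D ^ 2 + 1)%R; [nra|]. rewrite <- Rmult_assoc, Rinv_r by nra. lra. }
      nra. }
  intros eps Heps; apply Rnot_lt_le; intros Hbad.
  set (r0 := (x1, x2, y1, y2)).
  assert (Hsub : forall r s t, subrect r s -> subrect s t -> subrect r t).
  { intros [[[? ?] ?] ?] [[[? ?] ?] ?] [[[? ?] ?] ?]; simpl; lra. }
  set (P := fun r => subrect r r0 /\ (eps * rect_size r ^ 2 < Cmod (rint f r))).
  (* Rectangles that still carry the excess form a sigma type, so that dependent choice turns the
     subdivision into the plain recursion [sq]. *)
  assert (Step : forall r : {r | P r}, exists r' : {r | P r},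
     subrect (proj1_sig r') (proj1_sig r) /\ rect_size (proj1_sig r') = (rect_size (proj1_sig r) / 2)%R).
  { intros [r [Hr1 Hr2]].
    destruct (goursat_step f r eps) as [r' [A1 [A2 A3]]]; auto.
    - revert Hr1; destruct r as [[[? ?] ?] ?]; simpl; lra.
    - intros x y Hxy; apply cdiff_cont, Hd; pose proof (Hsub _ _ _ Hxy Hr1) as HH; simpl in HH; lra.
    - assert (Hr' : P r') by (split; [exact (Hsub _ _ _ A1 Hr1)|exact A3]).
      exists (exist _ r' Hr'); simpl; auto. }
  set (next := fun r => proj1_sig (constructive_indefinite_description _ (Step r))).
  assert (Hnext : forall r, subrect (proj1_sig (next r)) (proj1_sig r) /\
     rect_size (proj1_sig (next r)) = (rect_size (proj1_sig r) / 2)%R).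
  { intros r; unfold next; apply (proj2_sig (constructive_indefinite_description _ (Step r))). }
  assert (P0 : P r0) by (split; [simpl; lra|exact Hbad]).
  set (sq := fix sq n := match n with O => exist P r0 P0 | S k => next (sq k) end).
  set (sx1 := fun n => fst (fst (fst (proj1_sig (sq n))))).
  set (sx2 := fun n => snd (fst (fst (proj1_sig (sq n))))).
  set (sy1 := fun n => snd (fst (proj1_sig (sq n)))).
  set (sy2 := fun n => snd (proj1_sig (sq n))).
  assert (Est : forall n, proj1_sig (sq n) = (sx1 n, sx2 n, sy1 n, sy2 n)).
  { intros n; unfold sx1, sx2, sy1, sy2; destruct (proj1_sig (sq n)) as [[[? ?] ?] ?]; reflexivity. }
  assert (Hs : forall n, subrect (sx1 (S n), sx2 (S n), sy1 (S n), sy2 (S n)) (sx1 n, sx2 n, sy1 n, sy2 n)).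
  { intros n; rewrite <- !Est; apply Hnext. }
  assert (H0 : forall n, subrect (sx1 n, sx2 n, sy1 n, sy2 n) r0 /\
     (eps * rect_size (sx1 n, sx2 n, sy1 n, sy2 n) ^ 2 < Cmod (rint f (sx1 n, sx2 n, sy1 n, sy2 n)))).
  { intros n; rewrite <- Est; exact (proj2_sig (sq n)). }
  assert (Hsz : forall n, rect_size (sx1 n, sx2 n, sy1 n, sy2 n) = (D / 2 ^ n)%R).
  { intros n; rewrite <- Est; induction n.
    - simpl; unfold D; field.
    - replace (D / 2 ^ S n)%R with (D / 2 ^ n / 2)%R by (simpl; field; apply pow_nonzero; lra).
      refine (eq_trans (proj2 (Hnext (sq n))) _).
      exact (f_equal (fun x => x / 2)%R IHn). }
  destruct (nested_intervals sx1 sx2) as [px Hpx];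
    try (intros n; specialize (Hs n); specialize (H0 n); simpl in *; lra).
  destruct (nested_intervals sy1 sy2) as [py Hpy];
    try (intros n; specialize (Hs n); specialize (H0 n); simpl in *; lra).
  destruct (Hd px py) as [phi [Hphi Ephi]].
  { pose proof (Hpx 0%nat) as HH; unfold sx1, sx2 in HH; simpl in HH; exact HH. }
  { pose proof (Hpy 0%nat) as HH; unfold sy1, sy2 in HH; simpl in HH; exact HH. }
  (* With slope error [eps / 4], a rectangle of size [d] contributes at most
     [2 (eps d / 4) d = eps d^2 / 2], which cannot exceed [eps d^2]. *)
  destruct (Hphi (eps / 4)%R) as [del [Hdel Hq]]; [lra|].
  assert (Hn : exists n, D / 2 ^ n < del).
  { destruct (Rle_lt_or_eq_dec 0 D) as [Hpos|Hz]; [unfold D; lra| |].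
    - destruct (pow_lt_1_zero (/ 2) ltac:(rewrite Rabs_pos_eq; lra) (del / D)%R) as [N HN].
      { now apply Rdiv_lt_0_compat. }
      exists N; specialize (HN N (le_n _)); rewrite Rabs_pos_eq in HN by (apply pow_le; lra).
      rewrite pow_inv in HN; unfold Rdiv.
      apply Rmult_lt_compat_l with (r := D) in HN; [|exact Hpos].
      replace (D * (del / D))%R with del in HN by (field; lra). exact HN.
    - exists 0%nat; simpl; rewrite <- Hz; lra. }
  destruct Hn as [n Hn].
  specialize (H0 n); destruct H0 as [Hsubn Hbig]; specialize (Hsz n); rewrite Hsz in Hbig.
  specialize (Hpx n); specialize (Hpy n); simpl in Hsubn, Hsz.
  set (d := (D / 2 ^ n)%R) in *.
  set (p := (px, py) : C) in *.
  set (aff := fun q : C => (f p - phi p * p) + phi p * q).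
  (* The tangent map at the limit point is affine, so its boundary integral vanishes and may be
     subtracted freely. *)
  assert (Erem : rint f (sx1 n, sx2 n, sy1 n, sy2 n) =
    rect_int (fun q => f q - aff q) (sx1 n) (sx2 n) (sy1 n) (sy2 n)).
  { rewrite rect_int_minus; try lra.
    - unfold aff; rewrite rect_int_affine; simpl; ring.
    - intros x y H1 H2; apply cdiff_cont, Hd; lra.
    - intros x y _ _; apply ccont_affine. }
  rewrite Erem in Hbig.
  assert (Hd0 : 0 <= d) by lra.
  assert (B : (Cmod (rect_int (fun q => (f q - aff q)%C) (sx1 n) (sx2 n) (sy1 n) (sy2 n)) <= 2 * (eps / 4 * d) * d)%R).
  { rewrite <- Hsz at 2; apply rect_int_bound; try lra.
    - intros x y H1 H2; apply (cont_at_plus _ f (fun q => - aff q)).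
      + apply cdiff_cont, Hd; lra.
      + apply (cont_at_ext_loc _ (fun q => (- (f p - phi p * p)) + (- phi p) * q) _ _ 1); try lra;
          try (intros; unfold aff; ring); try (unfold aff; ring).
        apply ccont_affine.
    - intros x y H1 H2.
      assert (Hdist : Cmod ((x, y) - p) <= d).
      { eapply Rle_trans; [apply Cmod_le_re_im|]; simpl.
        assert (Rabs (x + - px) <= sx2 n - sx1 n) by (apply Rabs_le; lra).
        assert (Rabs (y + - py) <= sy2 n - sy1 n) by (apply Rabs_le; lra). lra. }
      replace (f (x, y) - aff (x, y)) with ((phi (x, y) - phi p) * ((x, y) - p)).
      2:{ unfold aff; replace (f (x, y)) with (f p + (f (x, y) - f p)) by ring; rewrite Ephi; ring. }
      rewrite Cmod_mult.
      specialize (Hq (x, y) ltac:(lra)).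
      apply Rmult_le_compat; try apply Cmod_ge_0; [left; exact Hq|exact Hdist]. }
  nra.
Qed.

(** * Mean values, maximum principle, Taylor coefficients *)

Definition pol (r t : R) : C := (r * cos t, r * sin t)%R.

Lemma pol_cexp u t : cexp (u, t) = pol (exp u) t.
Proof. reflexivity. Qed.

Lemma pol_cexp_ln r t : 0 < r -> pol r t = cexp (ln r, t).
Proof. intros H; rewrite pol_cexp, exp_ln; auto. Qed.

Lemma Cmod_pol r t : 0 < r -> Cmod (pol r t) = r.
Proof. intros H; rewrite pol_cexp_ln by exact H; rewrite Cmod_cexp; simpl; now apply exp_ln. Qed.

Lemma pol_2PI r : pol r (2 * PI) = pol r 0.
Proof. unfold pol; rewrite cos_2PI, sin_2PI, cos_0, sin_0; reflexivity. Qed.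

Lemma rcont_pol r t : rcont (pol r) t.
Proof.
  apply rcont_pair; apply ex_derive_cont; auto_derive; auto.
Qed.

(** In the coordinate [log q] circles become vertical segments, and the two
    horizontal sides of a rectangle of height [2 PI] cancel. *)
Lemma mean_value f rho L : 0 < rho ->
  (forall q, 0 < Cmod q <= rho -> cdiff f q) ->
  (forall eps, 0 < eps -> exists d, 0 < d /\ forall q, 0 < Cmod q < d -> Cmod (f q - L) <= eps) ->
  is_CInt (fun t => f (pol rho t)) 0 (2 * PI) (RtoC (2 * PI) * L).
Proof.
  intros Hr Hd HL.
  pose proof PI_RGT_0 as Hpi.
  assert (Hg : forall u, u <= ln rho -> is_CInt (fun t => f (pol (exp u) t)) 0 (2 * PI)
      (CInt (fun t => f (pol (exp u) t)) 0 (2 * PI))).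
  { intros u Hu; apply CInt_correct; intros t _.
    apply (cont_at_comp _ (pol (exp u)) f); [apply rcont_pol|apply cdiff_cont, Hd].
    rewrite Cmod_pol by apply exp_pos; split; [apply exp_pos|].
    rewrite <- (exp_ln rho) by exact Hr.
    destruct Hu as [Hu| ->]; [left; now apply exp_increasing|right; reflexivity]. }
  assert (Hc : forall u, u <= ln rho -> CInt (fun t => f (pol (exp u) t)) 0 (2 * PI) =
     CInt (fun t => f (pol (exp (ln rho)) t)) 0 (2 * PI)).
  { intros u Hu.
    assert (G : rect_int (fun p => f (cexp p)) u (ln rho) 0 (2 * PI) = 0).
    { apply goursat; [exact Hu|lra|]; intros x y Hx Hy.
      apply cdiff_comp; [apply cdiff_cexp|apply Hd].
      rewrite Cmod_cexp; simpl; split; [apply exp_pos|].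
      rewrite <- (exp_ln rho) by exact Hr.
      destruct (proj2 Hx) as [Hu'| ->]; [left; now apply exp_increasing|right; reflexivity]. }
    unfold rect_int in G.
    assert (E : CInt (fun x => f (cexp (x, 2 * PI)%R)) u (ln rho) = CInt (fun x => f (cexp (x, 0%R))) u (ln rho)).
    { apply CInt_ext; intros x _; rewrite !pol_cexp, pol_2PI; reflexivity. }
    rewrite E in G.
    set (X := CInt (fun t => f (pol (exp u) t)) 0 (2 * PI)).
    set (Y := CInt (fun t => f (pol (exp (ln rho)) t)) 0 (2 * PI)).
    change (CInt (fun y => f (cexp (u, y))) 0 (2 * PI)) with X in G.
    change (CInt (fun y => f (cexp (ln rho, y))) 0 (2 * PI)) with Y in G.
    set (Z := CInt (fun x => f (cexp (x, 0%R))) u (ln rho)) in G.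
    assert (G2 : Ci * (Y - X) = 0) by (rewrite <- G; ring).
    replace X with (Y + Ci * (Ci * (Y - X))).
    - rewrite G2; ring.
    - assert (Ci2 : Ci * Ci = - (1)) by (unfold Ci, Cmult, Copp, RtoC; simpl; f_equal; ring).
      replace (Ci * (Ci * (Y - X))) with ((Ci * Ci) * (Y - X)) by ring; rewrite Ci2; ring. }
  pose proof (Hg (ln rho) (Rle_refl _)) as HI.
  rewrite exp_ln in HI, Hc by exact Hr.
  set (X := CInt (fun t => f (pol rho t)) 0 (2 * PI)) in *.
  replace (RtoC (2 * PI) * L) with X; [exact HI|].
  replace X with ((X - RtoC (2 * PI) * L) + RtoC (2 * PI) * L) by ring.
  replace (X - RtoC (2 * PI) * L) with (RtoC 0); [ring|symmetry].
  apply Cmod_small_eq0; intros e He.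
  destruct (HL (e / (2 * PI))%R) as [d [Hd0 HdL]]; [apply Rdiv_lt_0_compat; lra|].
  (* The circle integral does not depend on the radius, so it may be computed at radius [exp u < d],
     where [f] is within [e / (2 PI)] of [L]. *)
  set (u := Rmin (ln rho) (ln (d / 2))).
  assert (Hu : u <= ln rho) by apply Rmin_l.
  assert (Hud : exp u < d).
  { apply Rle_lt_trans with (d / 2)%R; [|lra].
    rewrite <- (exp_ln (d / 2)) by lra.
    assert (Hu2 : u <= ln (d / 2)) by apply Rmin_r.
    destruct Hu2 as [Hu2| ->]; [left; now apply exp_increasing|right; reflexivity]. }
  rewrite <- (Hc u Hu).
  assert (HH : is_CInt (fun t => f (pol (exp u) t) - L) 0 (2 * PI)
     (CInt (fun t => f (pol (exp u) t)) 0 (2 * PI) - RtoC (2 * PI - 0) * L)).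
  { apply is_CInt_minus; [now apply Hg|apply is_CInt_const]. }
  rewrite Rminus_0_r in HH.
  eapply Rle_trans; [eapply is_CInt_norm_const with (K := (e / (2 * PI))%R); [| |exact HH]|].
  - lra.
  - intros t _; apply HdL; rewrite Cmod_pol by apply exp_pos; split; [apply exp_pos|exact Hud].
  - right; field; lra.
Qed.

(** Moving an arbitrary point of the disc to its centre by a Moebius map turns
    the mean value property into the maximum principle. *)
Lemma max_principle f rho x M : 0 < x < rho ->
  (forall q, Cmod q <= rho -> cdiff f q) ->
  (forall q, (Cmod q = rho)%R -> Cmod (f q) <= M) -> Cmod (f (RtoC x)) <= M.
Proof.
  intros Hx Hd HM.
  (* [Mo] is the automorphism of the disc of radius [rho] that sends 0 to [x]; its pole
     [- rho^2 / x] lies outside because [x < rho]. *)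
  set (den := fun t : C => RtoC (rho * rho) + RtoC x * t).
  set (Mo := fun t : C => (RtoC (rho * rho) * (t + RtoC x)) / den t).
  assert (Hden : forall t, Cmod t <= rho -> den t <> 0).
  { intros t Ht Z.
    assert (E : RtoC (rho * rho) = - (RtoC x * t)).
    { unfold den in Z; replace (RtoC (rho * rho)) with ((RtoC (rho * rho) + RtoC x * t) - RtoC x * t) by ring.
      rewrite Z; ring. }
    apply (f_equal Cmod) in E; rewrite Cmod_opp, Cmod_mult, !Cmod_R in E.
    rewrite !Rabs_pos_eq in E by nra. nra. }
  (* One identity settles both facts about [Mo]: the extra term is nonnegative on the disc and
     vanishes on its boundary circle. *)
  assert (Key : forall t, ((rho * rho * Cmod (t + RtoC x)) ^ 2 + (rho * rho) * (rho * rho - Cmod t ^ 2) * (rho * rho - x * x) = (rho * Cmod (den t)) ^ 2)%R).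
  { intros t; rewrite !Rpow_mult_distr, !Cmod2_alt; unfold den; destruct t as [a b]; simpl; ring. }
  assert (Hle : forall t, Cmod t <= rho -> Cmod (Mo t) <= rho).
  { intros t Ht; unfold Mo; rewrite Cmod_div by now apply Hden.
    rewrite Cmod_mult, Cmod_R, Rabs_pos_eq by nra.
    pose proof (proj1 (Cmod_gt_0 _) (Hden t Ht)) as Hp.
    apply Rmult_le_reg_r with (Cmod (den t)); [exact Hp|].
    unfold Rdiv; rewrite Rmult_assoc, Rinv_l, Rmult_1_r by lra.
    specialize (Key t); pose proof (Cmod_ge_0 t); pose proof (Cmod_ge_0 (t + RtoC x)).
    assert (0 <= rho * rho - Cmod t ^ 2) by nra.
    assert (0 <= rho * rho - x * x) by nra.
    apply Rsqr_incr_0_var; unfold Rsqr.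
    - assert (0 <= rho * rho * (rho * rho - Cmod t ^ 2) * (rho * rho - x * x)).
      { apply Rmult_le_pos; [apply Rmult_le_pos; [nra|assumption]|assumption]. }
      simpl in Key; rewrite !Rmult_1_r in Key; simpl in *; lra.
    - nra. }
  assert (Heq : forall t, Cmod t = rho -> Cmod (Mo t) = rho).
  { intros t Ht; unfold Mo; rewrite Cmod_div by (apply Hden; lra).
    rewrite Cmod_mult, Cmod_R, Rabs_pos_eq by nra.
    pose proof (proj1 (Cmod_gt_0 _) (Hden t ltac:(lra))) as Hp.
    apply Rmult_eq_reg_r with (Cmod (den t)); [|lra].
    unfold Rdiv; rewrite Rmult_assoc, Rinv_l, Rmult_1_r by lra.
    specialize (Key t); rewrite Ht in Key; pose proof (Cmod_ge_0 (t + RtoC x)).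
    apply Rsqr_inj; unfold Rsqr; [|nra|].
    - apply Rmult_le_pos; [nra|assumption].
    - simpl in Key; rewrite !Rmult_1_r in Key; nra. }
  assert (HdMo : forall t, Cmod t <= rho -> cdiff Mo t).
  { intros t Ht; apply cdiff_div; [| |now apply Hden].
    - apply cdiff_mult; [apply cdiff_const|apply cdiff_plus; [apply cdiff_id|apply cdiff_const]].
    - apply cdiff_plus; [apply cdiff_const|apply cdiff_mult; [apply cdiff_const|apply cdiff_id]]. }
  assert (HdF : forall t, Cmod t <= rho -> cdiff (fun t => f (Mo t)) t).
  { intros t Ht; apply cdiff_comp; [now apply HdMo|now apply Hd, Hle]. }
  assert (E0 : Mo 0 = RtoC x).
  { unfold Mo, den; rewrite RtoC_mult; field. apply RtoC_neq0; lra. }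
  assert (MV : is_CInt (fun t => f (Mo (pol rho t))) 0 (2 * PI) (RtoC (2 * PI) * f (RtoC x))).
  { apply (mean_value (fun t => f (Mo t))); [lra|intros; apply HdF; lra|].
    intros e He; destruct (cdiff_cont _ _ (HdF 0 ltac:(rewrite Cmod_0; lra)) e He) as [d [Hd0 Hc]].
    exists d; split; [exact Hd0|]; intros q Hq; left; rewrite <- E0; apply Hc.
    replace (q - 0) with q by ring; lra. }
  pose proof PI_RGT_0 as Hpi.
  assert (B : Cmod (RtoC (2 * PI) * f (RtoC x)) <= (2 * PI - 0) * M).
  { eapply is_CInt_norm_const; [lra| |exact MV]; intros t _; apply HM, Heq, Cmod_pol; lra. }
  rewrite Cmod_mult, Cmod_R, Rabs_pos_eq in B by lra.
  apply Rmult_le_reg_l with (2 * PI)%R; lra.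
Qed.

(** * Complex series and geometric tails *)

Fixpoint csum (u : nat -> C) (n : nat) : C :=
  match n with O => 0 | S k => csum u k + u k end.

Definition cseries (u : nat -> C) (l : C) : Prop :=
  forall eps, 0 < eps -> exists N, forall n, (N <= n)%nat -> Cmod (csum u n - l) < eps.

(** [csum u n] stops before the index [n], whereas [sum_n u n] includes it. *)
Lemma sum_n_csum (u : nat -> C) n : @sum_n C_AbelianMonoid u n = csum u (S n).
Proof.
  induction n.
  - rewrite sum_O; simpl; ring.
  - rewrite sum_Sn, IHn; reflexivity.
Qed.

Lemma is_series_cseries (u : nat -> C) (l : C) :
  @is_series C_AbsRing C_NormedModule u l <-> cseries u l.
Proof.
  split.
  - intros H e He.
    destruct (H (fun y => Cmod (y - l) < e)%R) as [N HN].
    { apply locally_Cmod; exists e; auto. }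
    exists (S N); intros n Hn; destruct n as [|n]; [lia|].
    rewrite <- sum_n_csum; apply HN; lia.
  - intros H P HP; apply (locally_Cmod l) in HP; destruct HP as [d [Hd HP]].
    destruct (H d Hd) as [N HN]; exists N; intros n Hn; apply HP.
    change (Cmod (@sum_n C_AbelianMonoid u n - l) < d).
    rewrite sum_n_csum; apply HN; lia.
Qed.

Lemma cseries_unique u l l' : cseries u l -> cseries u l' -> l = l'.
Proof.
  intros H H'.
  replace l with ((l - l') + l') by ring; replace (l - l') with (RtoC 0); [ring|symmetry].
  apply Cmod_small_eq0; intros e He.
  destruct (H (e/2)%R) as [N HN]; [lra|]; destruct (H' (e/2)%R) as [N' HN']; [lra|].
  specialize (HN (N + N')%nat ltac:(lia)); specialize (HN' (N + N')%nat ltac:(lia)).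
  rewrite Cmod_sub_sym in HN.
  pose proof (Cmod_sub_tri l (csum u (N + N')) l'); lra.
Qed.

Lemma csum_ext u v n : (forall k, (k < n)%nat -> u k = v k) -> csum u n = csum v n.
Proof. induction n; intros H; simpl; [reflexivity|]; rewrite IHn, H; auto. Qed.

Lemma cseries_ext u v l : (forall k, u k = v k) -> cseries u l -> cseries v l.
Proof.
  intros E H e He; destruct (H e He) as [N HN]; exists N; intros n Hn.
  rewrite <- (csum_ext u v) by auto; auto.
Qed.

Lemma csum_scal c u n : csum (fun k => c * u k) n = c * csum u n.
Proof. induction n; simpl; [ring|rewrite IHn; ring]. Qed.

Lemma cseries_scal c u l : cseries u l -> cseries (fun k => c * u k) (c * l).
Proof.
  intros H e He.
  destruct (H (e / (Cmod c + 1))%R) as [N HN].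
  { apply Rdiv_lt_0_compat; [exact He|pose proof (Cmod_ge_0 c); lra]. }
  exists N; intros n Hn; specialize (HN n Hn).
  rewrite csum_scal; replace (c * csum u n - c * l) with (c * (csum u n - l)) by ring.
  rewrite Cmod_mult; pose proof (Cmod_ge_0 c).
  apply Rle_lt_trans with (Cmod c * (e / (Cmod c + 1)))%R; [nra|apply mul_div_succ_lt; lra].
Qed.

Lemma cseries_terms_bounded u l : cseries u l -> exists K, forall k, Cmod (u k) <= K.
Proof.
  intros H; destruct (H 1%R ltac:(lra)) as [N HN].
  assert (B : forall n, exists K, forall k, (k < n)%nat -> Cmod (u k) <= K).
  { induction n as [|n [K HK]]; [exists 0%R; lia|].
    exists (Rmax K (Cmod (u n))); intros k Hk.
    destruct (Nat.eq_dec k n) as [->|]; [apply Rmax_r|].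
    eapply Rle_trans; [apply HK; lia|apply Rmax_l]. }
  destruct (B N) as [K HK]; exists (Rmax K 2); intros k.
  destruct (Nat.le_gt_cases N k) as [h|h].
  - eapply Rle_trans; [|apply Rmax_r].
    pose proof (HN k h) as A1; pose proof (HN (S k) ltac:(lia)) as A2; simpl in A2.
    replace (u k) with ((csum u k + u k - l) - (csum u k - l)) by ring.
    unfold Cminus at 1; eapply Rle_trans; [apply Cmod_triangle|]; rewrite Cmod_opp; lra.
  - eapply Rle_trans; [apply HK, h|apply Rmax_l].
Qed.

Lemma csum_geo (c : nat -> C) (q : C) r K y M n : 0 < r -> 0 <= y < 1 -> 0 <= K ->
  (forall k, Cmod (c k) * r ^ k <= K) -> Cmod q <= y * r ->
  (Cmod (csum (fun k => (c k * q ^ k)%C) (M + n) - csum (fun k => (c k * q ^ k)%C) M) <= K * y ^ M / (1 - y))%R.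
Proof.
  intros Hr Hy HK Hc Hq.
  assert (T : forall k, Cmod (c k * q ^ k) <= K * y ^ k).
  { intros k; rewrite Cmod_mult, Cmod_pow.
    apply Rle_trans with (Cmod (c k) * (y * r) ^ k)%R.
    - apply Rmult_le_compat_l; [apply Cmod_ge_0|]; apply pow_incr; split; [apply Cmod_ge_0|exact Hq].
    - rewrite Rpow_mult_distr; specialize (Hc k).
      assert (0 <= y ^ k) by (apply pow_le; lra). nra. }
  (* The induction needs the exact finite geometric sum; [y ^ (M + n)] is dropped only
     afterwards. *)
  assert (B : (Cmod (csum (fun k => (c k * q ^ k)%C) (M + n) - csum (fun k => (c k * q ^ k)%C) M) 
     <= K * (y ^ M - y ^ (M + n)) / (1 - y))%R).
  { induction n.
    - rewrite Nat.add_0_r; replace (csum (fun k => (c k * q ^ k)%C) M - csum (fun k => (c k * q ^ k)%C) M) with (RtoC 0) by ring.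
      rewrite Cmod_0; right; field; lra.
    - rewrite Nat.add_succ_r; simpl csum.
      replace (csum (fun k => (c k * q ^ k)%C) (M + n) + c (M + n)%nat * q ^ (M + n) - csum (fun k => (c k * q ^ k)%C) M)
        with ((csum (fun k => (c k * q ^ k)%C) (M + n) - csum (fun k => (c k * q ^ k)%C) M) + c (M + n)%nat * q ^ (M + n)) by ring.
      eapply Rle_trans; [apply Cmod_triangle|].
      eapply Rle_trans; [apply Rplus_le_compat; [apply IHn|apply T]|].
      right; simpl; field; lra. }
  eapply Rle_trans; [exact B|].
  apply Rmult_le_compat_r; [left; apply Rinv_0_lt_compat; lra|].
  apply Rmult_le_compat_l; [exact HK|].
  assert (0 <= y ^ (M + n)) by (apply pow_le; lra). lra.
Qed.

Lemma cseries_geo_tail (c : nat -> C) (q S : C) r K y M : 0 < r -> 0 <= y < 1 -> 0 <= K ->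
  (forall k, Cmod (c k) * r ^ k <= K) -> Cmod q <= y * r ->
  cseries (fun k => (c k * q ^ k)%C) S ->
  (Cmod (S - csum (fun k => (c k * q ^ k)%C) M) <= K * y ^ M / (1 - y))%R.
Proof.
  intros Hr Hy HK Hc Hq HS; apply le_epsilon; intros e He.
  destruct (HS e He) as [N HN]; specialize (HN (M + N)%nat ltac:(lia)).
  rewrite Cmod_sub_sym in HN.
  pose proof (csum_geo c q r K y M N Hr Hy HK Hc Hq).
  pose proof (Cmod_sub_tri S (csum (fun k => (c k * q ^ k)%C) (M + N)) (csum (fun k => (c k * q ^ k)%C) M)). lra.
Qed.

(** In the coordinate [log q] the integrand is an exponential with nonzero frequency [k - N]; its
    primitive takes the same value at angles 0 and [2 PI]. *)
Lemma circle_power_int rho k N : 0 < rho -> (k < N)%nat ->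
  is_CInt (fun t => pol rho t ^ k / pol rho t ^ N) 0 (2 * PI) (RtoC 0).
Proof.
  intros Hr Hk.
  set (a := RtoC (INR k - INR N)).
  assert (Ha : a <> 0).
  { apply RtoC_neq0; apply lt_INR in Hk; lra. }
  assert (Hi : Ci <> 0) by (apply Cmod_gt_0; rewrite Cmod_Ci; lra).
  assert (E : forall t, pol rho t ^ k / pol rho t ^ N = cexp (a * (ln rho, t))).
  { intros t; rewrite pol_cexp_ln, !cexp_pow by exact Hr.
    unfold Cdiv; rewrite <- cexp_opp, <- cexp_plus; f_equal; unfold a; rewrite RtoC_minus; ring. }
  replace (RtoC 0) with (cexp (a * (ln rho, 2 * PI)%R) / (a * Ci) - cexp (a * (ln rho, 0%R)) / (a * Ci)).
  2:{ rewrite <- !E, pol_2PI; ring. }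
  assert (D : forall t, is_rderiv (fun t => cexp (a * (ln rho, t))) t ((a * Ci) * cexp (a * (ln rho, t)))).
  { intros t; apply (is_rderiv_cexp (fun t => a * (ln rho, t))).
    replace (a * Ci) with (0 * (ln rho, t) + a * Ci) by ring.
    apply (is_rderiv_mult (fun _ => a) (fun t => (ln rho, t))); [apply is_rderiv_const|].
    split; simpl; [exact (is_derive_const (V := R_NormedModule) (ln rho) t)|].
    exact (is_derive_id (K := R_AbsRing) t). }
  apply (is_CInt_derive (fun t => cexp (a * (ln rho, t)) / (a * Ci))); intros t _.
  - rewrite E.
    replace (cexp (a * (ln rho, t))) with (((a * Ci) * cexp (a * (ln rho, t))) * / (a * Ci) + cexp (a * (ln rho, t)) * 0)
      by (field; auto).
    apply (is_rderiv_mult (fun t => cexp (a * (ln rho, t))) (fun _ => / (a * Ci))); [apply D|apply is_rderiv_const].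
  - apply (cont_at_ext_loc _ (fun t => cexp (a * (ln rho, t))) _ t 1); [lra|auto|auto|].
    eapply is_rderiv_rcont, D.
Qed.

(** * Cauchy's formula and convergence of the power series on the unit disc *)

Section PowerSeries.
Variables (H : C -> C) (c : nat -> C) (r0 : R).
Hypothesis H_diff : forall q, 0 < Cmod q < 1 -> cdiff H q.
Hypothesis r0_pos : 0 < r0.
Hypothesis H_series : forall q, 0 < Cmod q < r0 -> cseries (fun k => (c k * q ^ k)%C) (H q).

Let P (N : nat) (q : C) : C := csum (fun k => (c k * q ^ k)%C) N.

(** The terms are bounded at radius [r = r0 / 2], so for [|q| < r / 2] the tail is geometric with
    ratio below [1/2]; this is the origin of [2 K / r^N]. The estimate makes the singularity of the
    Taylor quotients at 0 removable. *)
Lemma local_remainder N : exists C0 r1, (0 < r1) /\ (0 <= C0) /\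
  forall q, 0 < Cmod q < r1 -> Cmod ((H q - P N q)%C) <= C0 * Cmod q ^ N.
Proof.
  set (r := (r0 / 2)%R).
  destruct (cseries_terms_bounded _ _ (H_series (RtoC r) ltac:(rewrite Cmod_R, Rabs_pos_eq; unfold r; lra))) as [K HK].
  assert (HK' : forall k, Cmod (c k) * r ^ k <= K).
  { intros k; specialize (HK k); rewrite Cmod_mult, Cmod_pow, Cmod_R, Rabs_pos_eq in HK by (unfold r; lra); exact HK. }
  assert (K0 : 0 <= K) by (eapply Rle_trans; [apply Cmod_ge_0|apply (HK 0%nat)]).
  assert (Hr : 0 < r) by (unfold r; lra).
  exists (2 * K / r ^ N)%R, (r / 2)%R; split; [lra|]; split.
  { apply Rmult_le_pos; [lra|left; apply Rinv_0_lt_compat, pow_lt, Hr]. }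
  intros q Hq.
  assert (Hy : 0 <= Cmod q / r < / 2).
  { split; [apply Rmult_le_pos; [lra|left; apply Rinv_0_lt_compat, Hr]|].
    apply Rmult_lt_reg_r with r; [exact Hr|]. unfold Rdiv; rewrite Rmult_assoc, Rinv_l by lra; lra. }
  eapply Rle_trans; [apply (cseries_geo_tail c q (H q) r K (Cmod q / r)%R N Hr)|]; auto; try lra.
  - right; field; lra.
  - apply H_series; unfold r in Hq; lra.
  - unfold Rdiv at 2; rewrite Rpow_mult_distr, pow_inv.
    assert (Hp : 0 < / r ^ N) by apply Rinv_0_lt_compat, pow_lt, Hr.
    assert (Hq0 : 0 <= Cmod q ^ N) by (apply pow_le; lra).
    apply Rmult_le_reg_r with (1 - Cmod q / r)%R; [lra|].
    replace (K * (Cmod q ^ N * / r ^ N) / (1 - Cmod q / r) * (1 - Cmod q / r))%R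
      with (K * (Cmod q ^ N * / r ^ N))%R by (field; repeat split; try (apply pow_nonzero; lra); lra).
    unfold Rdiv at 1.
    assert (X : 0 <= K * (Cmod q ^ N * / r ^ N)) by (apply Rmult_le_pos; [lra|apply Rmult_le_pos; lra]).
    replace (2 * K * / r ^ N * Cmod q ^ N * (1 - Cmod q / r))%R with
      ((K * (Cmod q ^ N * / r ^ N)) * (2 * (1 - Cmod q / r)))%R by ring.
    nra.
Qed.

Lemma cdiff_P N q : cdiff (P N) q.
Proof.
  unfold P; induction N; simpl; [apply cdiff_const|].
  apply cdiff_plus; [exact IHN|].
  apply cdiff_mult; [apply cdiff_const|apply (cdiff_pow (fun q => q)), cdiff_id].
Qed.

(** The Taylor remainder divided by [q^N], with its limit at 0 put in by hand: the mean value
    property at the centre then returns exactly [c N]. *)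
Let quot (N : nat) (q : C) : C := if excluded_middle_informative (q = RtoC 0) then c N else (H q - P N q) / q ^ N.

Lemma quot_neq N (q : C) : q <> 0 -> quot N q = (H q - P N q) / q ^ N.
Proof. intros Hq; unfold quot; destruct (excluded_middle_informative _); [tauto|reflexivity]. Qed.

Lemma quot_diff N q : Cmod q < 1 -> cdiff (quot N) q.
Proof.
  intros Hq; destruct (excluded_middle_informative (q = RtoC 0)) as [->|n].
  (* Order [N + 2] is what differentiability at 0 takes: after removal of [c N] and [c (S N) * p]
     the quotient is [O(|p|^2)], so the derivative is [c (S N)]. *)
  - destruct (local_remainder (S (S N))) as [C0 [r1 [Hr1 [HC0 HB]]]].
    apply cdiff_of_is_derive_eps with (c (S N)); intros e He.
    exists (Rmin r1 (e / (C0 + 1))); split.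
    { apply Rmin_pos; [exact Hr1|apply Rdiv_lt_0_compat; lra]. }
    intros p; replace (p - 0) with p by ring; intros Hp.
    pose proof (Rlt_le_trans _ _ _ Hp (Rmin_l _ _)) as Hp1.
    pose proof (Rlt_le_trans _ _ _ Hp (Rmin_r _ _)) as Hp2.
    unfold quot; destruct (excluded_middle_informative (RtoC 0 = RtoC 0)) as [_|]; [|tauto].
    destruct (excluded_middle_informative (p = RtoC 0)) as [->|np].
    { replace (c N - c N - c (S N) * 0) with (RtoC 0) by ring; rewrite Cmod_0; lra. }
    assert (Hp0 : 0 < Cmod p) by now apply Cmod_gt_0.
    assert (HpN : p ^ N <> 0) by now apply Cpow_nz.
    replace ((H p - P N p) / p ^ N - c N - c (S N) * p) with ((H p - P (S (S N)) p) / p ^ N).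
    2:{ unfold P; simpl; field; exact HpN. }
    rewrite Cmod_div, Cmod_pow by exact HpN.
    specialize (HB p ltac:(lra)).
    assert (HN : 0 < Cmod p ^ N) by now apply pow_lt.
    apply Rmult_le_reg_r with (Cmod p ^ N)%R; [exact HN|].
    unfold Rdiv; rewrite Rmult_assoc, Rinv_l, Rmult_1_r by lra.
    eapply Rle_trans; [exact HB|]; simpl.
    assert (Hs : Cmod p * (C0 + 1) <= e).
    { apply Rle_trans with (e / (C0 + 1) * (C0 + 1))%R; [nra|right; field; lra]. }
    assert (0 < Cmod p * Cmod p ^ N) by nra. nra.
  - assert (Hp0 : 0 < Cmod q) by now apply Cmod_gt_0.
    apply (cdiff_ext_loc (fun q => (H q - P N q) / q ^ N) _ q (Cmod q) Hp0).
    + intros p Hp; rewrite quot_neq; [reflexivity|]; intros ->.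
      rewrite Cmod_sub_sym in Hp; replace (q - 0) with q in Hp by ring; lra.
    + apply cdiff_div; [|apply (cdiff_pow (fun q => q)), cdiff_id|now apply Cpow_nz].
      apply cdiff_minus; [apply H_diff; lra|apply cdiff_P].
Qed.

(** [H / q^N] is [quot N] plus the powers [q^(k-N)] with [k < N]. The former has mean [c N] on the
    circle, the latter have mean zero. *)
Lemma coef_integral N rho : 0 < rho < 1 ->
  is_CInt (fun t => H (pol rho t) / pol rho t ^ N) 0 (2 * PI) (RtoC (2 * PI) * c N).
Proof.
  intros Hr.
  assert (Hnz : forall t, pol rho t <> 0) by (intros t; apply Cmod_gt_0; rewrite Cmod_pol; lra).
  assert (A : is_CInt (fun t => quot N (pol rho t)) 0 (2 * PI) (RtoC (2 * PI) * c N)).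
  { apply mean_value; [lra|intros; apply quot_diff; lra|]; intros e He.
    destruct (cdiff_cont _ _ (quot_diff N 0 ltac:(rewrite Cmod_0; lra)) e He) as [d [Hd Hc]].
    exists d; split; [exact Hd|]; intros q Hq; left.
    replace (c N) with (quot N 0) by (unfold quot; destruct (excluded_middle_informative _); [reflexivity|tauto]).
    apply Hc; replace (q - 0) with q by ring; lra. }
  assert (B : forall M, (M <= N)%nat -> is_CInt (fun t => P M (pol rho t) / pol rho t ^ N) 0 (2 * PI) (RtoC 0)).
  { induction M; intros HM.
    - apply (is_CInt_ext (fun _ => RtoC 0)).
      + intros t _; unfold P; simpl; unfold Cdiv; ring.
      + pose proof (is_CInt_const (RtoC 0) 0 (2 * PI)) as Z.
        replace (RtoC (2 * PI - 0) * 0) with (RtoC 0) in Z by ring; exact Z.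
    - apply (is_CInt_ext (fun t => P M (pol rho t) / pol rho t ^ N + c M * (pol rho t ^ M / pol rho t ^ N))).
      + intros t _; unfold P; simpl; unfold Cdiv; ring.
      + pose proof (is_CInt_plus _ _ _ _ _ _ (IHM ltac:(lia))
          (is_CInt_scal (c M) _ _ _ _ (circle_power_int rho M N ltac:(lra) ltac:(lia)))) as Z.
        replace (0 + c M * 0) with (RtoC 0) in Z by ring; exact Z. }
  apply (is_CInt_ext (fun t => quot N (pol rho t) + P N (pol rho t) / pol rho t ^ N)).
  - intros t _; rewrite quot_neq by auto; unfold Cdiv.
    match goal with |- @eq _ ?x ?y => change (@eq C x y) end; ring.
  - pose proof (is_CInt_plus _ _ _ _ _ _ A (B N (le_n N))) as Z.
    replace (RtoC (2 * PI) * c N + 0) with (RtoC (2 * PI) * c N) in Z by ring; exact Z.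
Qed.

(** The majorant may depend on the angle; replacing a supremum by this average is what saves one
    power of [n] in the growth of the coefficients. *)
Lemma coef_bound N rho g (lg : R) : 0 < rho < 1 ->
  (forall t, 0 <= t <= 2 * PI -> Cmod (H (pol rho t)) <= g t) -> is_RInt g 0 (2 * PI) lg ->
  (2 * PI * (Cmod (c N) * rho ^ N) <= lg).
Proof.
  intros Hr Hg Ig; pose proof PI_RGT_0.
  assert (Hp : 0 < rho ^ N) by (apply pow_lt; lra).
  pose proof (coef_integral N rho Hr) as A.
  apply (is_CInt_scal (RtoC (rho ^ N))) in A.
  assert (Hb : forall t, 0 <= t <= 2 * PI -> Cmod (RtoC (rho ^ N) * (H (pol rho t) / pol rho t ^ N)) <= g t).
  { intros t Ht.
    assert (Hnz : pol rho t <> 0) by (apply Cmod_gt_0; rewrite Cmod_pol; lra).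
    rewrite Cmod_mult, Cmod_div, Cmod_R, Cmod_pow, Cmod_pol, Rabs_pos_eq by (try apply Cpow_nz; auto; lra).
    eapply Rle_trans; [|apply Hg, Ht]; right; field; lra. }
  pose proof (is_CInt_norm _ g 0 (2 * PI) _ lg ltac:(lra) Hb A Ig) as B.
  rewrite !Cmod_mult, !Cmod_R, !Rabs_pos_eq in B by lra. lra.
Qed.

(** The remainder at [x] is [x^N * quot N x]. The maximum principle on the circle of radius [r1 > x]
    bounds [quot N] by [M / r1^N], and [M] is independent of [N] because the coefficients are
    controlled at the larger radius [r2]. The remainder is then [O((x / r1)^N)]. *)
Lemma power_series_identity x :
  (forall rho, 1 / 2 <= rho < 1 -> exists K, forall q, Cmod q = rho -> Cmod (H q) <= K)%R ->
  (0 < x < 1) -> cseries (fun k => c k * RtoC x ^ k) (H (RtoC x)).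
Proof.
  intros HK Hx; pose proof PI_RGT_0.
  (* Both radii lie above [x] and above [1/2], where bounds on circles are assumed. *)
  set (r1 := ((2 + x) / 3)%R); set (r2 := ((5 + x) / 6)%R).
  assert (Hr1 : x < r1 < 1) by (unfold r1; lra).
  assert (Hr2 : r1 < r2 < 1) by (unfold r1, r2; lra).
  destruct (HK r1 ltac:(unfold r1; lra)) as [K1 HK1]; destruct (HK r2 ltac:(unfold r2; lra)) as [K2 HK2].
  assert (HK1' : 0 <= K1).
  { eapply Rle_trans; [apply Cmod_ge_0|apply (HK1 (RtoC r1))]; rewrite Cmod_R, Rabs_pos_eq; lra. }
  assert (HK2' : 0 <= K2).
  { eapply Rle_trans; [apply Cmod_ge_0|apply (HK2 (RtoC r2))]; rewrite Cmod_R, Rabs_pos_eq; lra. }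
  assert (Hc : forall k, Cmod (c k) * r2 ^ k <= K2).
  { intros k; pose proof (coef_bound k r2 (fun _ => K2) ((2 * PI - 0) * K2)%R ltac:(lra)) as HB.
    apply Rmult_le_reg_l with (2 * PI)%R; [lra|].
    eapply Rle_trans; [apply HB|right; ring].
    - intros t _; apply HK2, Cmod_pol; lra.
    - apply (is_RInt_const (V := R_NormedModule)). }
  set (y := (r1 / r2)%R).
  assert (Hy : 0 <= y < 1).
  { apply div_lt1; lra. }
  assert (HP : forall N q, Cmod q = r1 -> Cmod (P N q) <= K2 / (1 - y)).
  { intros N q Hq.
    pose proof (csum_geo c q r2 K2 y 0 N ltac:(lra) Hy HK2' Hc) as G.
    simpl in G; unfold P; replace (csum (fun k => (c k * q ^ k)%C) N) with (csum (fun k => (c k * q ^ k)%C) N - 0) by ring.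
    replace (K2 / (1 - y))%R with (K2 * 1 / (1 - y))%R by (field; lra).
    apply G; rewrite Hq; right; unfold y; field; lra. }
  set (M := (K1 + K2 / (1 - y))%R).
  assert (HM : 0 <= M).
  { unfold M; apply Rplus_le_le_0_compat; [exact HK1'|]; apply Rmult_le_pos; [exact HK2'|left; apply Rinv_0_lt_compat; lra]. }
  assert (Bd : forall N, Cmod (H (RtoC x) - P N (RtoC x)) <= M * (x / r1) ^ N).
  { intros N.
    assert (Hxn : RtoC x <> 0) by (apply RtoC_neq0; lra).
    assert (Q : Cmod (quot N (RtoC x)) <= M / r1 ^ N).
    { apply (max_principle _ r1); [lra|intros q Hq; apply quot_diff; lra|].
      intros q Hq; assert (q <> 0) by (apply Cmod_gt_0; lra).
      rewrite quot_neq, Cmod_div, Cmod_pow, Hq by (try apply Cpow_nz; auto).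
      apply Rmult_le_compat_r; [left; apply Rinv_0_lt_compat, pow_lt; lra|].
      unfold Cminus; eapply Rle_trans; [apply Cmod_triangle|]; rewrite Cmod_opp.
      unfold M; apply Rplus_le_compat; auto. }
    rewrite quot_neq, Cmod_div, Cmod_pow, Cmod_R, Rabs_pos_eq in Q by (try apply Cpow_nz; auto; lra).
    assert (Hp : 0 < x ^ N) by (apply pow_lt; lra).
    apply (Rmult_le_compat_r (x ^ N)) in Q; [|lra].
    unfold Rdiv in Q at 1; rewrite Rmult_assoc, Rinv_l, Rmult_1_r in Q by lra.
    eapply Rle_trans; [exact Q|right]; unfold Rdiv; rewrite Rpow_mult_distr, pow_inv; ring. }
  intros e He.
  destruct (pow_lt_1_zero (x / r1)%R) with (y := (e / (M + 1))%R) as [N HN].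
  { pose proof (div_lt1 x r1 ltac:(lra)); rewrite Rabs_pos_eq; lra. }
  { apply Rdiv_lt_0_compat; lra. }
  exists N; intros n Hn; rewrite Cmod_sub_sym; specialize (HN n Hn).
  eapply Rle_lt_trans; [apply Bd|].
  pose proof (Rle_abs ((x / r1) ^ n)) as Hab.
  apply Rle_lt_trans with (M * (e / (M + 1)))%R; [apply Rmult_le_compat_l; lra|apply mul_div_succ_lt; lra].
Qed.

End PowerSeries.

(** * The Gamma function *)

Notation is_CInt_gen f l :=
  (@is_RInt_gen C_R_NormedModule f (at_right 0) (Rbar_locally p_infty) l).

(** Imposing [al <= 1 <= be] ensures [t1 < t2], so the truncated integrals are always taken in the
    positive direction. *)
Definition gen_lim (Phi : R -> R -> C) (l : C) : Prop :=
  forall eps, 0 < eps -> exists al be, (0 < al <= 1) /\ (1 <= be) /\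
    forall t1 t2, 0 < t1 < al -> be < t2 -> Cmod (Phi t1 t2 - l) < eps.

Lemma filter_prod_intro (Q : R * R -> Prop) al be : 0 < al ->
  (forall t1 t2, 0 < t1 < al -> be < t2 -> Q (t1, t2)) ->
  filter_prod (at_right 0) (Rbar_locally p_infty) Q.
Proof.
  intros Ha HQ.
  exists (fun t1 => 0 < t1 < al)%R (fun t2 => be < t2)%R; [| |exact HQ].
  - exists (mkposreal al Ha); intros y Hy Hy0; split; [exact Hy0|].
    change (Rabs (y - 0) < al) in Hy; rewrite Rminus_0_r in Hy.
    pose proof (Rle_abs y); lra.
  - exists be; auto.
Qed.

Lemma filter_prod_elim (Q : R * R -> Prop) :
  filter_prod (at_right 0) (Rbar_locally p_infty) Q ->
  exists al be, (0 < al <= 1) /\ (1 <= be) /\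
    forall t1 t2, 0 < t1 < al -> be < t2 -> Q (t1, t2).
Proof.
  intros [P1 P2 [e He] [M HM] HQ].
  exists (Rmin e 1), (Rmax M 1); repeat split.
  - apply Rmin_pos; [apply cond_pos|lra].
  - apply Rmin_r.
  - apply Rmax_r.
  - intros t1 t2 [H1 H1'] H2; apply HQ.
    + apply He; [|exact H1].
      change (Rabs (t1 - 0) < e); rewrite Rminus_0_r, Rabs_pos_eq by lra.
      eapply Rlt_le_trans; [exact H1'|apply Rmin_l].
    + apply HM; eapply Rle_lt_trans; [apply Rmax_l|exact H2].
Qed.

Lemma gen_lim_of_filterlim Phi l :
  filterlim (fun p => Phi (fst p) (snd p))
    (filter_prod (at_right 0) (Rbar_locally p_infty)) (locally (T := C_UniformSpace) l) ->
  gen_lim Phi l.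
Proof.
  intros H e He.
  apply (filter_prod_elim (fun p => Cmod (Phi (fst p) (snd p) - l) < e)%R).
  apply (H (fun y => Cmod (y - l) < e)%R); apply locally_Cmod; exists e; auto.
Qed.

Lemma is_CInt_gen_intro f l :
  (forall t, 0 < t -> rcont f t) -> gen_lim (CInt f) l -> is_CInt_gen f l.
Proof.
  intros Hc H P HP; apply (locally_Cmod l) in HP; destruct HP as [d [Hd HP]].
  destruct (H d Hd) as [al [be [Ha [Hb HH]]]].
  apply (filter_prod_intro _ al be); [lra|]; intros t1 t2 H1 H2.
  exists (CInt f t1 t2); split; [|apply HP, HH; assumption].
  apply CInt_correct; intros t Ht; apply Hc.
  simpl in Ht; rewrite Rmin_left in Ht by lra; lra.
Qed.

Lemma is_CInt_gen_unique f l : is_CInt_gen f l ->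
  @RInt_gen C_R_CompleteNormedModule f (at_right 0) (Rbar_locally p_infty) = l.
Proof.
  intros H; apply (is_RInt_gen_unique (V := C_R_CompleteNormedModule)); exact H.
Qed.

Lemma gen_lim_close Phi l B : gen_lim Phi l ->
  (forall al be, 0 < al <= 1 -> 1 <= be -> exists t1 t2, (0 < t1 < al) /\ (be < t2) /\ (Cmod (Phi t1 t2) <= B)) ->
  (Cmod l <= B).
Proof.
  intros H HB; apply le_epsilon; intros e He.
  destruct (H e He) as [al [be [Ha [Hb HH]]]].
  destruct (HB al be Ha Hb) as [t1 [t2 [H1 [H2 H3]]]].
  specialize (HH t1 t2 H1 H2); rewrite Cmod_sub_sym in HH.
  pose proof (Cmod_le_add l (Phi t1 t2)); lra.
Qed.

Lemma gen_lim_bound Phi l B : gen_lim Phi l ->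
  (forall t1 t2, 0 < t1 <= t2 -> Cmod (Phi t1 t2) <= B) -> Cmod l <= B.
Proof.
  intros H HB; apply (gen_lim_close Phi); [exact H|]; intros al be Ha Hb.
  exists (al / 2)%R, (be + 1)%R; repeat split; try lra; apply HB; lra.
Qed.

Lemma gen_lim_plus Phi Psi l l' :
  gen_lim Phi l -> gen_lim Psi l' -> gen_lim (fun a b => Phi a b + Psi a b) (l + l').
Proof.
  intros H H' e He.
  destruct (H (e/2)%R) as [a1 [b1 [A1 [B1 H1]]]]; [lra|].
  destruct (H' (e/2)%R) as [a2 [b2 [A2 [B2 H2]]]]; [lra|].
  exists (Rmin a1 a2), (Rmax b1 b2); repeat split.
  - apply Rmin_pos; lra.
  - eapply Rle_trans; [apply Rmin_l|lra].
  - eapply Rle_trans; [|apply Rmax_l]; lra.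
  - intros t1 t2 Ht1 Ht2.
    pose proof (Rmin_l a1 a2); pose proof (Rmin_r a1 a2); pose proof (Rmax_l b1 b2); pose proof (Rmax_r b1 b2).
    specialize (H1 t1 t2 ltac:(lra) ltac:(lra)); specialize (H2 t1 t2 ltac:(lra) ltac:(lra)).
    replace (Phi t1 t2 + Psi t1 t2 - (l + l')) with ((Phi t1 t2 - l) + (Psi t1 t2 - l')) by ring.
    eapply Rle_lt_trans; [apply Cmod_triangle|lra].
Qed.

Lemma gen_lim_scal c Phi l : gen_lim Phi l -> gen_lim (fun a b => c * Phi a b) (c * l).
Proof.
  intros H e He; pose proof (Cmod_ge_0 c).
  destruct (H (e / (Cmod c + 1))%R) as [a1 [b1 [A1 [B1 H1]]]]; [apply Rdiv_lt_0_compat; lra|].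
  exists a1, b1; split; [exact A1|split; [exact B1|]]; intros t1 t2 Ht1 Ht2.
  specialize (H1 t1 t2 Ht1 Ht2).
  replace (c * Phi t1 t2 - c * l) with (c * (Phi t1 t2 - l)) by ring; rewrite Cmod_mult.
  apply Rle_lt_trans with (Cmod c * (e / (Cmod c + 1)))%R; [nra|apply mul_div_succ_lt; lra].
Qed.

Lemma gen_lim_ext Phi Psi l : (forall t1 t2, 0 < t1 < t2 -> Phi t1 t2 = Psi t1 t2) ->
  gen_lim Phi l -> gen_lim Psi l.
Proof.
  intros E H e He; destruct (H e He) as [a1 [b1 [A1 [B1 H1]]]].
  exists a1, b1; split; [exact A1|split; [exact B1|]]; intros t1 t2 Ht1 Ht2.
  rewrite <- E by lra; auto.
Qed.

Lemma gen_lim_unique Phi l l' : gen_lim Phi l -> gen_lim Phi l' -> l = l'.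
Proof.
  intros H H'.
  assert (Z : Cmod (l + - (1) * l') = 0%R).
  { apply Rle_antisym; [|apply Cmod_ge_0].
    apply (gen_lim_bound (fun a b => Phi a b + - (1) * Phi a b)).
    - apply gen_lim_plus; [exact H|now apply gen_lim_scal].
    - intros t1 t2 _; replace (Phi t1 t2 + - (1) * Phi t1 t2) with (RtoC 0) by ring; rewrite Cmod_0; lra. }
  apply Cmod_eq_0 in Z; replace l with ((l + - (1) * l') + l') by ring; rewrite Z; ring.
Qed.

Definition pcont (f : R -> C) : Prop := forall t, 0 < t -> rcont f t.

Lemma pcont_CInt f t1 t2 : pcont f -> 0 < t1 <= t2 -> is_CInt f t1 t2 (CInt f t1 t2).
Proof.
  intros H Ht; apply CInt_correct; intros t Ht'; apply H; rewrite Rmin_left in Ht'; lra.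
Qed.

Lemma pos_RInt (g : R -> R) t1 t2 : (forall t, 0 < t -> continuous g t) -> 0 < t1 <= t2 ->
  is_RInt g t1 t2 (RInt g t1 t2).
Proof.
  intros H Ht; apply continuous_is_RInt.
  intros t Ht'; apply H; rewrite Rmin_left in Ht'; lra.
Qed.

(** The integrals of [g] over compact intervals have a supremum. An interval coming within [eps] of
    it leaves at most [eps] of mass on its two sides together, which is the Cauchy criterion for the
    integrals of [f]. *)
Lemma dominated_gen_lim (f : R -> C) (g : R -> R) M : pcont f ->
  (forall t, 0 < t -> continuous g t) -> (forall t, 0 < t -> Cmod (f t) <= g t) ->
  (forall t1 t2, 0 < t1 <= t2 -> RInt g t1 t2 <= M) -> exists l, gen_lim (CInt f) l.
Proof.
  intros Hf Hg Hfg HM.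
  destruct (completeness (fun x => exists t1 t2, (0 < t1 <= t2) /\ x = RInt g t1 t2)) as [S [HS1 HS2]].
  { exists M; intros x [t1 [t2 [Ht ->]]]; auto. }
  { exists (RInt g 1 1), 1%R, 1%R; split; [lra|reflexivity]. }
  assert (Hn : forall t1 t2, 0 < t1 <= t2 -> Cmod (CInt f t1 t2) <= RInt g t1 t2).
  { intros t1 t2 Ht; eapply is_CInt_norm; [apply Ht| |apply pcont_CInt; auto|apply pos_RInt; auto].
    intros t Ht'; apply Hfg; lra. }
  assert (Cau : forall eps, 0 < eps -> exists a b, (0 < a <= b) /\ forall t1 t2, 0 < t1 <= a -> b <= t2 ->
     (Cmod (CInt f t1 t2 - CInt f a b) <= eps)).
  { intros eps He.
    assert (Hex : exists a b, (0 < a <= b) /\ (S - eps < RInt g a b)).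
    { apply Classical_Prop.NNPP; intros N; apply (Rlt_irrefl S).
      apply Rle_lt_trans with (S - eps)%R; [|lra].
      apply HS2; intros x [a [b [Hab ->]]]; apply Rnot_lt_le; intros L; apply N; exists a, b; auto. }
    destruct Hex as [a [b [Hab Hlt]]]; exists a, b; split; [exact Hab|]; intros t1 t2 H1 H2.
    assert (E : CInt f t1 t2 = CInt f t1 a + CInt f a b + CInt f b t2).
    { apply is_CInt_unique; apply is_CInt_Chasles with b; [apply is_CInt_Chasles with a|];
        apply pcont_CInt; auto; lra. }
    assert (E' : (RInt g t1 t2 = RInt g t1 a + RInt g a b + RInt g b t2)%R).
    { apply is_RInt_unique. apply (is_RInt_Chasles (V := R_NormedModule) g t1 b t2);
       [apply (is_RInt_Chasles (V := R_NormedModule) g t1 a b)|]; apply pos_RInt; auto; lra. }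
    rewrite E; replace (CInt f t1 a + CInt f a b + CInt f b t2 - CInt f a b) with (CInt f t1 a + CInt f b t2) by ring.
    eapply Rle_trans; [apply Cmod_triangle|].
    pose proof (Hn t1 a ltac:(lra)); pose proof (Hn b t2 ltac:(lra)).
    assert (RInt g t1 t2 <= S) by (apply HS1; exists t1, t2; split; [lra|reflexivity]). lra. }
  assert (PF : ProperFilter (filter_prod (at_right 0) (Rbar_locally p_infty))).
  { apply filter_prod_proper. }
  destruct (proj1 (filterlim_locally_cauchy (U := C_R_CompleteNormedModule) (F := filter_prod (at_right 0) (Rbar_locally p_infty))
     (fun p => CInt f (fst p) (snd p)))) as [l Hl].
  - intros e; destruct (Cau (e / 3)%R) as [a [b [Hab HH]]]; [pose proof (cond_pos e); lra|].
    exists (fun p => (0 < fst p < a) /\ (b < snd p)); split.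
    + apply (filter_prod_intro _ a b); [lra|]; intros t1 t2 H1 H2; simpl; lra.
    + intros [u1 u2] [v1 v2]; simpl; intros [Hu1 Hu2] [Hv1 Hv2].
      apply C_NormedModule_mixin_compat1.
      change (Cmod (CInt f v1 v2 - CInt f u1 u2) < e).
      pose proof (HH u1 u2 ltac:(lra) ltac:(lra)) as A1; rewrite Cmod_sub_sym in A1.
      pose proof (HH v1 v2 ltac:(lra) ltac:(lra)) as A2.
      pose proof (Cmod_sub_tri (CInt f v1 v2) (CInt f a b) (CInt f u1 u2)); pose proof (cond_pos e); lra.
  - exists l; apply gen_lim_of_filterlim; exact Hl.
Qed.

(** The Euler integral, the Beta integral and the circle kernel are all bounded in this way, by a
    majorant with an elementary primitive. *)
Lemma RInt_le_primitive_on (g G dG : R -> R) t1 t2 : t1 <= t2 ->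
  (forall t, t1 <= t <= t2 -> continuous g t) -> (forall t, t1 <= t <= t2 -> is_derive G t (dG t)) ->
  (forall t, t1 <= t <= t2 -> continuous dG t) -> (forall t, t1 <= t <= t2 -> g t <= dG t) ->
  (RInt g t1 t2 <= G t2 - G t1).
Proof.
  intros Ht Hg HG HdG Hle.
  assert (I : is_RInt dG t1 t2 (G t2 - G t1)%R).
  { apply (is_RInt_derive (V := R_CompleteNormedModule) G dG); intros t Ht';
      rewrite Rmin_left, Rmax_right in Ht' by lra; auto. }
  apply (is_RInt_le g dG t1 t2); auto.
  - apply continuous_is_RInt.
    intros t Ht'; rewrite Rmin_left, Rmax_right in Ht' by lra; auto.
  - intros t Ht'; apply Hle; lra.
Qed.

Lemma RInt_le_primitive (g G dG : R -> R) t1 t2 : 0 < t1 <= t2 ->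
  (forall t, 0 < t -> continuous g t) -> (forall t, 0 < t -> is_derive G t (dG t)) ->
  (forall t, 0 < t -> continuous dG t) -> (forall t, 0 < t -> g t <= dG t) ->
  (RInt g t1 t2 <= G t2 - G t1).
Proof.
  intros Ht Hg HG HdG Hle; apply (RInt_le_primitive_on g G dG); [lra|intros t Ht'..];
    [apply Hg|apply HG|apply HdG|apply Hle]; lra.
Qed.

Definition gint (z : C) (t : R) : C := cexp ((z - 1) * RtoC (ln t)) * RtoC (exp (- t)).
Definition greal (x t : R) : R := (exp ((x - 1) * ln t) * exp (- t))%R.

Lemma pcont_cexp_lin (a : C) (g : R -> R) t :
  continuous g t -> rcont (fun t => cexp (a * RtoC (g t))) t.
Proof.
  intros Hg; apply (cont_at_comp _ (fun t => a * RtoC (g t)) cexp).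
  - apply cont_at_mult; [apply cont_at_const|now apply rcont_RtoC].
  - apply cdiff_cont, cdiff_cexp.
Qed.

Lemma gint_cont z : pcont (gint z).
Proof.
  intros t Ht; apply cont_at_mult.
  - apply pcont_cexp_lin, ex_derive_cont; auto_derive; auto.
  - apply rcont_RtoC, ex_derive_cont; auto_derive; auto.
Qed.

Lemma greal_cont x t : 0 < t -> continuous (greal x) t.
Proof.
  intros Ht; apply ex_derive_cont; unfold greal; auto_derive; auto.
Qed.

Lemma Cmod_gint z t : Cmod (gint z t) = greal (Re z) t.
Proof.
  unfold gint, greal; rewrite Cmod_mult, Cmod_cexp, Cmod_R, Rabs_pos_eq by (left; apply exp_pos).
  f_equal; f_equal; destruct z as [x y]; simpl; ring.
Qed.

Lemma ln_le_sub1 y : (0 < y -> ln y <= y - 1).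
Proof.
  intros Hy; pose proof (exp_ineq1_le (ln y)); rewrite exp_ln in H by exact Hy; lra.
Qed.

(** The majorant is [A t^(x-1) (1+t)^(-(x+1))], with primitive [(A/x) (t/(1+t))^x <= A/x]. The
    constant [A] is the maximum of [(1+t)^K e^(-t)], reached at [1 + t = K]. *)
Lemma greal_int_bound x : 0 < x ->
  exists M, (0 < M) /\ forall t1 t2, 0 < t1 <= t2 -> RInt (greal x) t1 t2 <= M.
Proof.
  intros Hx; set (K := (x + 1)%R); set (A := exp (K * ln K + 1 - K)).
  assert (HA : 0 < A) by apply exp_pos.
  exists (A / x)%R; split; [apply Rdiv_lt_0_compat; lra|]; intros t1 t2 Ht.
  set (G := fun t => (A * (exp (x * (ln t - ln (1 + t))) / x))%R).
  set (dG := fun t => (A * (exp ((x - 1) * ln t) * exp (- (K * ln (1 + t)))))%R).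
  assert (HG : RInt (greal x) t1 t2 <= G t2 - G t1).
  { apply (RInt_le_primitive _ G dG); auto.
    - apply greal_cont.
    - intros t H; unfold G, dG; auto_derive; [repeat split; lra|].
      replace (exp (x * (ln t + - ln (1 + t))))%R with (exp ((x - 1) * ln t) * exp (- (K * ln (1 + t))) * (exp (ln t) * exp (ln (1 + t))))%R.
      + rewrite !exp_ln by lra; field; lra.
      + rewrite <- !exp_plus; f_equal; unfold K; ring.
    - intros t H; apply ex_derive_cont; unfold dG; auto_derive; repeat split; lra.
    - intros t H; unfold greal, dG.
      replace (A * (exp ((x - 1) * ln t) * exp (- (K * ln (1 + t)))))%R with
        (exp ((x - 1) * ln t) * (A * exp (- (K * ln (1 + t)))))%R by ring.
      apply Rmult_le_compat_l; [left; apply exp_pos|].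
      unfold A; rewrite <- exp_plus; apply exp_le_compat.
      assert (HK : 0 < K) by (unfold K; lra).
      pose proof (ln_le_sub1 ((1 + t) / K) ltac:(apply Rdiv_lt_0_compat; lra)) as L.
      unfold Rdiv in L at 1; rewrite ln_mult, ln_Rinv in L by (try apply Rinv_0_lt_compat; lra).
      apply (Rmult_le_compat_l K) in L; [|lra].
      replace (K * ((1 + t) / K - 1))%R with (1 + t - K)%R in L by (field; lra). lra. }
  assert (G0 : 0 <= G t1).
  { unfold G; apply Rmult_le_pos; [lra|]; apply Rmult_le_pos; [left; apply exp_pos|left; apply Rinv_0_lt_compat; lra]. }
  assert (G1 : G t2 <= A / x).
  { unfold G, Rdiv; apply Rmult_le_compat_l; [lra|].
    rewrite <- (Rmult_1_l (/ x)) at 2; apply Rmult_le_compat_r; [left; apply Rinv_0_lt_compat; lra|].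
    apply exp_le1.
    assert (ln t2 <= ln (1 + t2)) by (left; apply ln_increasing; lra). assert (0 <= x * (ln (1 + t2) - ln t2)) by (apply Rmult_le_pos; lra). lra. }
  lra.
Qed.

Lemma CGamma_lim z : 0 < Re z -> gen_lim (CInt (gint z)) (CGamma z).
Proof.
  intros Hz; destruct (greal_int_bound (Re z) Hz) as [M [_ HM]].
  destruct (dominated_gen_lim (gint z) (greal (Re z)) M) as [l Hl]; auto.
  - apply gint_cont.
  - intros; now apply greal_cont.
  - intros; right; apply Cmod_gint.
  - replace (CGamma z) with l; [exact Hl|symmetry].
    exact (is_CInt_gen_unique (gint z) l (is_CInt_gen_intro (gint z) l (gint_cont z) Hl)).
Qed.

(** The two functions are defined by separate improper integrals; their truncations agree, and the
    imaginary part is zero before the limit. *)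
Lemma RGamma_CGamma x : 0 < x -> CGamma (RtoC x) = RtoC (RGamma x).
Proof.
  intros Hx; pose proof (CGamma_lim (RtoC x) Hx) as HL.
  assert (E : forall t, gint (RtoC x) t = RtoC (Rpower t (x - 1) * exp (- t))).
  { intros t; unfold gint, Rpower; rewrite RtoC_mult; f_equal.
    rewrite <- cexp_RtoC; f_equal; now rewrite RtoC_mult, RtoC_minus. }
  assert (Im0 : Im (CGamma (RtoC x)) = 0%R).
  { apply Rabs_eq_0, Rle_antisym; [|apply Rabs_pos]; apply le_epsilon; intros e He.
    destruct (HL e He) as [al [be [Ha [Hb HH]]]].
    specialize (HH (al / 2)%R (be + 1)%R ltac:(lra) ltac:(lra)).
    pose proof (im_le_Cmod (CInt (gint (RtoC x)) (al / 2) (be + 1) - CGamma (RtoC x))) as L.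
    assert (Z : CInt (gint (RtoC x)) (al / 2) (be + 1) = RtoC (RInt (fun t => Rpower t (x - 1) * exp (- t))%R (al / 2) (be + 1))).
    { apply is_CInt_unique; eapply is_CInt_ext; [intros t _; symmetry; apply E|].
      apply is_CInt_RtoC; apply pos_RInt; [|lra].
      intros t Ht; apply (greal_cont x t Ht). }
    assert (HI : Im (CInt (gint (RtoC x)) (al / 2) (be + 1) - CGamma (RtoC x)) = (- Im (CGamma (RtoC x)))%R).
    { rewrite Z; simpl; unfold Im; ring. }
    rewrite HI, Rabs_Ropp in L; lra. }
  assert (R0 : RGamma x = Re (CGamma (RtoC x))).
  { apply (is_RInt_gen_unique (V := R_CompleteNormedModule) (fun t => Rpower t (x - 1) * exp (- t))%R); intros P [e He].
    pose proof (is_CInt_gen_intro _ _ (gint_cont (RtoC x)) HL) as HG.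
    specialize (HG (fun c => P (Re c))).
    assert (LQ : locally (T := C_R_NormedModule) (CGamma (RtoC x)) (fun c => P (Re c))).
    { apply (locally_Cmod (CGamma (RtoC x))); exists e; split; [apply cond_pos|]; intros y Hy; apply He.
      change (Rabs (Re y - Re (CGamma (RtoC x))) < e).
      eapply Rle_lt_trans; [apply (re_le_Cmod (y - CGamma (RtoC x)))|exact Hy]. }
    specialize (HG LQ); unfold filtermapi in *; revert HG; apply filter_imp.
    intros [t1 t2] [y [Hy1 Hy2]]; exists (Re y); split; [|exact Hy2]; simpl in *.
    apply is_CInt_pair in Hy1; destruct Hy1 as [Hy1 _].
    apply (is_RInt_ext (V := R_NormedModule) (fun t => Re (gint (RtoC x) t))); [|exact Hy1].
    intros t _; rewrite E; reflexivity. }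
  rewrite R0; destruct (CGamma (RtoC x)) as [u v]; simpl in *; rewrite Im0; reflexivity.
Qed.

(** Stated in a general module to serve both a complex integrand and its real majorant. The
    substitution [u = N e^(-t)] reverses orientation, hence the exchanged bounds. *)
Lemma is_RInt_subst_exp {V : CompleteNormedModule R_AbsRing} (f : R -> V) N t1 t2 :
  (0 < N) -> (forall u, 0 < u -> continuous f u) ->
  is_RInt (fun t => scal (N * exp (- t))%R (f (N * exp (- t))%R)) t1 t2
    (RInt f (N * exp (- t2)) (N * exp (- t1))).
Proof.
  intros HN Hf.
  assert (Hu : forall t, 0 < N * exp (- t)) by (intros; apply Rmult_lt_0_compat; [exact HN|apply exp_pos]).
  assert (I : is_RInt (fun y => scal (- (N * exp (- y)))%R (f (N * exp (- y))%R)) t1 t2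
     (RInt f (N * exp (- t1)) (N * exp (- t2)))).
  { apply (is_RInt_comp f (fun t => N * exp (- t))%R (fun t => - (N * exp (- t)))%R).
    - intros; apply Hf, Hu.
    - intros t _; split; [auto_derive; auto; ring|].
      apply ex_derive_cont; auto_derive; auto. }
  apply is_RInt_opp in I.
  rewrite <- (opp_RInt_swap f (N * exp (- t1)) (N * exp (- t2))).
  - eapply is_RInt_ext; [|exact I]; intros t _; simpl.
    refine (eq_trans (eq_sym (scal_opp_l _ _)) _); f_equal; unfold opp; simpl; ring.
  - apply ex_RInt_continuous; intros u Hu'; apply Hf.
    apply Rlt_le_trans with (Rmin (N * exp (- t1)) (N * exp (- t2))); [apply Rmin_pos; apply Hu|apply Hu'].
Qed.

Lemma CInt_subst_exp f N t1 t2 : 0 < N -> pcont f ->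
  is_CInt (fun t => RtoC (N * exp (- t)) * f (N * exp (- t))%R) t1 t2
    (CInt f (N * exp (- t2)) (N * exp (- t1))).
Proof.
  intros HN Hf.
  eapply is_CInt_ext; [|apply (is_RInt_subst_exp (V := C_R_CompleteNormedModule) f N t1 t2 HN)].
  - intros t _; unfold scal; simpl; unfold prod_scal, Cmult, RtoC; simpl.
    unfold scal; simpl; unfold mult; simpl; f_equal; ring.
  - intros u Hu; apply rcont_continuous, Hf, Hu.
Qed.

(** [M] is a bound for the Euler integral itself and so does not depend on the scale [N]; Gauss's
    limit and the decay of the Beta integral rest on this uniformity. *)
Lemma greal_subst_bound x : 0 < x -> exists M, (0 < M) /\ forall N t1 t2, 0 < N -> 0 < t1 <= t2 ->
  exists I, is_RInt (fun t => N * exp (- t) * greal x (N * exp (- t)))%R t1 t2 I /\ (I <= M).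
Proof.
  intros Hx; destruct (greal_int_bound x Hx) as [M [HM0 HM]]; exists M; split; [exact HM0|].
  intros N t1 t2 HN Ht; exists (RInt (greal x) (N * exp (- t2)) (N * exp (- t1))); split.
  - exact (is_RInt_subst_exp (V := R_CompleteNormedModule) (greal x) N t1 t2 HN (greal_cont x)).
  - apply HM; split; [apply Rmult_lt_0_compat; [exact HN|apply exp_pos]|].
    apply Rmult_le_compat_l; [lra|apply exp_le_compat; lra].
Qed.

(** * The Beta integral and Gauss's limit *)

Definition bint (z : C) (b t : R) : C := cexp (- z * RtoC t) * RtoC (Rpower (1 - exp (- t)) (b - 1)).
Definition breal (x b t : R) : R := (exp (- (x * t)) * Rpower (1 - exp (- t)) (b - 1))%R.

Definition CBeta (z : C) (b : R) : C :=
  @RInt_gen C_R_CompleteNormedModule (bint z b) (at_right 0) (Rbar_locally p_infty).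

Lemma exp_opp_lt1 t : 0 < t -> 0 < exp (- t) < 1.
Proof. intros H; split; [apply exp_pos|]; rewrite <- exp_0; apply exp_increasing; lra. Qed.

Lemma continuous_Rpower_1mexp e t : 0 < t -> continuous (fun t => Rpower (1 - exp (- t)) e) t.
Proof.
  intros H; pose proof (exp_opp_lt1 t H).
  apply ex_derive_cont; unfold Rpower; auto_derive; lra.
Qed.

Lemma bint_cont z b : pcont (bint z b).
Proof.
  intros t Ht; apply cont_at_mult.
  - apply (pcont_cexp_lin (- z) (fun t => t)), continuous_id.
  - now apply rcont_RtoC, continuous_Rpower_1mexp.
Qed.

Lemma breal_cont x b t : 0 < t -> continuous (breal x b) t.
Proof.
  intros Ht; pose proof (exp_opp_lt1 t Ht).
  apply ex_derive_cont; unfold breal, Rpower; auto_derive; lra.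
Qed.

Lemma Cmod_bint z b t : Cmod (bint z b t) = breal (Re z) b t.
Proof.
  unfold bint, breal; rewrite Cmod_mult, Cmod_cexp, Cmod_R, Rabs_pos_eq by (left; apply exp_pos).
  f_equal; f_equal; destruct z as [x y]; simpl; ring.
Qed.

(** With [s = e^(-t)]: if [s <= 1/2], then [(1-s)^(b-1) <= 1/(1-s) <= 2]; otherwise
    [e^(-xt) <= 1 <= 2 s]. The sum of the two resulting majorants has an elementary primitive. *)
Lemma breal_bound x b t1 t2 : 0 < x -> 0 < b -> 0 < t1 <= t2 ->
  (RInt (breal x b) t1 t2 <= 2 * (/ x + / b)).
Proof.
  intros Hx Hb Ht.
  set (G := fun t => (2 * (- (exp (- (x * t)) / x) + Rpower (1 - exp (- t)) b / b))%R).
  set (dG := fun t => (2 * (exp (- (x * t)) + exp (- t) * Rpower (1 - exp (- t)) (b - 1)))%R).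
  assert (HG : RInt (breal x b) t1 t2 <= G t2 - G t1).
  { apply (RInt_le_primitive _ G dG); auto.
    - apply breal_cont.
    - intros t H; pose proof (exp_opp_lt1 t H); unfold G, dG, Rpower; auto_derive; [lra|].
      replace (exp ((b - 1) * ln (1 - exp (- t)))) with (exp (b * ln (1 - exp (- t))) * / (1 - exp (- t)))%R.
      + unfold Rminus; field; lra.
      + rewrite <- (exp_ln (1 - exp (- t))) at 2 by lra; rewrite <- exp_Ropp, <- exp_plus; f_equal; ring.
    - intros t H; pose proof (exp_opp_lt1 t H).
      apply ex_derive_cont; unfold dG, Rpower; auto_derive; lra.
    - intros t H; pose proof (exp_opp_lt1 t H) as Hs; unfold breal, dG.
      set (s := exp (- t)) in *.
      assert (P1 : 0 < Rpower (1 - s) (b - 1)) by apply exp_pos.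
      assert (P2 : 0 < exp (- (x * t)) <= 1).
      { split; [apply exp_pos|]; apply exp_le1; assert (0 < x * t) by now apply Rmult_lt_0_compat. lra. }
      destruct (Rle_dec s (1 / 2)) as [h|h].
      + assert (P3 : Rpower (1 - s) (b - 1) <= 2).
        { apply Rle_trans with (exp (- ln (1 - s))).
          - apply exp_le_compat; pose proof (ln_le_sub1 (1 - s) ltac:(lra)); nra.
          - rewrite exp_Ropp, exp_ln by lra.
            apply Rmult_le_reg_r with (1 - s)%R; [lra|]; rewrite Rinv_l; lra. }
        assert (0 < s * Rpower (1 - s) (b - 1)) by nra. nra.
      + assert (exp (- (x * t)) <= 2 * s) by lra. nra. }
  assert (G1 : - (2 * / x) <= G t1).
  { unfold G; assert (0 < Rpower (1 - exp (- t1)) b / b) by (apply Rdiv_lt_0_compat; [apply exp_pos|lra]).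
    assert (exp (- (x * t1)) / x <= / x); [|lra].
    unfold Rdiv; rewrite <- (Rmult_1_l (/ x)) at 2; apply Rmult_le_compat_r; [left; apply Rinv_0_lt_compat; lra|].
    apply exp_le1.
    assert (0 < x * t1) by (apply Rmult_lt_0_compat; lra). lra. }
  assert (G2 : G t2 <= 2 * / b).
  { unfold G; assert (0 < exp (- (x * t2)) / x) by (apply Rdiv_lt_0_compat; [apply exp_pos|lra]).
    assert (Rpower (1 - exp (- t2)) b / b <= / b); [|lra].
    unfold Rdiv; rewrite <- (Rmult_1_l (/ b)) at 2; apply Rmult_le_compat_r; [left; apply Rinv_0_lt_compat; lra|].
    apply exp_le1.
    pose proof (exp_opp_lt1 t2 ltac:(lra)).
    pose proof (ln_le_sub1 (1 - exp (- t2)) ltac:(lra)); nra. }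
  lra.
Qed.

Lemma CInt_bint_bound z b t1 t2 : 0 < Re z -> 0 < b -> 0 < t1 <= t2 ->
  (Cmod (CInt (bint z b) t1 t2) <= 2 * (/ Re z + / b)).
Proof.
  intros Hz Hb Ht; eapply Rle_trans; [|apply (breal_bound (Re z) b t1 t2); auto].
  eapply is_CInt_norm; [apply Ht| |apply pcont_CInt; [apply bint_cont|exact Ht]|apply pos_RInt; [apply breal_cont|exact Ht]].
  intros; right; apply Cmod_bint.
Qed.

Lemma CBeta_lim z b : 0 < Re z -> 0 < b -> gen_lim (CInt (bint z b)) (CBeta z b).
Proof.
  intros Hz Hb.
  destruct (dominated_gen_lim (bint z b) (breal (Re z) b) (2 * (/ Re z + / b))) as [l Hl].
  - apply bint_cont.
  - intros; now apply breal_cont.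
  - intros; right; apply Cmod_bint.
  - intros; now apply breal_bound.
  - replace (CBeta z b) with l; [exact Hl|symmetry].
    exact (is_CInt_gen_unique (bint z b) l (is_CInt_gen_intro (bint z b) l (bint_cont z b) Hl)).
Qed.

Lemma gen_lim_boundary (phi : R -> C) (L : C) :
  (forall eps, 0 < eps -> exists d, 0 < d /\ forall t, 0 < t < d -> Cmod (phi t - L) < eps) ->
  (forall eps, 0 < eps -> exists M, forall t, M < t -> Cmod (phi t) < eps) ->
  gen_lim (fun t1 t2 => phi t2 - phi t1) (- L).
Proof.
  intros H0 Hi e He.
  destruct (H0 (e/2)%R) as [d [Hd A]]; [lra|]; destruct (Hi (e/2)%R) as [M B]; [lra|].
  exists (Rmin d 1), (Rmax M 1); repeat split.
  - apply Rmin_pos; lra.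
  - apply Rmin_r.
  - apply Rmax_r.
  - intros t1 t2 H1 H2; pose proof (Rmin_l d 1); pose proof (Rmax_l M 1).
    specialize (A t1 ltac:(lra)); specialize (B t2 ltac:(lra)).
    replace (phi t2 - phi t1 - - L) with (phi t2 - (phi t1 - L)) by ring.
    unfold Cminus at 1; eapply Rle_lt_trans; [apply Cmod_triangle|]; rewrite Cmod_opp; lra.
Qed.

Lemma exp_decay x : 0 < x -> forall eps, 0 < eps -> exists M, forall t, M < t -> exp (- (x * t)) < eps.
Proof.
  intros Hx eps He; exists (- ln eps / x)%R; intros t Ht.
  rewrite <- (exp_ln eps) by exact He; apply exp_increasing.
  apply (Rmult_lt_compat_l x) in Ht; [|exact Hx].
  replace (x * (- ln eps / x))%R with (- ln eps)%R in Ht by (field; lra). lra.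
Qed.

(** Integrate the derivative of [e^(-zt) (1-e^(-t))^b], which vanishes at both ends, and write the
    factor [e^(-t)] as [1 - (1 - e^(-t))]. *)
Lemma CBeta_succ z b : 0 < Re z -> 0 < b ->
  (z + RtoC b) * CBeta z (b + 1) = RtoC b * CBeta z b.
Proof.
  intros Hz Hb.
  set (phi := fun t => cexp (- z * RtoC t) * RtoC (Rpower (1 - exp (- t)) b)).
  assert (B0 : gen_lim (fun t1 t2 => phi t2 - phi t1) (- 0)).
  { assert (Hm : forall t, 0 < t -> Cmod (phi t) = (exp (- (Re z * t)) * Rpower (1 - exp (- t)) b)%R).
    { intros t Ht; pose proof (Cmod_bint z (b + 1) t) as E; unfold bint, breal in E.
      replace (b + 1 - 1)%R with b in E by ring; exact E. }
    assert (Hp : forall t, 0 < t -> 0 < Rpower (1 - exp (- t)) b <= 1).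
    { intros t Ht; split; [apply exp_pos|].
      apply exp_le1.
      pose proof (exp_opp_lt1 t Ht); pose proof (ln_le_sub1 (1 - exp (- t)) ltac:(lra)); nra. }
    apply gen_lim_boundary.
    - intros e He; exists (Rpower e (/ b)); split; [apply exp_pos|]; intros t Ht.
      replace (phi t - 0) with (phi t) by ring; rewrite Hm by lra.
      pose proof (exp_opp_lt1 t ltac:(lra)) as Hs.
      assert (L1 : Rpower (1 - exp (- t)) b < e).
      { apply Rlt_le_trans with (Rpower (Rpower e (/ b)) b).
        - apply Rlt_Rpower_l; [exact Hb|]; split; [lra|].
          pose proof (exp_ineq1_le (- t)); lra.
        - rewrite Rpower_mult, Rinv_l, Rpower_1 by lra; lra. }
      assert (0 < exp (- (Re z * t)) <= 1).
      { split; [apply exp_pos|]; apply exp_le1.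
        assert (0 < Re z * t) by (apply Rmult_lt_0_compat; lra). lra. }
      specialize (Hp t ltac:(lra)); nra.
    - intros e He; destruct (exp_decay (Re z) Hz e He) as [M HM]; exists (Rmax M 0); intros t Ht.
      pose proof (Rmax_l M 0); pose proof (Rmax_r M 0).
      rewrite Hm by lra; specialize (HM t ltac:(lra)); specialize (Hp t ltac:(lra)).
      pose proof (exp_pos (- (Re z * t))); nra. }
  assert (B1 : gen_lim (fun t1 t2 => phi t2 - phi t1) (RtoC b * CBeta z b + - (z + RtoC b) * CBeta z (b + 1))).
  { apply (gen_lim_ext (fun t1 t2 => RtoC b * CInt (bint z b) t1 t2 + - (z + RtoC b) * CInt (bint z (b + 1)) t1 t2)).
    2:{ apply gen_lim_plus; apply gen_lim_scal; apply CBeta_lim; lra. }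
    intros t1 t2 Ht.
    assert (I1 : is_CInt (fun t => RtoC b * bint z b t + - (z + RtoC b) * bint z (b + 1) t) t1 t2
      (RtoC b * CInt (bint z b) t1 t2 + - (z + RtoC b) * CInt (bint z (b + 1)) t1 t2)).
    { apply is_CInt_plus; apply is_CInt_scal; apply pcont_CInt; try apply bint_cont; lra. }
    rewrite <- (is_CInt_unique _ _ _ _ I1); apply is_CInt_unique.
    apply (is_CInt_derive phi).
    - intros t Ht'; rewrite Rmin_left in Ht' by lra; assert (Hp : 0 < t) by lra.
      pose proof (exp_opp_lt1 t Hp) as Hs.
      assert (D : is_rderiv phi t ((- z * cexp (- z * RtoC t)) * RtoC (Rpower (1 - exp (- t)) b)
         + cexp (- z * RtoC t) * RtoC (b * exp (- t) * Rpower (1 - exp (- t)) (b - 1)))).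
      { apply (is_rderiv_mult (fun t => cexp (- z * RtoC t)) (fun t => RtoC (Rpower (1 - exp (- t)) b))).
        - apply is_rderiv_cexp_lin.
        - apply is_rderiv_RtoC; unfold Rpower; auto_derive; [lra|].
          replace (exp ((b - 1) * ln (1 - exp (- t)))) with (exp (b * ln (1 - exp (- t))) * / (1 - exp (- t)))%R.
          + unfold Rminus; field; lra.
          + rewrite <- (exp_ln (1 - exp (- t))) at 2 by lra; rewrite <- exp_Ropp, <- exp_plus; f_equal; ring. }
      replace (RtoC b * bint z b t + - (z + RtoC b) * bint z (b + 1) t) with
       ((- z * cexp (- z * RtoC t)) * RtoC (Rpower (1 - exp (- t)) b)
         + cexp (- z * RtoC t) * RtoC (b * exp (- t) * Rpower (1 - exp (- t)) (b - 1))); [exact D|].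
      unfold bint; replace (b + 1 - 1)%R with b by ring.
      assert (E : Rpower (1 - exp (- t)) b = (Rpower (1 - exp (- t)) (b - 1) * (1 - exp (- t)))%R).
      { rewrite <- (Rpower_1 (1 - exp (- t))) at 3 by lra; rewrite <- Rpower_plus; f_equal; ring. }
      rewrite E, !RtoC_mult, RtoC_minus; ring.
    - intros t Ht'; rewrite Rmin_left in Ht' by lra.
      apply cont_at_plus; apply cont_at_mult; try apply cont_at_const; apply bint_cont; lra. }
  pose proof (gen_lim_unique _ _ _ B0 B1) as E.
  replace ((z + RtoC b) * CBeta z (b + 1)) with
    (RtoC b * CBeta z b - (RtoC b * CBeta z b + - (z + RtoC b) * CBeta z (b + 1))) by ring.
  rewrite <- E; ring.
Qed.

Lemma Re_pos_neq0 z : 0 < Re z -> z <> 0.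
Proof. intros H E; rewrite E in H; simpl in H; lra. Qed.

Lemma CBeta_1 z : 0 < Re z -> CBeta z 1 = / z.
Proof.
  intros Hz; pose proof (Re_pos_neq0 z Hz) as Hn.
  set (phi := fun t => (- / z) * cexp (- z * RtoC t)).
  assert (B0 : gen_lim (fun t1 t2 => phi t2 - phi t1) (- (- / z))).
  { apply gen_lim_boundary.
    - assert (Hc : rcont phi 0).
      { apply cont_at_mult; [apply cont_at_const|].
        apply (pcont_cexp_lin (- z) (fun t => t)), continuous_id. }
      intros e He; destruct (Hc e He) as [d [Hd H]]; exists d; split; [exact Hd|]; intros t Ht.
      replace (- / z) with (phi 0%R).
      + apply H; rewrite Rminus_0_r, Rabs_pos_eq; lra.
      + unfold phi; replace (- z * RtoC 0) with (RtoC 0) by ring; rewrite cexp_0; ring.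
    - intros e He.
      assert (Hm : 0 < Cmod (- / z)).
      { rewrite Cmod_opp, Cmod_inv by exact Hn; apply Rinv_0_lt_compat; now apply Cmod_gt_0. }
      destruct (exp_decay (Re z) Hz (e / Cmod (- / z))%R) as [M HM]; [now apply Rdiv_lt_0_compat|].
      exists M; intros t Ht; unfold phi; rewrite Cmod_mult, Cmod_cexp.
      replace (Re (- z * RtoC t)) with (- (Re z * t))%R by (destruct z; simpl; ring).
      specialize (HM t Ht); apply (Rmult_lt_compat_l (Cmod (- / z))) in HM; [|exact Hm].
      replace (Cmod (- / z) * (e / Cmod (- / z)))%R with e in HM by (field; lra). exact HM. }
  replace (/ z) with (- - / z) by ring.
  refine (gen_lim_unique (CInt (bint z 1)) _ _ (CBeta_lim z 1 Hz ltac:(lra)) _).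
  apply (gen_lim_ext (fun t1 t2 => phi t2 - phi t1)); [|exact B0].
  intros t1 t2 Ht; symmetry; apply is_CInt_unique; apply (is_CInt_derive phi).
  - intros t Ht'; rewrite Rmin_left in Ht' by lra.
    pose proof (exp_opp_lt1 t ltac:(lra)).
    replace (bint z 1 t) with (0 * cexp (- z * RtoC t) + (- / z) * (- z * cexp (- z * RtoC t))).
    + apply (is_rderiv_mult (fun _ => - / z) (fun t => cexp (- z * RtoC t))); [apply is_rderiv_const|apply is_rderiv_cexp_lin].
    + unfold bint; replace (1 - 1)%R with 0%R by ring; rewrite Rpower_O by lra; field; exact Hn.
  - intros t Ht'; rewrite Rmin_left in Ht' by lra; apply bint_cont; lra.
Qed.

(** A finite form of the Beta-Gamma identity, in which both sides obey the same recursion in [n].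
    Multiplied by [n^(z+b)], the three factors whose second argument grows tend to Gamma values; the
    argument [n + 1 + b] is why Gauss's limit is proved with a shift [c]. *)
Lemma CBeta_shift z b n : 0 < Re z -> 0 < b ->
  CBeta (z + RtoC b) (INR n + 1) * CBeta z b = CBeta (RtoC b) (INR n + 1) * CBeta z (INR n + 1 + b).
Proof.
  intros Hz Hb.
  assert (Hzb : 0 < Re (z + RtoC b)) by (destruct z; simpl in *; lra).
  induction n.
  - simpl INR; rewrite Rplus_0_l, !CBeta_1 by (assumption || exact Hb).
    pose proof (CBeta_succ z b Hz Hb) as E; rewrite Rplus_comm in E.
    replace (CBeta z (1 + b)) with (((z + RtoC b) * CBeta z (1 + b)) / (z + RtoC b)).
    + rewrite E; field; split; [now apply Re_pos_neq0|apply RtoC_neq0; lra].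
    + field; now apply Re_pos_neq0.
  - rewrite S_INR; pose proof (pos_INR n) as Hn; set (N := INR n) in *.
    pose proof (CBeta_succ (z + RtoC b) (N + 1) Hzb ltac:(lra)) as E1.
    pose proof (CBeta_succ (RtoC b) (N + 1) Hb ltac:(lra)) as E2.
    pose proof (CBeta_succ z (N + 1 + b) Hz ltac:(lra)) as E3.
    replace (N + 1 + b + 1)%R with (N + 1 + 1 + b)%R in E3 by ring.
    replace (z + RtoC (N + 1 + b)) with (z + RtoC b + RtoC (N + 1)) in E3 by (rewrite (RtoC_plus (N + 1)); ring).
    replace (RtoC (N + 1 + b)) with (RtoC b + RtoC (N + 1)) in E3 by (rewrite (RtoC_plus (N + 1)); ring).
    set (k := RtoC (N + 1)) in *; set (P := z + RtoC b + k) in *; set (Q := RtoC b + k) in *.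
    assert (P1 : P <> 0) by (apply Re_pos_neq0; destruct z; simpl in *; lra).
    assert (P2 : Q <> 0) by (apply Re_pos_neq0; simpl in *; lra).
    replace (CBeta (z + RtoC b) (N + 1 + 1)) with (k * CBeta (z + RtoC b) (N + 1) / P) by (rewrite <- E1; field; exact P1).
    replace (CBeta (RtoC b) (N + 1 + 1)) with (k * CBeta (RtoC b) (N + 1) / Q) by (rewrite <- E2; field; exact P2).
    replace (CBeta z (N + 1 + 1 + b)) with (Q * CBeta z (N + 1 + b) / P) by (rewrite <- E3; field; exact P1).
    replace (k * CBeta (z + RtoC b) (N + 1) / P * CBeta z b)
      with (k / P * (CBeta (z + RtoC b) (N + 1) * CBeta z b)) by (field; exact P1).
    rewrite IHn; field; auto.
Qed.

(** The upper half is [ln (1-s) <= -s]. For the lower half, [e^(-s) (1+s) <= 1] gives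
    [(1-s)^n >= e^(-ns) (1-s^2)^n], and Bernoulli's inequality treats [(1-s^2)^n] and [(1-s)^k]; the
    integer [k >= c] is there for the latter. *)
Lemma beta_kernel_bound (n k : nat) c s : 0 <= c <= INR k -> 0 < s < 1 ->
  (Rabs (Rpower (1 - s) (INR n + c) - exp (- (INR n * s))) <= exp (- (INR n * s)) * (INR n * (s * s) + INR k * s)).
Proof.
  intros Hc Hs; pose proof (pos_INR n) as Hn; pose proof (pos_INR k) as Hk.
  set (E := exp (- (INR n * s))); assert (HE : 0 < E) by apply exp_pos.
  assert (L : ln (1 - s) <= - s) by (pose proof (ln_le_sub1 (1 - s) ltac:(lra)); lra).
  assert (U : Rpower (1 - s) (INR n + c) <= E).
  { apply exp_le_compat; nra. }
  assert (Bern : forall y j, 0 <= y <= 1 -> 1 - INR j * y <= (1 - y) ^ j).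
  { intros y j Hy; induction j; [simpl; lra|]; rewrite S_INR; simpl pow; pose proof (pos_INR j).
    assert (0 <= (1 - y) ^ j) by (apply pow_le; lra). nra. }
  assert (P1 : E * (1 - INR n * (s * s)) <= Rpower (1 - s) (INR n)).
  { apply Rle_trans with (E * (1 - s * s) ^ n)%R.
    - apply Rmult_le_compat_l; [lra|]; apply Bern; nra.
    - rewrite Rpower_pow by lra.
      replace E with (exp (- s) ^ n)%R.
      + rewrite <- Rpow_mult_distr; apply pow_incr; pose proof (exp_pos (- s)).
        assert (S1 : exp (- s) * (1 + s) <= 1).
        { pose proof (exp_ineq1_le s). assert (S2 : (exp (- s) * exp s = 1)%R) by (rewrite <- exp_plus, Rplus_opp_l; apply exp_0). nra. }
        split; [apply Rmult_le_pos; nra|]. replace (exp (- s) * (1 - s * s))%R with ((exp (- s) * (1 + s)) * (1 - s))%R by ring. nra.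
      + unfold E; rewrite <- (Rpower_pow n) by apply exp_pos; unfold Rpower; rewrite ln_exp; f_equal; ring. }
  assert (P2 : 1 - INR k * s <= Rpower (1 - s) c).
  { apply Rle_trans with ((1 - s) ^ k)%R; [apply Bern; lra|].
    rewrite <- Rpower_pow by lra; apply exp_le_compat; nra. }
  assert (Lo : E - E * (INR n * (s * s) + INR k * s) <= Rpower (1 - s) (INR n + c)).
  { assert (Pp : 0 < Rpower (1 - s) (INR n + c)) by apply exp_pos.
    assert (Ps : 0 < Rpower (1 - s) c) by apply exp_pos.
    set (A := (INR n * (s * s))%R) in *; set (B := (INR k * s)%R) in *.
    assert (HA : 0 <= A) by (unfold A; nra). assert (HB : 0 <= B) by (unfold B; nra).
    (* If [A + B >= 1] the left side is nonpositive; otherwise [(1-A)(1-B) >= 1-A-B] applies. *)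
    destruct (Rle_dec 1 (A + B)) as [h|h]; [nra|].
    rewrite Rpower_plus.
    apply Rle_trans with ((E * (1 - A)) * (1 - B))%R.
    - assert (0 <= A * B) by nra. nra.
    - assert (0 <= E * (1 - A)) by nra.
      apply Rmult_le_compat; lra. }
  apply Rabs_le; split; [lra|].
  assert (0 <= E * (INR n * (s * s) + INR k * s)) by (apply Rmult_le_pos; nra). lra.
Qed.

Definition Clim (u : nat -> C) (l : C) : Prop :=
  forall eps, 0 < eps -> exists n0, forall n, (n0 <= n)%nat -> (1 <= n)%nat -> Cmod (u n - l) < eps.

(** Gauss's limit formula; the substitution [u = n e^{-t}] turns the Beta
    integral into a perturbation of the Euler integral. *)
Lemma CBeta_gauss_limit w c : 0 < Re w -> 0 <= c ->
  Clim (fun n => cexp (w * RtoC (ln (INR n))) * CBeta w (INR n + 1 + c)) (CGamma w).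
Proof.
  intros Hw Hc eps He.
  set (x := Re w) in *.
  (* With [u = n s] the error terms [n s^2] and [k s] become [u^2 / n] and [k u / n]; against
     [u^x e^(-u)] they produce Euler integrals at [x + 2] and [x + 1]. *)
  destruct (greal_subst_bound (x + 2) ltac:(lra)) as [M2 [HM2 B2]].
  destruct (greal_subst_bound (x + 1) ltac:(lra)) as [M1 [HM1 B1]].
  destruct (CGamma_lim w Hw (eps / 4)%R ltac:(lra)) as [al [be [Hal [Hbe HG]]]].
  assert (Hk : exists k : nat, c <= INR k).
  { destruct (INR_unbounded c) as [k Hk]; exists k; lra. }
  destruct Hk as [k Hk].
  set (K := (M2 + INR k * M1)%R).
  assert (HK : 0 < K) by (unfold K; pose proof (pos_INR k); nra).
  destruct (INR_unbounded (Rmax (2 * be) (4 * K / eps))) as [n0 Hn0].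
  exists n0; intros n Hn Hn1.
  set (N := INR n) in *.
  assert (HNn : INR n0 <= N) by (apply le_INR; exact Hn).
  assert (N1 : 2 * be < N) by (pose proof (Rmax_l (2 * be) (4 * K / eps)); lra).
  assert (N2 : K / N < eps / 4).
  { assert (4 * K / eps < N) by (pose proof (Rmax_r (2 * be) (4 * K / eps)); lra).
    assert (HN0 : 0 < N) by lra.
    apply (Rmult_lt_compat_r eps) in H; [|lra].
    replace (4 * K / eps * eps)%R with (4 * K)%R in H by (field; lra).
    apply Rmult_lt_reg_r with N; [lra|]. replace (K / N * N)%R with K by (field; lra). nra. }
  assert (HN : 0 < N) by lra.
  set (W := cexp (w * RtoC (ln N))).
  assert (HW : 0 < Cmod W) by (apply Cmod_gt_0, cexp_neq0).
  destruct (CBeta_lim w (N + 1 + c) Hw ltac:(lra) (eps / 4 / Cmod W)%R ltac:(apply Rdiv_lt_0_compat; lra))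
    as [a2 [b2 [Ha2 [Hb2 HB]]]].
  (* [t1 < ln 2] puts [N e^(-t1)] above [N / 2 > be], and [t2 > ln (N / al)] puts [N e^(-t2)] below
     [al], so that the Beta and the Euler truncations are both close to their limits. *)
  set (t1 := (Rmin a2 (ln 2) / 2)%R).
  set (t2 := (Rmax b2 (ln (N / al)) + 1)%R).
  assert (Hl2 : 0 < ln 2) by (rewrite <- ln_1; apply ln_increasing; lra).
  assert (Ht1 : (0 < t1 < a2) /\ (t1 < ln 2)).
  { assert (0 < Rmin a2 (ln 2)) by (apply Rmin_pos; lra).
    pose proof (Rmin_l a2 (ln 2)); pose proof (Rmin_r a2 (ln 2)); unfold t1; lra. }
  assert (Ht2 : (b2 < t2) /\ (ln (N / al) < t2)).
  { pose proof (Rmax_l b2 (ln (N / al))); pose proof (Rmax_r b2 (ln (N / al))); unfold t2; lra. }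
  destruct Ht1 as [Ht1 Ht1']; destruct Ht2 as [Ht2 Ht2'].
  specialize (HB t1 t2 Ht1 Ht2).
  assert (U2 : 0 < N * exp (- t2) < al).
  { split; [apply Rmult_lt_0_compat; [lra|apply exp_pos]|].
    assert (HNa : 0 < N / al) by (apply Rdiv_lt_0_compat; lra).
    apply Rlt_le_trans with (N * exp (- ln (N / al)))%R.
    - apply Rmult_lt_compat_l; [lra|apply exp_increasing; lra].
    - rewrite exp_Ropp, exp_ln by exact HNa; right; field; lra. }
  assert (U1 : be < N * exp (- t1)).
  { apply Rlt_le_trans with (N * exp (- ln 2))%R.
    - rewrite exp_Ropp, exp_ln by lra; lra.
    - apply Rmult_le_compat_l; [lra|apply exp_le_compat; lra]. }
  specialize (HG (N * exp (- t2))%R (N * exp (- t1))%R U2 U1).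
  set (Bt := CInt (bint w (N + 1 + c)) t1 t2) in *.
  set (Gt := CInt (gint w) (N * exp (- t2)) (N * exp (- t1))) in *.
  assert (D : Cmod (W * Bt - Gt) <= K / N).
  { destruct (B2 N t1 t2 HN ltac:(lra)) as [I2 [HI2 LI2]].
    destruct (B1 N t1 t2 HN ltac:(lra)) as [I1 [HI1 LI1]].
    assert (ID : is_CInt (fun t => W * bint w (N + 1 + c) t - RtoC (N * exp (- t)) * gint w (N * exp (- t))) t1 t2 (W * Bt - Gt)).
    { apply is_CInt_minus.
      - apply is_CInt_scal, pcont_CInt; [apply bint_cont|lra].
      - apply CInt_subst_exp; [exact HN|apply gint_cont]. }
    set (h := fun t => (/ N * ((N * exp (- t) * greal (x + 2) (N * exp (- t))) + INR k * (N * exp (- t) * greal (x + 1) (N * exp (- t)))))%R).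
    assert (IH : is_RInt h t1 t2 (/ N * (I2 + INR k * I1))%R).
    { apply (is_RInt_scal (V := R_NormedModule) _ t1 t2 (/ N)).
      apply (is_RInt_plus (V := R_NormedModule) _ _ t1 t2); [exact HI2|].
      apply (is_RInt_scal (V := R_NormedModule) _ t1 t2 (INR k)); exact HI1. }
    apply Rle_trans with (/ N * (I2 + INR k * I1))%R.
    - apply (is_CInt_norm _ h t1 t2 _ _ ltac:(lra)) with (2 := ID) (3 := IH).
      intros t Ht; assert (Htp : 0 < t) by lra.
      pose proof (exp_opp_lt1 t Htp) as Hs.
      set (s := exp (- t)) in *; set (u := (N * s)%R).
      assert (Hu : 0 < u) by (unfold u; nra).
      assert (Elnu : ln u = (ln N - t)%R).
      { unfold u; rewrite ln_mult by lra; unfold s; rewrite ln_exp; ring. }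
      assert (E1 : W * bint w (N + 1 + c) t = cexp (w * RtoC (ln u)) * RtoC (Rpower (1 - s) (N + c))).
      { unfold W, bint; fold s; replace (N + 1 + c - 1)%R with (N + c)%R by ring.
        rewrite Cmult_assoc, <- cexp_plus; f_equal; f_equal; rewrite Elnu, RtoC_minus; ring. }
      assert (E2 : RtoC u * gint w u = cexp (w * RtoC (ln u)) * RtoC (exp (- u))).
      { unfold gint; rewrite Cmult_assoc; f_equal.
        rewrite <- (exp_ln u) at 1 by exact Hu; rewrite <- cexp_RtoC, <- cexp_plus; f_equal; ring. }
      fold u; rewrite E1, E2.
      replace (cexp (w * RtoC (ln u)) * RtoC (Rpower (1 - s) (N + c)) - cexp (w * RtoC (ln u)) * RtoC (exp (- u)))
        with (cexp (w * RtoC (ln u)) * RtoC (Rpower (1 - s) (N + c) - exp (- u))) by (rewrite RtoC_minus; ring).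
      rewrite Cmod_mult, Cmod_cexp, Cmod_R.
      replace (Re (w * RtoC (ln u))) with (x * ln u)%R by (unfold x; destruct w; simpl; ring).
      pose proof (beta_kernel_bound n k c s ltac:(lra) Hs) as KB; fold N in KB; fold u in KB.
      apply Rle_trans with (exp (x * ln u) * (exp (- u) * (N * (s * s) + INR k * s)))%R.
      { apply Rmult_le_compat_l; [left; apply exp_pos|exact KB]. }
      right; unfold h; fold s; fold u; unfold greal.
      replace (exp ((x + 2 - 1) * ln u)) with (exp (x * ln u) * u)%R.
      2:{ rewrite <- (exp_ln u) at 2 by exact Hu; rewrite <- exp_plus; f_equal; ring. }
      replace ((x + 1 - 1) * ln u)%R with (x * ln u)%R by ring.
      unfold u; field; lra.
    - unfold K, Rdiv; rewrite Rmult_comm; apply Rmult_le_compat_r; [left; apply Rinv_0_lt_compat; lra|].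
      pose proof (pos_INR k); nra. }
  replace (W * CBeta w (N + 1 + c) - CGamma w) with
    (- (W * (Bt - CBeta w (N + 1 + c))) + ((W * Bt - Gt) + (Gt - CGamma w))) by ring.
  eapply Rle_lt_trans; [apply Cmod_triangle|].
  eapply Rle_lt_trans; [apply Rplus_le_compat_l, Cmod_triangle|].
  rewrite Cmod_opp, Cmod_mult.
  apply (Rmult_lt_compat_l (Cmod W)) in HB; [|exact HW].
  replace (Cmod W * (eps / 4 / Cmod W))%R with (eps / 4)%R in HB by (field; lra). lra.
Qed.

Lemma Clim_unique (u : nat -> C) l l' : Clim u l -> Clim u l' -> l = l'.
Proof.
  intros H H'; replace l with ((l - l') + l') by ring; replace (l - l') with (RtoC 0); [ring|symmetry].
  apply Cmod_small_eq0; intros e He.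
  destruct (H (e/2)%R) as [N HN]; [lra|]; destruct (H' (e/2)%R) as [N' HN']; [lra|].
  specialize (HN (N + N' + 1)%nat ltac:(lia) ltac:(lia)); specialize (HN' (N + N' + 1)%nat ltac:(lia) ltac:(lia)).
  rewrite Cmod_sub_sym in HN; pose proof (Cmod_sub_tri l (u (N + N' + 1)%nat) l'); lra.
Qed.

Lemma Clim_mult (u v : nat -> C) l l' :
  Clim u l -> Clim v l' -> Clim (fun n => u n * v n) (l * l').
Proof.
  intros H H' e He.
  set (M := (Cmod l + Cmod l' + 1)%R).
  pose proof (Cmod_ge_0 l); pose proof (Cmod_ge_0 l').
  set (d := Rmin 1 (e / (2 * M))).
  assert (Hd : 0 < d) by (apply Rmin_pos; [lra|apply Rdiv_lt_0_compat; unfold M; lra]).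
  destruct (H d Hd) as [N HN]; destruct (H' d Hd) as [N' HN'].
  exists (N + N')%nat; intros n Hn Hn1.
  specialize (HN n ltac:(lia) Hn1); specialize (HN' n ltac:(lia) Hn1).
  assert (A1 : d <= 1) by apply Rmin_l.
  assert (A2 : d * (2 * M) <= e).
  { apply Rle_trans with (e / (2 * M) * (2 * M))%R.
    - apply Rmult_le_compat_r; [unfold M; lra|apply Rmin_r].
    - right; field; unfold M; lra. }
  replace (u n * v n - l * l') with ((u n - l) * (v n - l') + ((u n - l) * l' + l * (v n - l'))) by ring.
  eapply Rle_lt_trans; [apply Cmod_triangle|].
  eapply Rle_lt_trans; [apply Rplus_le_compat_l, Cmod_triangle|].
  rewrite !Cmod_mult.
  pose proof (Cmod_ge_0 (u n - l)); pose proof (Cmod_ge_0 (v n - l')).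
  unfold M in *; nra.
Qed.

Lemma CBeta_CGamma z b : 0 < Re z -> 0 < b ->
  CGamma (z + RtoC b) * CBeta z b = CGamma (RtoC b) * CGamma z.
Proof.
  intros Hz Hb.
  assert (Hzb : 0 < Re (z + RtoC b)) by (destruct z; simpl in *; lra).
  apply (Clim_unique (fun n => (cexp ((z + RtoC b) * RtoC (ln (INR n))) * CBeta (z + RtoC b) (INR n + 1 + 0)) * CBeta z b)).
  - apply Clim_mult; [apply CBeta_gauss_limit; lra|].
    intros e He; exists 0%nat; intros; replace (CBeta z b - CBeta z b) with (RtoC 0) by ring; rewrite Cmod_0; lra.
  - intros e He.
    destruct (Clim_mult _ _ _ _ (CBeta_gauss_limit (RtoC b) 0 Hb (Rle_refl _)) (CBeta_gauss_limit z b Hz (Rlt_le _ _ Hb)) e He) as [n0 H].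
    exists n0; intros n Hn Hn1; specialize (H n Hn Hn1).
    rewrite !Rplus_0_r in *.
    replace (cexp ((z + RtoC b) * RtoC (ln (INR n))) * CBeta (z + RtoC b) (INR n + 1) * CBeta z b)
      with (cexp (RtoC b * RtoC (ln (INR n))) * CBeta (RtoC b) (INR n + 1) * (cexp (z * RtoC (ln (INR n))) * CBeta z (INR n + 1 + b))); [exact H|].
    replace ((z + RtoC b) * RtoC (ln (INR n))) with (RtoC b * RtoC (ln (INR n)) + z * RtoC (ln (INR n))) by ring.
    rewrite cexp_plus.
    replace (cexp (RtoC b * RtoC (ln (INR n))) * cexp (z * RtoC (ln (INR n))) * CBeta (z + RtoC b) (INR n + 1) * CBeta z b)
     with (cexp (RtoC b * RtoC (ln (INR n))) * cexp (z * RtoC (ln (INR n))) * (CBeta (z + RtoC b) (INR n + 1) * CBeta z b)) by ring.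
    rewrite CBeta_shift by assumption; ring.
Qed.

(** Induction through [|B(w, k+1)| = (k / |w+k|) |B(w, k)|] and
    [|w+k| <= k exp(x/k + |w|^2 / (2 k^2))]. The main part of [x/k] is absorbed by
    [x (ln (k+1) - ln k)]; what is left is at most [K (1/k - 1/(k+1))] and telescopes. *)
Lemma CBeta_lower w n : 0 < Re w ->
  (/ Cmod w * exp (- (Re w * ln (INR n + 1)) - (Re w + Cmod w ^ 2) * (1 - / (INR n + 1))) <= Cmod (CBeta w (INR n + 1))).
Proof.
  intros Hw; set (x := Re w) in *; set (K := (x + Cmod w ^ 2)%R).
  assert (Hm : 0 < Cmod w) by (apply Cmod_gt_0, Re_pos_neq0, Hw).
  induction n.
  - simpl INR; rewrite Rplus_0_l, CBeta_1, Cmod_inv, ln_1, Rinv_1 by (auto; apply Re_pos_neq0, Hw).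
    replace (- (x * 0) - K * (1 - 1))%R with 0%R by ring; rewrite exp_0; lra.
  - rewrite S_INR; pose proof (pos_INR n) as Hn; set (k := (INR n + 1)%R) in *.
    assert (Hk : 1 <= k) by (unfold k; lra).
    pose proof (CBeta_succ w k Hw ltac:(lra)) as E.
    apply (f_equal Cmod) in E; rewrite !Cmod_mult, Cmod_R, Rabs_pos_eq in E by lra.
    assert (Hwk : 0 < Cmod (w + RtoC k)).
    { apply Cmod_gt_0, Re_pos_neq0; destruct w; simpl in *; unfold x in *; lra. }
    assert (Bd : Cmod (w + RtoC k) <= k * exp (x * (ln (k + 1) - ln k) + K * (/ k - / (k + 1)))).
    { assert (L : 1 / (k + 1) <= ln (k + 1) - ln k).
      { pose proof (ln_le_sub1 (k / (k + 1)) ltac:(apply Rdiv_lt_0_compat; lra)) as LL.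
        unfold Rdiv in LL at 1; rewrite ln_mult, ln_Rinv in LL by (try apply Rinv_0_lt_compat; lra).
        replace (k / (k + 1) - 1)%R with (- (1 / (k + 1)))%R in LL by (field; lra). lra. }
      assert (Sq : Cmod (w + RtoC k) ^ 2 <= (k * exp (x / k + Cmod w ^ 2 / (2 * (k * k)))) ^ 2).
      { rewrite Rpow_mult_distr.
        replace (exp (x / k + Cmod w ^ 2 / (2 * (k * k))) ^ 2)%R with (exp (2 * x / k + Cmod w ^ 2 / (k * k)))%R.
        2:{ assert (E2 : forall a, (exp a ^ 2 = exp (2 * a))%R)
              by (intros a; simpl; rewrite Rmult_1_r, <- exp_plus; f_equal; ring).
            rewrite E2; f_equal; field; lra. }
        pose proof (exp_ineq1_le (2 * x / k + Cmod w ^ 2 / (k * k))) as EI.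
        assert (Hk2 : 0 < k ^ 2) by (apply pow_lt; lra).
        apply (Rmult_le_compat_l (k ^ 2)) in EI; [|lra].
        eapply Rle_trans; [|exact EI]; right.
        replace (k ^ 2 * (1 + (2 * x / k + Cmod w ^ 2 / (k * k))))%R with (k ^ 2 + 2 * x * k + Cmod w ^ 2)%R by (field; lra).
        rewrite !Cmod2_alt; unfold x; destruct w as [p q]; simpl; ring. }
      assert (S1 : Cmod (w + RtoC k) <= k * exp (x / k + Cmod w ^ 2 / (2 * (k * k)))).
      { apply Rsqr_incr_0_var; [rewrite !Rsqr_pow2; exact Sq|].
        apply Rmult_le_pos; [lra|left; apply exp_pos]. }
      eapply Rle_trans; [exact S1|]; apply Rmult_le_compat_l; [lra|apply exp_le_compat].
      assert (F1 : (/ k - / (k + 1) = 1 / (k * (k + 1)))%R) by (field; lra).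
      assert (F2 : (x / k = x * (1 / (k + 1)) + x * (1 / (k * (k + 1))))%R) by (field; lra).
      assert (F3 : 1 / (2 * (k * k)) <= 1 / (k * (k + 1))).
      { unfold Rdiv; rewrite !Rmult_1_l; apply Rinv_le_contravar; nra. }
      rewrite F1, F2; unfold K.
      assert (F4 : Cmod w ^ 2 / (2 * (k * k)) <= Cmod w ^ 2 * (1 / (k * (k + 1)))).
      { replace (Cmod w ^ 2 / (2 * (k * k)))%R with (Cmod w ^ 2 * (1 / (2 * (k * k))))%R by (field; lra).
        apply Rmult_le_compat_l; [apply pow_le; lra|exact F3]. }
      assert (F5 : x * (1 / (k + 1)) <= x * (ln (k + 1) - ln k)) by (apply Rmult_le_compat_l; lra).
      lra. }
    apply Rmult_le_reg_l with (Cmod (w + RtoC k)); [exact Hwk|]; rewrite E.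
    apply Rle_trans with (k * (/ Cmod w * exp (- (x * ln k) - K * (1 - / k))))%R.
    + set (X := exp (- (x * ln (k + 1)) - K * (1 - / (k + 1)))).
      replace (exp (- (x * ln k) - K * (1 - / k))) with (exp (x * (ln (k + 1) - ln k) + K * (/ k - / (k + 1))) * X)%R.
      2:{ unfold X; rewrite <- exp_plus; f_equal; ring. }
      set (Y := exp (x * (ln (k + 1) - ln k) + K * (/ k - / (k + 1)))) in *.
      assert (HX : 0 < / Cmod w * X) by (apply Rmult_lt_0_compat; [now apply Rinv_0_lt_compat|apply exp_pos]).
      replace (k * (/ Cmod w * (Y * X)))%R with ((k * Y) * (/ Cmod w * X))%R by ring.
      apply Rmult_le_compat_r; lra.
    + apply Rmult_le_compat_l; [lra|exact IHn].
Qed.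

(** A zero would force [n^w B(w, n+1)] to tend to 0, while [CBeta_lower] keeps its modulus above
    [kap]. The [ln 2] in [kap] pays for [N + 1 <= 2 N]. *)
Lemma CGamma_neq0 w : 0 < Re w -> CGamma w <> 0.
Proof.
  intros Hw Z; set (x := Re w) in *; set (K := (x + Cmod w ^ 2)%R).
  assert (Hm : 0 < Cmod w) by (apply Cmod_gt_0, Re_pos_neq0, Hw).
  set (kap := (/ Cmod w * exp (- (x * ln 2) - K))%R).
  assert (Hkap : 0 < kap) by (apply Rmult_lt_0_compat; [now apply Rinv_0_lt_compat|apply exp_pos]).
  destruct (CBeta_gauss_limit w 0 Hw (Rle_refl _) kap Hkap) as [n0 H].
  specialize (H (S n0) ltac:(lia) ltac:(lia)); rewrite Z, Rplus_0_r in H.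
  replace (cexp (w * RtoC (ln (INR (S n0)))) * CBeta w (INR (S n0) + 1) - 0) with
    (cexp (w * RtoC (ln (INR (S n0)))) * CBeta w (INR (S n0) + 1)) in H by ring.
  rewrite Cmod_mult, Cmod_cexp in H.
  pose proof (CBeta_lower w (S n0) Hw) as L; fold x in L; fold K in L.
  set (N := INR (S n0)) in *.
  assert (HN : 1 <= N) by (unfold N; rewrite S_INR; pose proof (pos_INR n0); lra).
  replace (Re (w * RtoC (ln N))) with (x * ln N)%R in H by (unfold x; destruct w; simpl; ring).
  assert (kap <= exp (x * ln N) * Cmod (CBeta w (N + 1))); [|lra].
  eapply Rle_trans; [|apply Rmult_le_compat_l; [left; apply exp_pos|exact L]].
  replace (exp (x * ln N) * (/ Cmod w * exp (- (x * ln (N + 1)) - K * (1 - / (N + 1)))))%R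
    with (/ Cmod w * (exp (x * ln N) * exp (- (x * ln (N + 1)) - K * (1 - / (N + 1)))))%R by ring.
  unfold kap; apply Rmult_le_compat_l; [left; now apply Rinv_0_lt_compat|].
  rewrite <- exp_plus; apply exp_le_compat.
  assert (L1 : ln (N + 1) <= ln 2 + ln N).
  { rewrite <- ln_mult by lra; destruct (Rle_lt_or_eq_dec (N + 1) (2 * N)) as [h|h]; [lra| |].
    - left; apply ln_increasing; lra.
    - rewrite h; lra. }
  assert (0 <= K) by (unfold K; pose proof (pow_le (Cmod w) 2 (Rlt_le _ _ Hm)); lra).
  assert (0 < / (N + 1)) by (apply Rinv_0_lt_compat; lra).
  assert (x * ln (N + 1) <= x * (ln 2 + ln N)) by (apply Rmult_le_compat_l; lra).
  nra.
Qed.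

(** From [(1-s)^N <= e^(-N s)] with [N = b - 1] and [s = e^(-t)], the scaled integrand is dominated
    by the Euler integrand in [u = N s], and the scaling yields the power of [N]. Uniformity in [t1]
    and [t2] is what Tannery's theorem requires. *)
Lemma CInt_bint_decay z : 0 < Re z -> exists M, (0 < M) /\ forall b t1 t2, 1 < b -> 0 < t1 <= t2 ->
  (Cmod (CInt (bint z b) t1 t2) <= M * Rpower (b - 1) (- Re z)).
Proof.
  intros Hz; set (x := Re z) in *.
  destruct (greal_subst_bound x Hz) as [M [HM B]]; exists M; split; [exact HM|].
  intros b t1 t2 Hb Ht; set (N := (b - 1)%R).
  assert (HN : 0 < N) by (unfold N; lra).
  destruct (B N t1 t2 HN Ht) as [I [HI LI]].
  assert (HP : 0 < Rpower N (- x)) by apply exp_pos.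
  apply Rle_trans with (Rpower N (- x) * I)%R; [|rewrite Rmult_comm; apply Rmult_le_compat_r; lra].
  apply (is_CInt_norm (bint z b) (fun t => Rpower N (- x) * (N * exp (- t) * greal x (N * exp (- t))))%R t1 t2); [lra| | |].
  - intros t Ht'; assert (Htp : 0 < t) by lra; pose proof (exp_opp_lt1 t Htp) as Hs.
    rewrite Cmod_bint; fold x; unfold breal, greal; fold N; set (s := exp (- t)) in *.
    assert (Hu : 0 < N * s) by nra.
    replace (Rpower N (- x) * (N * s * (exp ((x - 1) * ln (N * s)) * exp (- (N * s)))))%R
      with (exp (- (x * t)) * exp (- (N * s)))%R.
    + apply Rmult_le_compat_l; [left; apply exp_pos|].
      apply exp_le_compat; pose proof (ln_le_sub1 (1 - s) ltac:(lra)); nra.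
    + unfold Rpower; rewrite <- (exp_ln (N * s)) at 2 by exact Hu.
      rewrite <- !exp_plus; f_equal; rewrite ln_mult by lra; unfold s; rewrite ln_exp; fold s; ring.
  - apply pcont_CInt; [apply bint_cont|exact Ht].
  - apply (is_RInt_scal (V := R_NormedModule) _ t1 t2 (Rpower N (- x))); exact HI.
Qed.

(** * The chart [sigma |-> w] *)

Lemma ccont_RtoC_comp (g : C -> R) (h : R -> R) p :
  ccont (fun q => RtoC (g q)) p -> continuous h (g p) -> ccont (fun q => RtoC (h (g q))) p.
Proof.
  intros Hg Hh e He.
  destruct (rcont_RtoC h (g p) Hh e He) as [d [Hd H]].
  destruct (Hg d Hd) as [d' [Hd' H']]; exists d'; split; [exact Hd'|]; intros q Hq.
  apply H; specialize (H' q Hq); now rewrite <- RtoC_minus, Cmod_R in H'.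
Qed.

Lemma ccont_lipschitz (g : C -> R) p :
  (forall q, Rabs (g q - g p) <= Cmod (q - p)) -> ccont (fun q => RtoC (g q)) p.
Proof.
  intros H e He; exists e; split; [exact He|]; intros q Hq.
  rewrite <- RtoC_minus, Cmod_R; eapply Rle_lt_trans; [apply H|exact Hq].
Qed.

Lemma ccont_Re p : ccont (fun q => RtoC (Re q)) p.
Proof. apply ccont_lipschitz; intros q; apply (re_le_Cmod (q - p)). Qed.

Lemma ccont_Im p : ccont (fun q => RtoC (Im q)) p.
Proof. apply ccont_lipschitz; intros q; apply (im_le_Cmod (q - p)). Qed.

Lemma ccont_Cmod p : ccont (fun q => RtoC (Cmod q)) p.
Proof.
  apply ccont_lipschitz; intros q; apply Rabs_le; split.
  - pose proof (Cmod_le_add p q) as H; rewrite Cmod_sub_sym in H; lra.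
  - pose proof (Cmod_le_add q p); lra.
Qed.

(** Every logarithm in the proof is taken in the open right half-plane, where [Carg] is a single
    arctangent. *)
Lemma Carg_right z : 0 < Re z -> Carg z = atan (Im z / Re z).
Proof. intros H; unfold Carg; destruct (Rlt_dec 0 (Re z)); [reflexivity|lra]. Qed.

Lemma Cmod_right z : 0 < Re z -> Cmod z = (Re z * sqrt (1 + (Im z / Re z)²))%R.
Proof.
  intros H; destruct z as [x y]; simpl in *; unfold Cmod; simpl.
  rewrite <- (sqrt_square x) at 3 by lra; rewrite <- sqrt_mult.
  - f_equal; unfold Rsqr; field; lra.
  - nra.
  - pose proof (Rle_0_sqr (y / x)); lra.
Qed.

Lemma cexp_Cln z : 0 < Re z -> cexp (Cln z) = z.
Proof.
  intros H; assert (Hm : 0 < Cmod z) by (apply Cmod_gt_0, Re_pos_neq0, H).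
  unfold cexp, Cln; simpl; rewrite exp_ln, Carg_right, cos_atan, sin_atan by assumption.
  rewrite Cmod_right by exact H.
  assert (S : sqrt (1 + (Im z / Re z)²) <> 0).
  { apply Rgt_not_eq, sqrt_lt_R0; pose proof (Rle_0_sqr (Im z / Re z)); lra. }
  destruct z as [x y]; simpl in *; f_equal; field; repeat split; solve [exact S | lra].
Qed.

Lemma Re_pos_near z q : Cmod (q - z) < Re z -> 0 < Re q.
Proof.
  intros Hq; pose proof (re_le_Cmod (q - z)) as L.
  assert (HH : Rabs (Re q - Re z) < Re z) by (eapply Rle_lt_trans; [exact L|exact Hq]).
  apply Rabs_def2 in HH; lra.
Qed.

Lemma ccont_Cln z : 0 < Re z -> ccont Cln z.
Proof.
  intros H; assert (Hm : 0 < Cmod z) by (apply Cmod_gt_0, Re_pos_neq0, H).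
  apply (cont_at_ext_loc _ (fun q => RtoC (ln (Cmod q)) + Ci * RtoC (atan (Im q / Re q))) Cln z (Re z) H).
  - unfold Cln; rewrite Carg_right by exact H; unfold Ci, RtoC, Cplus, Cmult; simpl; f_equal; ring.
  - intros q Hq.
    pose proof (Re_pos_near z q Hq) as Hq'.
    unfold Cln; rewrite Carg_right by exact Hq'; unfold Ci, RtoC, Cplus, Cmult; simpl; f_equal; ring.
  - apply cont_at_plus.
    + apply (ccont_RtoC_comp Cmod ln); [apply ccont_Cmod|].
      apply ex_derive_cont; auto_derive; exact Hm.
    + apply cont_at_mult; [apply cont_at_const|].
      apply (ccont_RtoC_comp (fun q => Im q / Re q)%R atan).
      * apply (cont_at_ext_loc _ (fun q => RtoC (Im q) * / RtoC (Re q)) _ z (Re z) H).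
        -- rewrite RtoC_div by lra; reflexivity.
        -- intros q Hq.
           pose proof (Re_pos_near z q Hq) as Hq'.
           rewrite RtoC_div by lra; reflexivity.
        -- apply cont_at_mult; [apply ccont_Im|apply cont_at_inv; [apply ccont_Re|]].
           apply RtoC_neq0; lra.
      * apply ex_derive_cont; auto_derive; auto.
Qed.

(** The inverse function argument in Carathéodory form: the slope of [cexp] at [Cln z] is nonzero
    and continuous, so along the continuous function [Cln] it may be inverted. *)
Lemma cdiff_Cln z : 0 < Re z -> cdiff Cln z.
Proof.
  intros H; pose proof (ccont_Cln z H) as CL.
  destruct (cexp_caratheodory (Cln z)) as [phi [Hc [Hp E]]].
  assert (Cphi : ccont (fun q => phi (Cln q)) z) by now apply cont_at_comp.
  assert (P0 : phi (Cln z) <> 0) by (rewrite Hp; apply cexp_neq0).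
  destruct (cont_at_neq0_near _ _ z Cphi P0) as [d [Hd Nz]].
  assert (Hr : 0 < Rmin d (Re z)) by (apply Rmin_pos; assumption).
  apply (cdiff_ext_loc (fun q => Cln z + / phi (Cln q) * (q - z)) _ z _ Hr).
  - intros q Hq.
    specialize (Nz q (Rlt_le_trans _ _ _ Hq (Rmin_l _ _))).
    pose proof (Re_pos_near z q (Rlt_le_trans _ _ _ Hq (Rmin_r _ _))) as Hq'.
    specialize (E (Cln q)); rewrite !cexp_Cln in E by assumption.
    rewrite E; field; exact Nz.
  - exists (fun q => / phi (Cln q)); split; [now apply cont_at_inv|intro; ring].
Qed.

(** The variable [zeta] as a function of [u = 1 - e^(-zeta)], that is of [sigma^m]. *)
Definition lxi (u : C) : C := - Cln (1 - u).

Lemma Re_1m u : Cmod u < 1 -> 0 < Re (1 - u).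
Proof.
  intros H; pose proof (re_le_Cmod u) as L; pose proof (Rle_abs (Re u)).
  destruct u; simpl in *; lra.
Qed.

Lemma cexp_opp_lxi u : Cmod u < 1 -> cexp (- lxi u) = 1 - u.
Proof.
  intros H; unfold lxi; replace (- - Cln (1 - u)) with (Cln (1 - u)) by ring.
  now apply cexp_Cln, Re_1m.
Qed.

(** The quantity is the real part of [lxi u] times the conjugate of [u]. With [1 - u = r e^(i th)]
    it equals [- ln r (1 - r cos th) + r th sin th], and [th sin th >= sin^2 th] because
    [|th| < PI/2]. *)
Lemma Re_lxi_conj u : 0 < Cmod u < 1 -> 0 < Re (lxi u) * Re u + Im (lxi u) * Im u.
Proof.
  intros Hu; pose proof (Re_1m u (proj2 Hu)) as HX.
  set (s := 1 - u) in *; set (r := Cmod s); set (th := Carg s).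
  assert (Hr : 0 < r) by (apply Cmod_gt_0, Re_pos_neq0, HX).
  assert (E : cexp (Cln s) = s) by now apply cexp_Cln.
  assert (EX : (r * cos th = Re s)%R).
  { rewrite <- E at 1; unfold cexp, Cln; simpl; fold r; rewrite exp_ln by exact Hr; reflexivity. }
  assert (EY : (r * sin th = Im s)%R).
  { rewrite <- E at 1; unfold cexp, Cln; simpl; fold r; rewrite exp_ln by exact Hr; reflexivity. }
  assert (Hth : - PI / 2 < th < PI / 2).
  { unfold th; rewrite Carg_right by exact HX; pose proof (atan_bound (Im s / Re s)); lra. }
  assert (Hsin : sin th * sin th <= th * sin th).
  { pose proof (Rabs_sin_le th) as B; pose proof PI_RGT_0.
    destruct (Rle_dec 0 th) as [h|h].
    - pose proof (sin_ge_0 th h ltac:(lra)); rewrite !Rabs_pos_eq in B by lra; nra.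
    - assert (0 <= sin (- th)) by (apply sin_ge_0; lra). rewrite sin_neg in H0.
      rewrite <- (Rabs_Ropp (sin th)), <- (Rabs_Ropp th) in B.
      rewrite !Rabs_pos_eq in B by lra; nra. }
  pose proof (sin2_cos2 th) as SC; unfold Rsqr in SC.
  assert (Hc : 0 < cos th <= 1).
  { split; [nra|apply COS_bound]. }
  set (c := cos th) in *; set (y := sin th) in *.
  assert (Eu1 : Re u = (1 - r * c)%R) by (rewrite EX; unfold s; destruct u; simpl; ring).
  assert (Eu2 : Im u = (- (r * y))%R) by (rewrite EY; unfold s; destruct u; simpl; ring).
  assert (El1 : Re (lxi u) = (- ln r)%R) by (unfold lxi; fold s; unfold Cln; simpl; reflexivity).
  assert (El2 : Im (lxi u) = (- th)%R) by (unfold lxi; fold s; unfold Cln; simpl; reflexivity).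
  rewrite Eu1, Eu2, El1, El2.
  replace (- ln r * (1 - r * c) + - th * - (r * y))%R with (- ln r * (1 - r * c) + r * (th * y))%R by ring.
  assert (N1 : ~ (r = 1 /\ c = 1)%R).
  { intros [R1 C1].
    assert (y = 0)%R by (rewrite C1 in SC; nra).
    assert (u = 0).
    { destruct u as [p q]; simpl in *; unfold RtoC; f_equal; [rewrite Eu1, R1, C1; ring|rewrite Eu2, H; ring]. }
    rewrite H0, Cmod_0 in Hu; lra. }
  assert (LB : r * (y * y) <= r * (th * y)) by (apply Rmult_le_compat_l; lra).
  assert (YY : (y * y = 1 - c * c)%R) by lra.
  rewrite YY in LB.
  assert (Hc1 : 0 <= 1 - c * c) by nra.
  pose proof (ln_le_sub1 r Hr) as Ln1.
  (* For [r < 1] the logarithmic term is positive. For [r >= 1] and [r c < 1] it may be negative,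
     but it is at least [- (r-1)(1-c)], which [r (1-c^2)] outweighs when [c < 1]. *)
  destruct (Rlt_dec r 1) as [R1|R1].
  - assert (ln r < 0) by (rewrite <- ln_1; apply ln_increasing; lra).
    assert (0 < 1 - r * c) by nra.
    assert (0 < - ln r * (1 - r * c)) by (apply Rmult_lt_0_compat; lra).
    assert (0 <= r * (1 - c * c)) by (apply Rmult_le_pos; lra). lra.
  - assert (L0 : 0 <= ln r).
    { rewrite <- ln_1; destruct (Req_dec r 1) as [->|n]; [lra|left; apply ln_increasing; lra]. }
    destruct (Req_dec c 1) as [C1|C1].
    + assert (r <> 1) by (intro; apply N1; auto).
      assert (0 < ln r) by (rewrite <- ln_1; apply ln_increasing; lra).
      rewrite C1 in *; assert (0 < ln r * (r - 1)) by (apply Rmult_lt_0_compat; lra). lra.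
    + assert (C2 : c < 1) by lra.
      assert (P : 0 < r * (1 - c)) by (apply Rmult_lt_0_compat; lra).
      assert (Q : r * (1 - c) <= r * (1 - c * c)) by (apply Rmult_le_compat_l; nra).
      destruct (Rle_dec 1 (r * c)) as [h|h].
      * assert (0 <= ln r * (r * c - 1)) by (apply Rmult_le_pos; lra). lra.
      * assert (S1 : ln r * (1 - r * c) <= (r - 1) * (1 - r * c)) by (apply Rmult_le_compat_r; lra).
        assert (S2 : 1 - r * c <= 1 - c) by nra.
        assert (S3 : (r - 1) * (1 - r * c) <= (r - 1) * (1 - c)) by (apply Rmult_le_compat_l; lra).
        lra.
Qed.

Lemma Re_lxi_div u : 0 < Cmod u < 1 -> 0 < Re (lxi u / u).
Proof.
  intros Hu; pose proof (Re_lxi_conj u Hu) as H.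
  assert (Hp : 0 < Cmod u ^ 2) by (apply pow_lt; lra).
  assert (E : (Re (lxi u / u) = (Re (lxi u) * Re u + Im (lxi u) * Im u) / Cmod u ^ 2)%R).
  { rewrite Cmod2_alt in *; destruct (lxi u) as [p q]; destruct u as [x y]; simpl in *; field; lra. }
  rewrite E; apply Rdiv_lt_0_compat; assumption.
Qed.

Lemma cdiff_lxi u : Cmod u < 1 -> cdiff lxi u.
Proof.
  intros H; apply cdiff_opp, (cdiff_comp (fun u => 1 - u) Cln).
  - apply cdiff_minus; [apply cdiff_const|apply cdiff_id].
  - now apply cdiff_Cln, Re_1m.
Qed.

(** As [u = 1 - e^(-lxi u)], the second-order bound gives [|u - lxi u| <= 3 |lxi u|] when
    [|lxi u| <= 1]; hence the factor [4 = 1 + 3]. *)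
Lemma lxi_lower u : Cmod u < 1 -> Cmod u / 4 <= Cmod (lxi u).
Proof.
  intros Hu; pose proof (cexp_opp_lxi u Hu) as E.
  destruct (Rle_dec (Cmod (lxi u)) 1) as [h|h]; [|lra].
  pose proof (cexp_sub1_bound (- lxi u) ltac:(rewrite Cmod_opp; exact h)) as B.
  rewrite E, !Cmod_opp in B.
  replace (1 - u - 1 - - lxi u) with (lxi u - u) in B by ring.
  pose proof (Cmod_le_add u (lxi u)) as T; rewrite (Cmod_sub_sym u) in T.
  pose proof (Cmod_ge_0 (lxi u)); nra.
Qed.

(** Converts [e^(B |zeta|)] into a power of [|1 - sigma^m|]. Since [|1-u| < 2], the absolute value
    of the logarithm costs only [2 ln 2]; the argument costs at most [PI]. *)
Lemma lxi_upper u : Cmod u < 1 -> Cmod (lxi u) <= - ln (Cmod (1 - u)) + (2 * ln 2 + PI).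
Proof.
  intros Hu; pose proof (Re_1m u Hu) as HX.
  unfold lxi; rewrite Cmod_opp; eapply Rle_trans; [apply Cmod_le_re_im|].
  change (Rabs (ln (Cmod (1 - u))) + Rabs (Carg (1 - u)) <= - ln (Cmod (1 - u)) + (2 * ln 2 + PI)).
  rewrite Carg_right by exact HX; set (r := Cmod (1 - u)).
  assert (Hr : 0 < r) by (apply Cmod_gt_0, Re_pos_neq0, HX).
  assert (Hr2 : r < 2).
  { unfold r, Cminus; eapply Rle_lt_trans; [apply Cmod_triangle|]; rewrite Cmod_1, Cmod_opp; lra. }
  assert (A1 : Rabs (atan (Im (1 - u) / Re (1 - u))) <= PI).
  { pose proof (atan_bound (Im (1 - u) / Re (1 - u))); pose proof PI_RGT_0; apply Rabs_le; lra. }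
  assert (A2 : Rabs (ln r) <= - ln r + 2 * ln 2).
  { assert (ln r < ln 2) by (apply ln_increasing; lra).
    assert (0 < ln 2) by (rewrite <- ln_1; apply ln_increasing; lra).
    unfold Rabs; destruct (Rcase_abs (ln r)); lra. }
  lra.
Qed.

(** This is [zeta^(1/m)] as a function of [sigma]. The root is taken of [zeta / sigma^m], which
    stays in the right half-plane, since a principal root of [zeta] itself would have a cut through
    the disc. *)
Definition wch (m : nat) (sg : C) : C :=
  sg * cexp (Cln (lxi (sg ^ m) / sg ^ m) / RtoC (INR m)).

Section Chart.
Variable m : nat.
Hypothesis Hm : (1 <= m)%nat.

Let Hm0 : RtoC (INR m) <> 0.
Proof. apply RtoC_neq0, not_0_INR; lia. Qed.

Lemma Cmod_pow_lt1 sg : 0 < Cmod sg < 1 -> 0 < Cmod (sg ^ m) < 1.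
Proof.
  intros H; rewrite Cmod_pow; split; [apply pow_lt; lra|].
  destruct m as [|k]; [lia|]; simpl.
  assert (Cmod sg ^ k <= 1) by (rewrite <- (pow1 k); apply pow_incr; lra).
  nra.
Qed.

Lemma wch_pow sg : 0 < Cmod sg < 1 -> wch m sg ^ m = lxi (sg ^ m).
Proof.
  intros H; pose proof (Cmod_pow_lt1 sg H) as Hu.
  assert (N : sg ^ m <> 0) by (apply Cmod_gt_0; lra).
  unfold wch; rewrite Cpow_mult_l, cexp_pow.
  replace (RtoC (INR m) * (Cln (lxi (sg ^ m) / sg ^ m) / RtoC (INR m))) with (Cln (lxi (sg ^ m) / sg ^ m))
    by (field; exact Hm0).
  rewrite cexp_Cln by now apply Re_lxi_div.
  field; exact N.
Qed.

Lemma wch_diff sg : 0 < Cmod sg < 1 -> cdiff (wch m) sg.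
Proof.
  intros H; pose proof (Cmod_pow_lt1 sg H) as Hu.
  assert (N : sg ^ m <> 0) by (apply Cmod_gt_0; lra).
  assert (Dp : cdiff (fun q => q ^ m) sg) by apply (cdiff_pow (fun q => q)), cdiff_id.
  apply cdiff_mult; [apply cdiff_id|].
  apply (cdiff_comp (fun sg => Cln (lxi (sg ^ m) / sg ^ m) / RtoC (INR m)) cexp); [|apply cdiff_cexp].
  apply cdiff_mult; [|apply cdiff_const].
  apply (cdiff_comp (fun sg => lxi (sg ^ m) / sg ^ m) Cln); [|now apply cdiff_Cln, Re_lxi_div].
  apply cdiff_div; [|exact Dp|exact N].
  apply (cdiff_comp (fun q => q ^ m) lxi); [exact Dp|apply cdiff_lxi; lra].
Qed.

Lemma wch_neq0 sg : 0 < Cmod sg < 1 -> wch m sg <> 0.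
Proof.
  intros H; unfold wch; apply Cmult_neq_0; [apply Cmod_gt_0; lra|apply cexp_neq0].
Qed.

Lemma wch_Omega sg : 0 < Cmod sg < 1 -> in_Omega_chart m (wch m sg).
Proof.
  intros H; split; [now apply wch_neq0|].
  rewrite wch_pow by exact H; exists (1 - sg ^ m); split; [|reflexivity].
  replace (1 - sg ^ m - 1) with (- sg ^ m) by ring; rewrite Cmod_opp; apply Cmod_pow_lt1, H.
Qed.

Lemma Cln_RtoC x : 0 < x -> Cln (RtoC x) = RtoC (ln x).
Proof.
  intros H; unfold Cln; rewrite Carg_right by exact H; rewrite Cmod_R, Rabs_pos_eq by lra.
  unfold RtoC; simpl; f_equal; replace (0 / x)%R with 0%R by (field; lra); apply atan_0.
Qed.

(** Places the ray of the Laplace integral on the real interval [(0,1)] of the [sigma] disc, with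
    the ordinary positive root. *)
Lemma wch_real t : 0 < t ->
  wch m (RtoC (Rpower (1 - exp (- t)) (/ INR m))) = RtoC (Rpower t (/ INR m)).
Proof.
  intros Ht; pose proof (exp_opp_lt1 t Ht) as Hs.
  assert (HmR : 0 < INR m) by (apply lt_0_INR; lia).
  set (sg := Rpower (1 - exp (- t)) (/ INR m)).
  assert (Hsg : 0 < sg) by apply exp_pos.
  assert (E : RtoC sg ^ m = RtoC (1 - exp (- t))).
  { rewrite <- RtoC_pow; f_equal; unfold sg; rewrite <- Rpower_pow by apply exp_pos.
    rewrite Rpower_mult, Rinv_l, Rpower_1 by lra; reflexivity. }
  unfold wch; rewrite E.
  assert (Ex : lxi (RtoC (1 - exp (- t))) = RtoC t).
  { unfold lxi; rewrite <- RtoC_minus; replace (1 - (1 - exp (- t)))%R with (exp (- t)) by ring.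
    rewrite Cln_RtoC, ln_exp, <- RtoC_opp by lra; f_equal; ring. }
  rewrite Ex, <- RtoC_div by lra.
  rewrite Cln_RtoC by (apply Rdiv_lt_0_compat; lra).
  rewrite <- RtoC_div by lra; rewrite cexp_RtoC, <- RtoC_mult; f_equal.
  unfold sg, Rpower; rewrite <- exp_plus; f_equal.
  unfold Rdiv at 1; unfold Rdiv; rewrite ln_mult, ln_Rinv by (try apply Rinv_0_lt_compat; lra).
  field; lra.
Qed.

End Chart.

(** * Growth of the coefficients *)

Lemma sin_lower x : 0 <= x <= 2 -> x / 3 <= sin x.
Proof.
  intros Hx; pose proof (pre_sin_bound x 0 ltac:(lra) ltac:(lra)) as [L _].
  unfold sin_approx, sin_term in L; simpl in L.
  eapply Rle_trans; [|exact L].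
  assert (x * x <= 4) by nra.
  replace (1 * (x * 1 / 1) + -1 * 1 * (x * (x * (x * 1)) / (1 + 1 + 1 + 1 + 1 + 1)))%R
    with (x * (1 - x * x / 6))%R by field.
  nra.
Qed.

(** [1 - cos phi = 2 sin^2(phi/2) >= 2 (phi/6)^2]. *)
Lemma one_minus_cos_lower phi : 0 <= phi <= PI -> phi * phi / 18 <= 1 - cos phi.
Proof.
  intros H; pose proof PI_4.
  replace (cos phi) with (cos (2 * (phi / 2)))%R by (f_equal; field); rewrite cos_2a_sin.
  pose proof (sin_lower (phi / 2) ltac:(lra)) as S; nra.
Qed.

(** The kernel [|1 - rr e^(i phi)|^(-B)], written through the squared modulus. *)
Definition kern (B rr phi : R) : R := Rpower (1 - 2 * rr * cos phi + rr * rr) (- (B / 2)).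

Lemma Rpower_neg_le x y e : 0 < x <= y -> 0 <= e -> Rpower y (- e) <= Rpower x (- e).
Proof.
  intros H He; rewrite !Rpower_Ropp; apply Rinv_le_contravar; [apply exp_pos|].
  apply Rle_Rpower_l; lra.
Qed.

(** [|1 - rr e^(i phi)|^2 = (1-rr)^2 + 2 rr (1 - cos phi)] is at least a constant times
    [(1 - rr + phi)^2]. A power of an affine function of [phi] can be integrated explicitly. *)
Lemma kern_bound B rr phi : 0 < rr < 1 -> 0 <= phi <= PI -> 0 < B ->
  (kern B rr phi <= Rpower (rr / 18) (- (B / 2)) * Rpower (1 - rr + phi) (- B)).
Proof.
  intros HR Hp HB; pose proof (one_minus_cos_lower phi Hp) as Hc.
  set (P := (1 - rr + phi)%R); assert (HP : 0 < P) by (unfold P; lra).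
  assert (Lo : rr / 18 * (P * P) <= 1 - 2 * rr * cos phi + rr * rr).
  { assert (E1 : P * P <= 2 * ((1 - rr) * (1 - rr) + phi * phi)).
    { unfold P; pose proof (Rle_0_sqr (1 - rr - phi)) as Q; unfold Rsqr in Q; nra. }
    assert (E2 : rr * (phi * phi / 18) <= rr * (1 - cos phi)) by (apply Rmult_le_compat_l; lra).
    assert (E3 : rr / 18 * (P * P) <= rr / 18 * (2 * ((1 - rr) * (1 - rr) + phi * phi)))
      by (apply Rmult_le_compat_l; lra).
    assert (E4 : rr * ((1 - rr) * (1 - rr)) <= (1 - rr) * (1 - rr)) by (pose proof (Rle_0_sqr (1 - rr)) as Q; unfold Rsqr in Q; nra).
    nra. }
  assert (HPP : 0 < rr / 18 * (P * P)) by (apply Rmult_lt_0_compat; nra).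
  unfold kern; eapply Rle_trans; [apply Rpower_neg_le with (x := (rr / 18 * (P * P))%R); [split; [exact HPP|exact Lo]|lra]|].
  rewrite <- Rpower_mult_distr by nra; right; f_equal.
  rewrite <- Rpower_mult_distr by lra; rewrite <- Rpower_plus; f_equal; field.
Qed.

Lemma kern_arg_pos rr phi : 0 < rr < 1 -> 0 < 1 - 2 * rr * cos phi + rr * rr.
Proof. intros H; pose proof (COS_bound phi); nra. Qed.

Lemma kern_cont B rr (m t : R) : 0 < rr < 1 -> continuous (fun t => kern B rr (m * t)) t.
Proof.
  intros H; pose proof (kern_arg_pos rr (m * t) H).
  apply ex_derive_cont; unfold kern, Rpower; auto_derive; lra.
Qed.

Lemma kern_RInt_ex B rr (m a b : R) : 0 < rr < 1 ->
  is_RInt (fun t => kern B rr (m * t)) a b (RInt (fun t => kern B rr (m * t)) a b).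
Proof.
  intros H; apply continuous_is_RInt.
  intros; now apply kern_cont.
Qed.

(** [sn = 1] and [sn = -1] are the two halves of a period around a peak of the kernel. *)
Lemma kern_half B rr (m sn : R) j p1 p2 : 0 < rr < 1 -> 1 < B -> 0 < m ->
  (sn * sn = 1)%R -> p1 <= p2 ->
  (forall t, p1 <= t <= p2 -> 0 <= sn * (m * t - 2 * INR j * PI) <= PI) ->
  (RInt (fun t => kern B rr (m * t)) p1 p2 <=
     Rpower (rr / 18) (- (B / 2)) * Rpower (1 - rr) (1 - B) / (m * (B - 1)))%R.
Proof.
  intros HR HB Hm Hsn Hp Hb.
  set (c := Rpower (rr / 18) (- (B / 2))); assert (Hc : 0 < c) by apply exp_pos.
  assert (Hd : 0 < c / (m * (B - 1))) by (apply Rdiv_lt_0_compat; [exact Hc|apply Rmult_lt_0_compat; lra]).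
  set (Q := fun t => (1 - rr + sn * (m * t - 2 * INR j * PI))%R).
  (* [Q] has derivative [sn * m], so the second factor [sn] in [G] restores the sign through
     [sn * sn = 1]. The hypothesis [B > 1] keeps the exponent [1 - B] of the primitive negative. *)
  set (G := fun t => (- (sn * (c / (m * (B - 1)) * Rpower (Q t) (1 - B))))%R).
  set (dG := fun t => (c * Rpower (Q t) (- B))%R).
  assert (HQ : forall t, p1 <= t <= p2 -> 1 - rr <= Q t) by (intros t Ht; specialize (Hb t Ht); unfold Q; lra).
  eapply Rle_trans; [apply (RInt_le_primitive_on _ G dG)|].
  - exact Hp.
  - intros; now apply kern_cont.
  - intros t Ht; specialize (HQ t Ht); unfold G, dG, Rpower, Q in *; auto_derive; [lra|].
    set (q := (1 - rr + sn * (m * t - 2 * INR j * PI))%R) in *.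
    replace (1 - rr + sn * (m * t + - (2 * INR j * PI)))%R with q by (unfold q; ring).
    replace (exp (- B * ln q)) with (sn * sn * (exp ((1 - B) * ln q) * / q))%R.
    + unfold Rminus; field; repeat split; lra.
    + rewrite Hsn, Rmult_1_l; rewrite <- (exp_ln q) at 2 by lra.
      rewrite <- exp_Ropp, <- exp_plus; f_equal; ring.
  - intros t Ht; specialize (HQ t Ht).
    apply ex_derive_cont; unfold dG, Rpower, Q in *; auto_derive; lra.
  - intros t Ht; specialize (Hb t Ht); unfold dG, c, Q.
    eapply Rle_trans; [|apply kern_bound; [exact HR|exact Hb|lra]].
    assert (Ec : cos (m * t) = cos (sn * (m * t - 2 * INR j * PI))).
    { assert (E : cos (m * t) = cos (m * t - 2 * INR j * PI))
        by (rewrite <- (cos_period (m * t - 2 * INR j * PI) j); f_equal; ring).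
      assert (Hs : (sn = 1 \/ sn = - 1)%R).
      { destruct (Rmult_integral (sn - 1) (sn + 1)) as [h|h]; [nra|left; lra|right; lra]. }
      rewrite E; destruct Hs as [-> | ->]; [now rewrite Rmult_1_l|].
      rewrite <- cos_neg; f_equal; ring. }
    unfold kern; rewrite Ec; right; reflexivity.
  - assert (HP : forall t, p1 <= t <= p2 -> 0 < Rpower (Q t) (1 - B) <= Rpower (1 - rr) (1 - B)).
    { intros t Ht; split; [apply exp_pos|]; replace (1 - B)%R with (- (B - 1))%R by ring.
      apply Rpower_neg_le; [split; [lra|auto]|lra]. }
    pose proof (HP p1 ltac:(lra)) as P1; pose proof (HP p2 ltac:(lra)) as P2; unfold G.
    replace (c * Rpower (1 - rr) (1 - B) / (m * (B - 1)))%R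
      with (c / (m * (B - 1)) * Rpower (1 - rr) (1 - B))%R by (field; lra).
    assert (Hs : (sn <= 1 /\ - sn <= 1)) by nra.
    set (k := (c / (m * (B - 1)))%R) in *; set (u := Rpower (Q p1) (1 - B)) in *; set (v := Rpower (Q p2) (1 - B)) in *.
    replace (- (sn * (k * v)) - - (sn * (k * u)))%R with (k * (sn * (u - v)))%R by ring.
    apply Rmult_le_compat_l; [lra|]; destruct (Rle_dec v u); nra.
Qed.

(** The angle [m t] meets [m] full periods of the kernel, each with two halves bounded by [X]; the
    [1/m] contained in [X] compensates for their number. *)
Lemma kern_circle B rr (m : nat) : 0 < rr < 1 -> 1 < B -> (1 <= m)%nat ->
  (RInt (fun t => kern B rr (INR m * t)) 0 (2 * PI) <=
     2 * (Rpower (rr / 18) (- (B / 2)) * Rpower (1 - rr) (1 - B) / (B - 1)))%R.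
Proof.
  intros HR HB Hm1; pose proof PI_RGT_0 as Hpi.
  assert (Hm : 0 < INR m) by (apply lt_0_INR; lia).
  set (X := (Rpower (rr / 18) (- (B / 2)) * Rpower (1 - rr) (1 - B) / (INR m * (B - 1)))%R).
  assert (Ind : forall j, (RInt (fun t => kern B rr (INR m * t)) 0 (2 * INR j * PI / INR m) <= INR j * (2 * X))%R).
  { induction j.
    - simpl INR; replace (2 * 0 * PI / INR m)%R with 0%R by (field; lra).
      rewrite (RInt_point (V := R_CompleteNormedModule)); unfold zero; simpl; lra.
    - set (p := (2 * INR j * PI / INR m)%R) in *.
      set (p' := (2 * INR (S j) * PI / INR m)%R).
      set (pm := (p + PI / INR m)%R).
      assert (Hp : (INR m * p = 2 * INR j * PI)%R) by (unfold p; field; lra).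
      assert (Hp' : (INR m * p' = 2 * INR (S j) * PI)%R) by (unfold p'; field; lra).
      assert (Hpm : (INR m * pm = 2 * INR j * PI + PI)%R) by (unfold pm; rewrite Rmult_plus_distr_l, Hp; field; lra).
      rewrite S_INR in Hp'.
      assert (Hord : p <= pm <= p') by (split; apply Rmult_le_reg_l with (INR m); lra).
      assert (Hmon : forall u v, u <= v -> INR m * u <= INR m * v) by (intros; apply Rmult_le_compat_l; lra).
      assert (A1 : (RInt (fun t => kern B rr (INR m * t)) p pm <= X)%R).
      { apply (kern_half B rr (INR m) 1 j); try lra.
        intros t Ht; pose proof (Hmon p t ltac:(lra)); pose proof (Hmon t pm ltac:(lra)); lra. }
      assert (A2 : (RInt (fun t => kern B rr (INR m * t)) pm p' <= X)%R).
      { apply (kern_half B rr (INR m) (-1) (S j)); try lra; rewrite S_INR.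
        intros t Ht; pose proof (Hmon pm t ltac:(lra)); pose proof (Hmon t p' ltac:(lra)); lra. }
      assert (Ch : RInt (fun t => kern B rr (INR m * t)) 0 p' =
        (RInt (fun t => kern B rr (INR m * t)) 0 p + RInt (fun t => kern B rr (INR m * t)) p pm
         + RInt (fun t => kern B rr (INR m * t)) pm p')%R).
      { apply is_RInt_unique.
        apply (is_RInt_Chasles (V := R_NormedModule) _ 0 pm p');
          [apply (is_RInt_Chasles (V := R_NormedModule) _ 0 p pm)|]; now apply kern_RInt_ex. }
      rewrite Ch, S_INR; lra. }
  specialize (Ind m).
  replace (2 * INR m * PI / INR m)%R with (2 * PI)%R in Ind by (field; lra).
  eapply Rle_trans; [exact Ind|]; right; unfold X; field; lra.
Qed.

Lemma pol_pow rho t m : 0 < rho -> pol rho t ^ m = pol (rho ^ m) (INR m * t).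
Proof.
  intros H; rewrite pol_cexp_ln, cexp_pow by exact H.
  rewrite pol_cexp_ln by now apply pow_lt.
  f_equal; rewrite <- Rpower_pow, ln_Rpower by exact H.
  unfold Cmult, RtoC; simpl; f_equal; ring.
Qed.

Lemma Rpower_Cmod_1m_pol rr phi B : 0 < rr < 1 ->
  Rpower (Cmod (1 - pol rr phi)) (- B) = kern B rr phi.
Proof.
  intros H; pose proof (kern_arg_pos rr phi H) as Hp.
  assert (E : Cmod (1 - pol rr phi) = sqrt (1 - 2 * rr * cos phi + rr * rr)).
  { unfold Cmod, pol; simpl; f_equal; pose proof (sin2_cos2 phi) as SC; unfold Rsqr in SC.
    replace (1 - 2 * rr * cos phi + rr * rr)%R with (1 - 2 * rr * cos phi + rr * rr * (sin phi * sin phi + cos phi * cos phi))%R by (rewrite SC; ring).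
    ring. }
  rewrite E, <- Rpower_sqrt, Rpower_mult by exact Hp; unfold kern; f_equal; field.
Qed.

Lemma pow_le_base (m : nat) rho : (1 <= m)%nat -> 0 < rho < 1 -> rho ^ m <= rho.
Proof.
  intros Hm Hr; destruct m as [|k]; [lia|]; simpl.
  assert (rho ^ k <= 1) by (rewrite <- (pow1 k); apply pow_incr; lra).
  nra.
Qed.

Section Growth.
Variables (H : C -> C) (c : nat -> C) (r0 : R) (m : nat) (C0 B : R).
Hypothesis H_diff : forall q, 0 < Cmod q < 1 -> cdiff H q.
Hypothesis r0_pos : 0 < r0.
Hypothesis H_series : forall q, 0 < Cmod q < r0 -> cseries (fun k => c k * q ^ k) (H q).
Hypothesis Hm : (1 <= m)%nat.
Hypothesis HB : 1 < B.
Hypothesis HC0 : 0 <= C0.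
Hypothesis H_bound : forall q, 1 / 2 <= Cmod q < 1 ->
  (Cmod (H q) <= C0 * Rpower (Cmod (1 - q ^ m)) (- B)).

Lemma circle_bounded rho : 1 / 2 <= rho < 1 -> exists K, forall q, Cmod q = rho -> Cmod (H q) <= K.
Proof.
  intros Hr; exists (C0 * Rpower (1 - rho ^ m) (- B))%R; intros q Hq.
  pose proof (pow_le_base m rho Hm ltac:(lra)).
  eapply Rle_trans; [apply H_bound; lra|]; apply Rmult_le_compat_l; [exact HC0|].
  apply Rpower_neg_le; [|lra]; split; [lra|].
  pose proof (Cmod_le_add 1 (q ^ m)) as T; rewrite Cmod_1, Cmod_pow, Hq in T.
  lra.
Qed.

Lemma coef_growth : exists D, (0 <= D) /\ forall n, Cmod (c n) <= D * Rpower (INR n + 2) (B - 1).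
Proof.
  pose proof PI_RGT_0 as Hpi.
  set (c0 := Rpower ((/ 2) ^ m / 18) (- (B / 2))).
  assert (Hc0 : 0 < c0) by apply exp_pos.
  set (D := (3 * (C0 * (2 * (c0 / (B - 1)))) / (2 * PI))%R).
  assert (HD0 : 0 <= C0 * (2 * (c0 / (B - 1)))).
  { apply Rmult_le_pos; [exact HC0|]; apply Rmult_le_pos; [lra|left; apply Rdiv_lt_0_compat; lra]. }
  exists D; split.
  { unfold D, Rdiv; apply Rmult_le_pos; [lra|left; apply Rinv_0_lt_compat; lra]. }
  intros n; pose proof (pos_INR n) as Hn.
  (* [1 - rho = 1 / (n + 2)]; the shift by 2 keeps [rho >= 1/2], where [H_bound] applies, already
     for [n = 0]. *)
  set (rho := ((INR n + 1) / (INR n + 2))%R).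
  assert (E1 : (1 - rho = / (INR n + 2))%R) by (unfold rho; field; lra).
  assert (Hinv : 0 < / (INR n + 2) <= 1 / 2).
  { split; [apply Rinv_0_lt_compat; lra|]. unfold Rdiv; rewrite Rmult_1_l; apply Rinv_le_contravar; lra. }
  assert (Hr : 1 / 2 <= rho < 1) by lra.
  assert (HR : 0 < rho ^ m < 1).
  { split; [apply pow_lt; lra|]; pose proof (pow_le_base m rho Hm ltac:(lra)); lra. }
  pose proof (coef_bound H c r0 H_diff r0_pos H_series n rho
    (fun t => C0 * kern B (rho ^ m) (INR m * t))%R
    (C0 * RInt (fun t => kern B (rho ^ m) (INR m * t)) 0 (2 * PI))%R ltac:(lra)) as CB.
  assert (X1 : (2 * PI * (Cmod (c n) * rho ^ n) <= C0 * RInt (fun t => kern B (rho ^ m) (INR m * t)) 0 (2 * PI))%R).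
  { apply CB.
    - intros t _; eapply Rle_trans; [apply H_bound; rewrite Cmod_pol; lra|].
      right; rewrite pol_pow, Rpower_Cmod_1m_pol by lra; reflexivity.
    - apply (is_RInt_scal (V := R_NormedModule) _ 0 (2 * PI) C0); now apply kern_RInt_ex. }
  assert (X2 : (RInt (fun t => kern B (rho ^ m) (INR m * t)) 0 (2 * PI) <= 2 * (c0 / (B - 1)) * Rpower (INR n + 2) (B - 1))%R).
  { eapply Rle_trans; [apply kern_circle; auto|].
    assert (Y1 : Rpower (rho ^ m / 18) (- (B / 2)) <= c0).
    { apply Rpower_neg_le; [|lra].
      assert ((/ 2) ^ m <= rho ^ m) by (apply pow_incr; lra).
      assert (0 < (/ 2) ^ m) by (apply pow_lt; lra). lra. }
    assert (Y2 : Rpower (1 - rho ^ m) (1 - B) <= Rpower (INR n + 2) (B - 1)).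
    { apply Rle_trans with (Rpower (/ (INR n + 2)) (- (B - 1))).
      - replace (1 - B)%R with (- (B - 1))%R by ring; apply Rpower_neg_le; [|lra].
        pose proof (pow_le_base m rho Hm ltac:(lra)); lra.
      - right; unfold Rpower; rewrite ln_Rinv by lra; f_equal; ring. }
    assert (Z1 : 0 < Rpower (rho ^ m / 18) (- (B / 2))) by apply exp_pos.
    assert (Z2 : 0 < Rpower (1 - rho ^ m) (1 - B)) by apply exp_pos.
    replace (2 * (c0 / (B - 1)) * Rpower (INR n + 2) (B - 1))%R with (2 * ((c0 * Rpower (INR n + 2) (B - 1)) / (B - 1)))%R by (field; lra).
    apply Rmult_le_compat_l; [lra|]; apply Rmult_le_compat_r; [left; apply Rinv_0_lt_compat; lra|].
    apply Rmult_le_compat; lra. }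
  (* [- ln rho <= 1/rho - 1 = 1/(n+1)], so [rho^n >= e^(-1) >= 1/3]. *)
  assert (X3 : 1 <= 3 * rho ^ n).
  { assert (Hrn : 0 < rho ^ n) by (apply pow_lt; lra).
    assert (L : - 1 <= INR n * ln rho).
    { assert (Hl : - ln rho <= / (INR n + 1)).
      { rewrite <- ln_Rinv by lra; eapply Rle_trans; [apply ln_le_sub1, Rinv_0_lt_compat; lra|].
        right; unfold rho; field; lra. }
      assert (INR n * (- ln rho) <= INR n * / (INR n + 1)) by (apply Rmult_le_compat_l; lra).
      assert (INR n * / (INR n + 1) <= 1).
      { apply Rmult_le_reg_r with (INR n + 1)%R; [lra|]; rewrite Rmult_assoc, Rinv_l by lra; lra. }
      lra. }
    rewrite <- Rpower_pow by lra; unfold Rpower.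
    assert (E3 : exp (-1) <= exp (INR n * ln rho)) by (apply exp_le_compat; lra).
    assert (E4 : (exp (-1) * exp 1 = 1)%R) by (rewrite <- exp_plus; replace (-1 + 1)%R with 0%R by ring; apply exp_0).
    pose proof exp_le_3; pose proof (exp_pos (-1)); nra. }
  set (P := Rpower (INR n + 2) (B - 1)) in *.
  assert (HP : 0 < P) by apply exp_pos.
  assert (X4 : 2 * PI * (Cmod (c n) * rho ^ n) <= C0 * (2 * (c0 / (B - 1))) * P).
  { eapply Rle_trans; [exact X1|].
    rewrite Rmult_assoc; apply Rmult_le_compat_l; [exact HC0|exact X2]. }
  assert (X5 : 2 * PI * Cmod (c n) <= 3 * (C0 * (2 * (c0 / (B - 1))) * P)).
  { apply Rle_trans with (3 * (2 * PI * (Cmod (c n) * rho ^ n)))%R; [|lra].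
    assert (0 <= 2 * PI * Cmod (c n)) by (apply Rmult_le_pos; [lra|apply Cmod_ge_0]).
    replace (3 * (2 * PI * (Cmod (c n) * rho ^ n)))%R with ((2 * PI * Cmod (c n)) * (3 * rho ^ n))%R by ring.
    nra. }
  apply Rmult_le_reg_l with (2 * PI)%R; [lra|].
  eapply Rle_trans; [exact X5|]; right; unfold D; field; lra.
Qed.

End Growth.

(** The assumed bound concerns [w^(m-1)] and the wanted one [q^(m-1)]. Their quotient is bounded for
    [|q| >= 1/2] because [lxi_lower] keeps [w] away from 0, which explains [kap]; [lxi_upper] treats
    the exponential. *)
Lemma chart_bound (m : nat) (F : C -> C) (A B B' : R) : (1 <= m)%nat -> 0 < A -> B <= B' -> 0 < B' ->
  (forall w : C, in_Omega_chart m w -> Cmod (F w * w ^ (m - 1)) <= A * exp (B * Cmod w ^ m)) ->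
  exists C0, (0 <= C0) /\ forall q, 1 / 2 <= Cmod q < 1 ->
    (Cmod (F (wch m q) * q ^ (m - 1))%C <= C0 * Rpower (Cmod (1 - q ^ m)) (- B')).
Proof.
  intros Hm HA HBB HB' HF.
  set (kap := ((/ 2) ^ m / 4)%R).
  assert (Hkap : 0 < kap < 1).
  { assert (0 < (/ 2) ^ m) by (apply pow_lt; lra).
    assert ((/ 2) ^ m <= 1) by (rewrite <- (pow1 m); apply pow_incr; lra). unfold kap; lra. }
  set (L := (2 * ln 2 + PI)%R).
  exists (A * exp (B' * L) * / kap ^ (m - 1))%R.
  assert (Hk1 : 0 < / kap ^ (m - 1)) by (apply Rinv_0_lt_compat, pow_lt; lra).
  pose proof (exp_pos (B' * L)) as HE.
  assert (HAE : 0 < A * exp (B' * L)) by (apply Rmult_lt_0_compat; lra).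
  split; [left; apply Rmult_lt_0_compat; lra|].
  intros q Hq; assert (Hq' : 0 < Cmod q < 1) by lra.
  pose proof (Cmod_pow_lt1 m Hm q Hq') as Hu.
  pose proof (wch_pow m Hm q Hq') as Ew.
  set (w := wch m q) in *.
  assert (Hw0 : w <> 0) by now apply wch_neq0.
  assert (Hwm : (Cmod w ^ m = Cmod (lxi (q ^ m)))%R) by now rewrite <- Cmod_pow, Ew.
  pose proof (lxi_lower (q ^ m) (proj2 Hu)) as Lo.
  pose proof (lxi_upper (q ^ m) (proj2 Hu)) as Up; fold L in Up.
  assert (Hlow : kap <= Cmod w ^ m).
  { rewrite Hwm; eapply Rle_trans; [|exact Lo]; rewrite Cmod_pow; unfold kap.
    assert ((/ 2) ^ m <= Cmod q ^ m) by (apply pow_incr; lra). lra. }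
  (* A value [|w| < kap < 1] would give [|w|^m <= |w| < kap]. *)
  assert (Hwk : kap <= Cmod w).
  { apply Rnot_lt_le; intros Hlt.
    assert (Hwp : 0 < Cmod w) by now apply Cmod_gt_0.
    assert (Cmod w ^ m <= Cmod w) by (apply pow_le_base; [exact Hm|lra]). lra. }
  pose proof (HF w (wch_Omega m Hm q Hq')) as HFw.
  assert (E : F w * q ^ (m - 1) = (F w * w ^ (m - 1)) * (q ^ (m - 1) * / w ^ (m - 1))).
  { field; now apply Cpow_nz. }
  rewrite E, Cmod_mult.
  assert (R1 : Cmod (q ^ (m - 1) * / w ^ (m - 1)) <= / kap ^ (m - 1)).
  { rewrite Cmod_mult, Cmod_inv, !Cmod_pow by now apply Cpow_nz.
    assert (Cmod q ^ (m - 1) <= 1) by (rewrite <- (pow1 (m - 1)); apply pow_incr; lra).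
    assert (0 <= Cmod q ^ (m - 1)) by (apply pow_le; lra).
    assert (K1 : / Cmod w ^ (m - 1) <= / kap ^ (m - 1)).
    { apply Rinv_le_contravar; [apply pow_lt; lra|apply pow_incr; lra]. }
    assert (0 < / Cmod w ^ (m - 1)) by (apply Rinv_0_lt_compat, pow_lt; lra). nra. }
  set (P := Rpower (Cmod (1 - q ^ m)) (- B')).
  assert (R2 : A * exp (B * Cmod w ^ m) <= A * exp (B' * L) * P).
  { rewrite Rmult_assoc; apply Rmult_le_compat_l; [lra|].
    unfold P, Rpower; rewrite <- exp_plus; apply exp_le_compat; rewrite Hwm.
    set (X := Cmod (lxi (q ^ m))) in *.
    assert (0 <= X) by apply Cmod_ge_0.
    assert (B * X <= B' * X) by (apply Rmult_le_compat_r; lra).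
    assert (B' * X <= B' * (- ln (Cmod (1 - q ^ m)) + L)) by (apply Rmult_le_compat_l; lra). lra. }
  assert (HP : 0 < P) by apply exp_pos.
  replace (A * exp (B' * L) * / kap ^ (m - 1) * P)%R with ((A * exp (B' * L) * P) * / kap ^ (m - 1))%R by ring.
  apply Rmult_le_compat; try apply Cmod_ge_0; [lra|exact R1].
Qed.

(** * Expansion at the origin *)

Lemma csum_add u a b : csum u (a + b) = csum u a + csum (fun i => u (i + a)%nat) b.
Proof.
  induction b; [rewrite Nat.add_0_r; simpl; ring|].
  rewrite Nat.add_succ_r; simpl; rewrite IHb, (Nat.add_comm b a); ring.
Qed.

Lemma csum_plus u v n : csum (fun k => u k + v k) n = csum u n + csum v n.
Proof. induction n; simpl; [ring|rewrite IHn; ring]. Qed.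

Lemma csum_blocks u m J :
  csum u (m * J) = csum (fun l => csum (fun j => u (l + m * j)%nat) J) m.
Proof.
  induction J.
  - rewrite Nat.mul_0_r; simpl; clear; induction m; simpl; [reflexivity|rewrite <- IHm; ring].
  - rewrite Nat.mul_succ_r, csum_add, IHJ; simpl; now rewrite csum_plus.
Qed.

Lemma csum_limit (f : nat -> nat -> C) (L : nat -> C) k :
  (forall l, (l < k)%nat -> forall eps, 0 < eps -> exists N, forall n, (N <= n)%nat -> Cmod (f l n - L l) < eps) ->
  (forall eps, 0 < eps -> exists N, forall n, (N <= n)%nat -> Cmod (csum (fun l => f l n) k - csum L k) < eps)%R.
Proof.
  induction k; intros H e He.
  - exists 0%nat; intros n _; simpl; replace (0 - 0) with (RtoC 0) by ring; rewrite Cmod_0; exact He.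
  - destruct (IHk ltac:(intros; apply H; [lia|assumption]) (e / 2)%R ltac:(lra)) as [N1 H1].
    destruct (H k ltac:(lia) (e / 2)%R ltac:(lra)) as [N2 H2].
    exists (N1 + N2)%nat; intros n Hn; specialize (H1 n ltac:(lia)); specialize (H2 n ltac:(lia)); simpl.
    replace (csum (fun l => f l n) k + f k n - (csum L k + L k)) with
      ((csum (fun l => f l n) k - csum L k) + (f k n - L k)) by ring.
    eapply Rle_lt_trans; [apply Cmod_triangle|lra].
Qed.

Lemma csum_const_bound u K n : (forall k, (k < n)%nat -> Cmod (u k) <= K) -> Cmod (csum u n) <= INR n * K.
Proof.
  induction n; intros H; [simpl; rewrite Cmod_0; lra|].
  rewrite S_INR; simpl csum; eapply Rle_trans; [apply Cmod_triangle|].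
  specialize (H n ltac:(lia)) as H1; pose proof (IHn ltac:(intros; apply H; lia)); lra.
Qed.

Lemma cseries_terms_small u l : cseries u l ->
  (forall eps, 0 < eps -> exists N, forall n, (N <= n)%nat -> Cmod (u n) < eps).
Proof.
  intros H e He; destruct (H (e / 2)%R ltac:(lra)) as [N HN]; exists N; intros n Hn.
  pose proof (HN n Hn) as A1; pose proof (HN (S n) ltac:(lia)) as A2; simpl in A2.
  replace (u n) with ((csum u n + u n - l) - (csum u n - l)) by ring.
  unfold Cminus at 1; eapply Rle_lt_trans; [apply Cmod_triangle|]; rewrite Cmod_opp; lra.
Qed.

Lemma uniform_smallness (P : nat -> nat -> Prop) k :
  (forall l, (l < k)%nat -> exists N, forall n, (N <= n)%nat -> P l n) ->
  exists N, forall n, (N <= n)%nat -> forall l, (l < k)%nat -> P l n.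
Proof.
  induction k; intros H; [exists 0%nat; lia|].
  destruct IHk as [N1 H1]; [intros; apply H; lia|].
  destruct (H k ltac:(lia)) as [N2 H2].
  exists (N1 + N2)%nat; intros n Hn l Hl; destruct (Nat.eq_dec l k) as [->|]; [apply H2; lia|apply H1; lia].
Qed.

Lemma cseries_interleave (m : nat) u L : (1 <= m)%nat ->
  (forall l, (l < m)%nat -> cseries (fun j => u (l + m * j)%nat) (L l)) -> cseries u (csum L m).
Proof.
  intros Hm H e He.
  destruct (csum_limit (fun l J => csum (fun j => u (l + m * j)%nat) J) L m H (e / 2)%R ltac:(lra)) as [N1 H1].
  assert (HmR : 0 < INR m) by (apply lt_0_INR; lia).
  destruct (uniform_smallness (fun l J => Cmod (u (l + m * J)%nat) < e / (2 * INR m))%R m) as [N2 H2].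
  { intros l Hl; apply (cseries_terms_small _ _ (H l Hl)); apply Rdiv_lt_0_compat; lra. }
  exists (m * (N1 + N2))%nat; intros n Hn.
  set (J := (n / m)%nat); set (i := (n mod m)%nat).
  assert (En : n = (m * J + i)%nat) by (apply Nat.div_mod_eq).
  assert (Hi : (i < m)%nat) by (apply Nat.mod_upper_bound; lia).
  assert (HJ : (N1 + N2 <= J)%nat) by (apply Nat.div_le_lower_bound; lia).
  rewrite En, csum_add, csum_blocks.
  specialize (H1 J ltac:(lia)); specialize (H2 J ltac:(lia)); cbv beta in H2.
  assert (Hrest : (Cmod (csum (fun k => u (k + m * J)%nat) i) <= INR i * (e / (2 * INR m)))%R).
  { apply csum_const_bound; intros k Hk; left; apply H2; lia. }
  assert (HiR : INR i <= INR m) by (apply le_INR; lia).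
  assert (Hs : INR i * (e / (2 * INR m)) <= e / 2).
  { apply Rle_trans with (INR m * (e / (2 * INR m)))%R.
    - apply Rmult_le_compat_r; [left; apply Rdiv_lt_0_compat; lra|exact HiR].
    - right; field; lra. }
  set (X := csum (fun l => csum (fun j => u (l + m * j)%nat) J) m) in *.
  replace (X + csum (fun k => u (k + m * J)%nat) i - csum L m) with
    ((X - csum L m) + csum (fun k => u (k + m * J)%nat) i) by ring.
  eapply Rle_lt_trans; [apply Cmod_triangle|lra].
Qed.

Lemma common_radius (P : nat -> R -> Prop) k :
  (forall l r r', P l r -> 0 < r' <= r -> P l r') ->
  (forall l, (l < k)%nat -> exists r, (0 < r) /\ P l r) ->
  exists r, (0 < r) /\ forall l, (l < k)%nat -> P l r.
Proof.
  intros Hmono; induction k; intros H; [exists 1%R; split; [lra|lia]|].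
  destruct IHk as [r1 [Hr1 H1]]; [intros; apply H; lia|].
  destruct (H k ltac:(lia)) as [r2 [Hr2 H2]].
  exists (Rmin r1 r2); assert (Hmin : 0 < Rmin r1 r2) by now apply Rmin_pos.
  split; [exact Hmin|]; intros l Hl; destruct (Nat.eq_dec l k) as [->|].
  - apply (Hmono _ r2); [exact H2|split; [exact Hmin|apply Rmin_r]].
  - apply (Hmono _ r1); [apply H1; lia|split; [exact Hmin|apply Rmin_l]].
Qed.

Lemma lxi_0 : lxi 0 = 0.
Proof.
  unfold lxi; replace (1 - 0) with (RtoC 1) by ring; rewrite Cln_RtoC, ln_1 by lra; ring.
Qed.

(** Splitting both series according to the residue of the index modulo [m]
    reduces the expansion of [F] to the definition of the [d n]. *)
Lemma chart_series (m : nat) (a d : nat -> C) (F : C -> C) :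
  (1 <= m)%nat ->
  (exists rho : R, (0 < rho) /\
     forall w : C, in_Omega_chart m w -> Cmod w < rho -> is_series (borel_term m a w) (F w)) ->
  (forall l : nat, (1 <= l <= m)%nat -> taylor_coeffs_d m a d l) ->
  exists r0, (0 < r0) /\ forall q, 0 < Cmod q < r0 ->
    cseries (fun k => d (S k) * q ^ k) (F (wch m q) * q ^ (m - 1)).
Proof.
  intros Hm [rho [Hrho HF]] Hd.
  assert (HmR : 0 < INR m) by (apply lt_0_INR; lia).
  destruct (common_radius (fun l r => forall s : C, Cmod (s - 1) < r ->
      let xi := - Cln s in exists sig : C,
        is_series (fun k => a (S l + m * k)%nat * xi ^ k / RtoC (RGamma (INR (S l) / INR m + INR k))) sig /\
        is_series (fun j => d (S l + m * j)%nat * (1 - s) ^ j)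
                  (cpowc (qfun xi) (RtoC (INR (S l) / INR m - 1)) * sig)) m) as [r [Hr HT]].
  { intros l r1 r2 H1 H2 s Hs; apply H1; lra. }
  { intros l Hl; destruct (Hd (S l) ltac:(lia)) as [r [Hr H]]; exists r; split; assumption. }
  (* The tolerance [rho ^ m] will give [|w|^m = |xi| < rho^m], which brings [w] into the domain of
     the Borel series. *)
  destruct (cdiff_cont _ _ (cdiff_lxi 0 ltac:(rewrite Cmod_0; lra)) (rho ^ m)%R ltac:(now apply pow_lt)) as [d1 [Hd1 Hl]].
  exists (Rmin 1 (Rmin r d1)); split; [repeat apply Rmin_pos; lra|]; intros q Hq.
  assert (Hq1 : 0 < Cmod q < 1) by (pose proof (Rmin_l 1 (Rmin r d1)); lra).
  assert (Hq2 : Cmod q < r) by (pose proof (Rmin_r 1 (Rmin r d1)); pose proof (Rmin_l r d1); lra).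
  assert (Hq3 : Cmod q < d1) by (pose proof (Rmin_r 1 (Rmin r d1)); pose proof (Rmin_r r d1); lra).
  assert (Hqm : Cmod (q ^ m) <= Cmod q) by (rewrite Cmod_pow; apply pow_le_base; assumption).
  pose proof (Cmod_pow_lt1 m Hm q Hq1) as Hu.
  pose proof (wch_pow m Hm q Hq1) as Ew.
  pose proof (wch_neq0 m q Hq1) as Hw0.
  assert (Hq0 : q <> 0) by (apply Cmod_gt_0; lra).
  set (w := wch m q) in *; set (u := q ^ m) in *; set (xi := lxi u) in *.
  assert (Hw : Cmod w < rho).
  { apply Rnot_le_lt; intros Hle.
    assert (L1 : rho ^ m <= Cmod w ^ m) by (apply pow_incr; lra).
    rewrite <- Cmod_pow, Ew in L1.
    specialize (Hl u); rewrite lxi_0 in Hl; replace (u - 0) with u in Hl by ring.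
    replace (lxi u - 0) with xi in Hl by (unfold xi; ring).
    specialize (Hl ltac:(lra)); lra. }
  pose proof (HF w (wch_Omega m Hm q Hq1) Hw) as HFw; apply is_series_cseries in HFw.
  assert (Hxi0 : xi <> 0).
  { rewrite <- Ew; now apply Cpow_nz. }
  (* Here [1 - e^(-xi) = u], so the principal power in the definition of the [d n] uses the same
     logarithm as the chart. *)
  assert (Eq : qfun xi = xi / u).
  { unfold qfun; destruct (excluded_middle_informative _) as [Z|_]; [tauto|].
    unfold xi at 2; rewrite cexp_opp_lxi by lra; f_equal; ring. }
  assert (Hs : Cmod ((1 - u) - 1) < r).
  { replace ((1 - u) - 1) with (- u) by ring; rewrite Cmod_opp; lra. }
  set (good := fun l sig =>
        is_series (fun k => a (S l + m * k)%nat * xi ^ k / RtoC (RGamma (INR (S l) / INR m + INR k))) sig /\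
        is_series (fun j => d (S l + m * j)%nat * (1 - (1 - u)) ^ j)
                  (cpowc (qfun xi) (RtoC (INR (S l) / INR m - 1)) * sig)).
  (* Interleaving takes the sums as a function of the residue; one chosen value serves both the
     Borel series and the Taylor series of that class. *)
  set (sg := fun l => epsilon (inhabits (RtoC 0)) (good l)).
  assert (Hsg : forall l, (l < m)%nat -> good l (sg l)).
  { intros l Hl'; apply epsilon_spec; exact (HT l Hl' (1 - u) Hs). }
  set (Pw := fun l => cpowc (qfun xi) (RtoC (INR (S l) / INR m - 1))).
  assert (S1 : cseries (fun k => d (S k) * q ^ k) (csum (fun l => q ^ l * (Pw l * sg l)) m)).
  { apply cseries_interleave; [exact Hm|]; intros l Hl'.
    destruct (Hsg l Hl') as [_ G2]; apply is_series_cseries in G2.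
    apply (cseries_scal (q ^ l)) in G2; eapply cseries_ext; [|exact G2].
    intros j; cbv beta; rewrite Cpow_add_r, Cpow_mult_r; fold u.
    replace (1 - (1 - u)) with u by ring; simpl; ring. }
  assert (S2 : cseries (borel_term m a w) (csum (fun l => (w ^ S l / w ^ m) * sg l) m)).
  { apply cseries_interleave; [exact Hm|]; intros l Hl'.
    destruct (Hsg l Hl') as [G1 _]; apply is_series_cseries in G1.
    apply (cseries_scal (w ^ S l / w ^ m)) in G1; eapply cseries_ext; [|exact G1].
    intros j; cbv beta; unfold borel_term.
    assert (Eb : (INR (S (l + m * j)) / INR m = INR (S l) / INR m + INR j)%R).
    { replace (S (l + m * j)) with (S l + m * j)%nat by lia; rewrite plus_INR, mult_INR; field; lra. }
    rewrite Eb.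
    assert (Hg : RtoC (RGamma (INR (S l) / INR m + INR j)) <> 0).
    { assert (Hpos : 0 < INR (S l) / INR m + INR j).
      { pose proof (pos_INR j); assert (0 < INR (S l) / INR m) by (apply Rdiv_lt_0_compat; [apply lt_0_INR; lia|lra]). lra. }
      rewrite <- RGamma_CGamma by exact Hpos; apply CGamma_neq0; exact Hpos. }
    assert (Hwm : w ^ m <> 0) by now apply Cpow_nz.
    replace (S (l + m * j)) with (S l + m * j)%nat by lia.
    rewrite (Cpow_add_r w (S l)), (Cpow_mult_r w m j), Ew.
    rewrite Ew in Hwm; field; split; assumption. }
  rewrite (cseries_unique _ _ _ HFw S2), Cmult_comm, <- csum_scal.
  rewrite <- (csum_ext (fun l => q ^ l * (Pw l * sg l))); [exact S1|].
  intros l Hl'; unfold Pw, cpowc; rewrite Eq.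
  set (X := Cln (xi / u)).
  (* Since [w = q (xi/u)^(1/m)], the factor [w^(l+1-m) q^(m-1)] equals [q^l (xi/u)^((l+1)/m - 1)].
     Writing all powers as exponentials of multiples of the one logarithm [X] leaves no branch to
     compare. *)
  assert (Ewl : forall k, w ^ k = q ^ k * cexp (RtoC (INR k / INR m) * X)).
  { intros k; unfold w, wch; fold u; fold xi; fold X; rewrite Cpow_mult_l, cexp_pow; f_equal; f_equal.
    rewrite RtoC_div by lra; field; apply RtoC_neq0; lra. }
  rewrite !Ewl.
  assert (Ee : cexp (RtoC (INR (S l) / INR m - 1) * X) =
     cexp (RtoC (INR (S l) / INR m) * X) / cexp (RtoC (INR m / INR m) * X)).
  { unfold Cdiv; rewrite <- cexp_opp, <- cexp_plus; f_equal.
    replace (INR m / INR m)%R with 1%R by (field; lra); rewrite RtoC_minus; ring. }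
  rewrite Ee; destruct m as [|k]; [lia|].
  replace (S k - 1)%nat with k by lia; rewrite (Cpow_S q k), (Cpow_S q l); field.
  repeat split; try apply cexp_neq0; try apply Cpow_nz; exact Hq0.
Qed.

(** * Termwise integration *)

(** Comparison of the zeta series with a telescoping sum: the ratio of the two powers is [exp(del
    (ln y - ln (y-1))) >= 1 + del / y]. *)
Lemma zeta_telescope del y : 0 < del -> 1 < y ->
  (del * Rpower y (- 1 - del) <= Rpower (y - 1) (- del) - Rpower y (- del)).
Proof.
  intros Hd Hy.
  assert (E1 : (Rpower y (- 1 - del) = Rpower y (- del) * / y)%R).
  { rewrite <- (Rpower_1 y) at 3 by lra; rewrite <- Rpower_Ropp, <- Rpower_plus; f_equal; ring. }
  assert (E2 : (Rpower (y - 1) (- del) = Rpower y (- del) * exp (- del * (ln (y - 1) - ln y)))%R).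
  { unfold Rpower; rewrite <- exp_plus; f_equal; ring. }
  assert (L : / y <= ln y - ln (y - 1)).
  { pose proof (ln_le_sub1 ((y - 1) / y) ltac:(apply Rdiv_lt_0_compat; lra)) as LL.
    unfold Rdiv in LL at 1; rewrite ln_mult, ln_Rinv in LL by (try apply Rinv_0_lt_compat; lra).
    replace ((y - 1) / y - 1)%R with (- / y)%R in LL by (field; lra). lra. }
  pose proof (exp_ineq1_le (- del * (ln (y - 1) - ln y))) as EI.
  assert (HP : 0 < Rpower y (- del)) by apply exp_pos.
  rewrite E1, E2.
  assert (del * / y <= - del * (ln (y - 1) - ln y)).
  { replace (- del * (ln (y - 1) - ln y))%R with (del * (ln y - ln (y - 1)))%R by ring.
    apply Rmult_le_compat_l; lra. }
  replace (del * (Rpower y (- del) * / y))%R with (Rpower y (- del) * (del * / y))%R by ring.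
  replace (Rpower y (- del) * exp (- del * (ln (y - 1) - ln y)) - Rpower y (- del))%R with
    (Rpower y (- del) * (exp (- del * (ln (y - 1) - ln y)) - 1))%R by ring.
  apply Rmult_le_compat_l; lra.
Qed.

Lemma csum_zeta_tail u del E n p : 0 < del -> 0 <= E ->
  (forall k, Cmod (u k) <= E * Rpower (INR k + 2) (- 1 - del)) ->
  (Cmod (csum u (n + p) - csum u n) <= E / del * Rpower (INR n + 1) (- del)).
Proof.
  intros Hd HE Hu.
  assert (B : Cmod (csum u (n + p) - csum u n) <= E / del * (Rpower (INR n + 1) (- del) - Rpower (INR (n + p) + 1) (- del))).
  { induction p.
    - rewrite Nat.add_0_r; replace (csum u n - csum u n) with (RtoC 0) by ring; rewrite Cmod_0; lra.
    - rewrite Nat.add_succ_r; simpl csum.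
      replace (csum u (n + p) + u (n + p)%nat - csum u n) with ((csum u (n + p) - csum u n) + u (n + p)%nat) by ring.
      eapply Rle_trans; [apply Cmod_triangle|].
      pose proof (pos_INR (n + p)).
      pose proof (zeta_telescope del (INR (n + p) + 2) Hd ltac:(lra)) as Z.
      replace (INR (n + p) + 2 - 1)%R with (INR (n + p) + 1)%R in Z by ring.
      rewrite S_INR; replace (INR (n + p) + 1 + 1)%R with (INR (n + p) + 2)%R by ring.
      specialize (Hu (n + p)%nat).
      assert (Z2 : E * Rpower (INR (n + p) + 2) (- 1 - del) <= E / del * (Rpower (INR (n + p) + 1) (- del) - Rpower (INR (n + p) + 2) (- del))).
      { apply (Rmult_le_compat_l (E / del)) in Z; [|apply Rmult_le_pos; [exact HE|left; now apply Rinv_0_lt_compat]].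
        replace (E / del * (del * Rpower (INR (n + p) + 2) (- 1 - del)))%R with (E * Rpower (INR (n + p) + 2) (- 1 - del))%R in Z by (field; lra).
        exact Z. }
      lra. }
  eapply Rle_trans; [exact B|]; apply Rmult_le_compat_l.
  - apply Rmult_le_pos; [exact HE|left; now apply Rinv_0_lt_compat].
  - assert (0 < Rpower (INR (n + p) + 1) (- del)) by apply exp_pos. lra.
Qed.

Lemma Rpower_neg_small del K eps : 0 < del -> 0 <= K -> 0 < eps ->
  exists N, forall n, (N <= n)%nat -> K * Rpower (INR n + 1) (- del) < eps.
Proof.
  intros Hd HK He.
  destruct (INR_unbounded (Rpower (eps / (K + 1)) (- / del))) as [N HN]; exists N; intros n Hn.
  apply le_INR in Hn.
  assert (Hq : 0 < eps / (K + 1)) by (apply Rdiv_lt_0_compat; lra).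
  assert (HP : 0 < Rpower (eps / (K + 1)) (- / del)) by apply exp_pos.
  assert (L : Rpower (INR n + 1) (- del) <= eps / (K + 1)).
  { eapply Rle_trans; [apply (Rpower_neg_le (Rpower (eps / (K + 1)) (- / del))); lra|].
    rewrite Rpower_mult; replace (- / del * - del)%R with 1%R by (field; lra); rewrite Rpower_1 by exact Hq; lra. }
  apply Rle_lt_trans with (K * (eps / (K + 1)))%R; [apply Rmult_le_compat_l; lra|apply mul_div_succ_lt; lra].
Qed.

Lemma zeta_ex_series del : 0 < del -> ex_series (fun n => Rpower (INR n + 2) (- 1 - del)).
Proof.
  intros Hd.
  destruct (ex_finite_lim_seq_incr (sum_n (fun n => Rpower (INR n + 2) (- 1 - del))) (/ del * 1)) as [l Hl].
  - intros n; rewrite sum_Sn; unfold plus; simpl.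
    match goal with |- (_ <= _ + ?x) => assert (0 < x) by apply exp_pos end; lra.
  - intros n.
    set (v := fun n => RtoC (Rpower (INR n + 2) (- 1 - del))).
    assert (E : RtoC (sum_n (fun n => Rpower (INR n + 2) (- 1 - del)) n) = csum v (S n)).
    { induction n; [rewrite sum_O; simpl csum; rewrite Cplus_0_l; reflexivity|].
      rewrite sum_Sn; unfold plus; simpl; rewrite RtoC_plus, IHn; reflexivity. }
    pose proof (csum_zeta_tail v del 1 0 (S n) Hd ltac:(lra)) as T.
    assert (Hv : forall k, Cmod (v k) <= 1 * Rpower (INR k + 2) (- 1 - del)).
    { intros k; unfold v; rewrite Cmod_R, Rabs_pos_eq by (left; apply exp_pos); lra. }
    specialize (T Hv); simpl (csum v 0) in T.
    rewrite Nat.add_0_l, <- E in T; simpl INR in T.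
    replace (0 + 1)%R with 1%R in T by ring.
    replace (Rpower 1 (- del)) with 1%R in T by (unfold Rpower; rewrite ln_1, Rmult_0_r, exp_0; reflexivity).
    replace (RtoC (sum_n (fun n => Rpower (INR n + 2) (- 1 - del)) n) - 0) with
      (RtoC (sum_n (fun n => Rpower (INR n + 2) (- 1 - del)) n)) in T by ring.
    rewrite Cmod_R in T; eapply Rle_trans; [apply Rle_abs|]; eapply Rle_trans; [exact T|]; right; field; lra.
  - exists l; exact Hl.
Qed.

(** Non-vanishing of Gamma makes the quotient a genuine one; in this form the term inherits the
    decay of the Beta integral. *)
Lemma fact_term_CBeta (m : nat) (d : nat -> C) z n : (1 <= m)%nat -> 0 < Re z ->
  fact_term m d z (S n) = d (S n) * CBeta z (INR (S n) / INR m).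
Proof.
  intros Hm Hz; unfold fact_term; set (b := (INR (S n) / INR m)%R).
  assert (Hb : 0 < b) by (apply Rdiv_lt_0_compat; apply lt_0_INR; lia).
  assert (Hnz : CGamma (z + RtoC b) <> 0) by (apply CGamma_neq0; destruct z; simpl in *; lra).
  pose proof (CBeta_CGamma z b Hz Hb) as E; rewrite RGamma_CGamma in E by exact Hb.
  rewrite <- E; field; exact Hnz.
Qed.

(** The decay estimate needs [b = (n+1)/m] above 1: for [n >= 2m] one has [b - 1 >= (n+2)/(2m)]. The
    finitely many smaller [n] use the crude bound, since there [(n+2)^(-x)] is bounded below. *)
Lemma bint_uniform_decay (m : nat) z : (1 <= m)%nat -> 0 < Re z ->
  exists M, (0 <= M) /\ forall n t1 t2, 0 < t1 <= t2 ->
    (Cmod (CInt (bint z (INR (S n) / INR m)) t1 t2) <= M * Rpower (INR n + 2) (- Re z)).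
Proof.
  intros Hm Hz; set (x := Re z) in *.
  assert (HmR : 1 <= INR m) by (change 1%R with (INR 1); apply le_INR; lia).
  destruct (CInt_bint_decay z Hz) as [M [HM HD]]; fold x in HD.
  set (M1 := (M * Rpower (2 * INR m) x)%R).
  set (M2 := (2 * (/ x + INR m) * Rpower (2 * INR m + 2) x)%R).
  assert (HM1 : 0 < M1) by (apply Rmult_lt_0_compat; [exact HM|apply exp_pos]).
  assert (Hix : 0 < / x) by now apply Rinv_0_lt_compat.
  assert (HM2 : 0 < M2) by (apply Rmult_lt_0_compat; [lra|apply exp_pos]).
  exists (M1 + M2)%R; split; [lra|]; intros n t1 t2 Ht.
  pose proof (pos_INR n) as Hn.
  set (P := Rpower (INR n + 2) (- x)); assert (HP : 0 < P) by apply exp_pos.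
  set (b := (INR (S n) / INR m)%R).
  destruct (Nat.le_gt_cases (2 * m) n) as [h|h].
  - apply Rle_trans with (M1 * P)%R; [|nra].
    apply le_INR in h; rewrite mult_INR in h; simpl (INR 2) in h.
    assert (Hb : (INR n + 2) / (2 * INR m) <= b - 1).
    { unfold b; rewrite S_INR.
      replace ((INR n + 1) / INR m - 1)%R with ((INR n + 1 - INR m) / INR m)%R by (field; lra).
      replace ((INR n + 2) / (2 * INR m))%R with (((INR n + 2) / 2) / INR m)%R by (field; lra).
      apply Rmult_le_compat_r; [left; apply Rinv_0_lt_compat; lra|]. lra. }
    assert (H0 : 0 < (INR n + 2) / (2 * INR m)) by (apply Rdiv_lt_0_compat; lra).
    eapply Rle_trans; [apply HD; [lra|exact Ht]|].
    unfold M1; rewrite Rmult_assoc; apply Rmult_le_compat_l; [lra|].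
    eapply Rle_trans; [apply (Rpower_neg_le ((INR n + 2) / (2 * INR m))); lra|].
    right; unfold P, Rpower, Rdiv; rewrite ln_mult, ln_Rinv, <- exp_plus by (try apply Rinv_0_lt_compat; lra).
    f_equal; ring.
  - apply Rle_trans with (M2 * P)%R; [|nra].
    assert (Hb : / INR m <= b).
    { unfold b, Rdiv; rewrite S_INR, <- (Rmult_1_l (/ INR m)) at 1.
      apply Rmult_le_compat_r; [left; apply Rinv_0_lt_compat; lra|lra]. }
    assert (Hb0 : 0 < b).
    { assert (0 < / INR m) by (apply Rinv_0_lt_compat; lra). lra. }
    eapply Rle_trans; [apply CInt_bint_bound; assumption|]; fold x.
    assert (Hib : / b <= INR m).
    { rewrite <- (Rinv_inv (INR m)); apply Rinv_le_contravar; [apply Rinv_0_lt_compat; lra|exact Hb]. }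
    apply lt_INR in h; rewrite mult_INR in h; simpl (INR 2) in h.
    assert (One : 1 <= Rpower (2 * INR m + 2) x * P).
    { apply Rle_trans with (Rpower (INR n + 2) x * P)%R.
      - unfold P; rewrite <- Rpower_plus, Rplus_opp_r, Rpower_O; lra.
      - apply Rmult_le_compat_r; [lra|apply Rle_Rpower_l; lra]. }
    unfold M2; rewrite Rmult_assoc.
    assert (0 <= 2 * (/ x + INR m)) by lra. nra.
Qed.

Lemma is_CInt_csum (u : nat -> R -> C) (I : nat -> C) a b N :
  (forall n, is_CInt (u n) a b (I n)) -> is_CInt (fun t => csum (fun n => u n t) N) a b (csum I N).
Proof.
  intros H; induction N; simpl.
  - pose proof (is_CInt_const (RtoC 0) a b) as Z.
    replace (RtoC (b - a) * 0) with (RtoC 0) in Z by ring; exact Z.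
  - apply is_CInt_plus; [exact IHN|apply H].
Qed.

Lemma borel_integrand_cont (m : nat) (F : C -> C) z : (1 <= m)%nat ->
  (forall w : C, in_Omega_chart m w -> @ex_derive C_AbsRing C_NormedModule F w) ->
  pcont (fun t => F (RtoC (Rpower t (/ INR m))) * cexp (- (z * RtoC t))).
Proof.
  intros Hm HF t Ht.
  assert (HmR : 0 < INR m) by (apply lt_0_INR; lia).
  apply cont_at_mult.
  - apply (cont_at_comp _ (fun t => RtoC (Rpower t (/ INR m))) F).
    + apply rcont_RtoC, ex_derive_cont; unfold Rpower; auto_derive; lra.
    + apply cdiff_cont, cdiff_of_ex_derive, HF; split.
      * apply RtoC_neq0, Rgt_not_eq, exp_pos.
      * exists (RtoC (exp (- t))); pose proof (exp_opp_lt1 t Ht); split.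
        -- rewrite <- RtoC_minus, Cmod_R, Rabs_left; lra.
        -- rewrite Cln_RtoC, ln_exp, <- RtoC_pow, <- RtoC_opp by lra; f_equal.
           rewrite <- Rpower_pow, Rpower_mult, Rinv_l, Rpower_1 by (try apply exp_pos; lra); ring.
  - apply (cont_at_ext_loc _ (fun t => cexp (- z * RtoC t)) _ t 1); [lra|f_equal; ring|intros; f_equal; ring|].
    apply (pcont_cexp_lin (- z) (fun t => t)), continuous_id.
Qed.

(** For fixed [t1] and [t2] the variable [sigma] stays below [x2 < 1] and the weight [om] below
    [om t1], so the series converges uniformly and may be integrated term by term. *)
Lemma borel_integral_series (m : nat) (F : C -> C) (c : nat -> C) z t1 t2 : (1 <= m)%nat -> 0 < Re z ->
  (forall w : C, in_Omega_chart m w -> @ex_derive C_AbsRing C_NormedModule F w) ->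
  (forall x, 0 < x < 1 -> cseries (fun k => c k * RtoC x ^ k) (F (wch m (RtoC x)) * RtoC x ^ (m - 1))) ->
  (0 < t1 < t2) ->
  cseries (fun n => c n * CInt (bint z (INR (S n) / INR m)) t1 t2)
    (CInt (fun t => F (RtoC (Rpower t (/ INR m))) * cexp (- (z * RtoC t))) t1 t2).
Proof.
  intros Hm Hz HF HS Ht e He.
  set (f := fun t => F (RtoC (Rpower t (/ INR m))) * cexp (- (z * RtoC t))).
  assert (HmR : 1 <= INR m) by (change 1%R with (INR 1); apply le_INR; lia).
  assert (Him : 0 < / INR m <= 1).
  { split; [apply Rinv_0_lt_compat; lra|]; rewrite <- Rinv_1; apply Rinv_le_contravar; lra. }
  set (sg := fun t => Rpower (1 - exp (- t)) (/ INR m)).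
  set (om := fun t => Rpower (1 - exp (- t)) (/ INR m - 1)).
  assert (Hsg : forall t, 0 < t -> 0 < sg t < 1).
  { intros t Htp; pose proof (exp_opp_lt1 t Htp); split; [apply exp_pos|].
    unfold sg; replace 1%R with (Rpower 1 (/ INR m)) at 2 by (unfold Rpower; rewrite ln_1, Rmult_0_r; apply exp_0).
    apply Rlt_Rpower_l; lra. }
  assert (Hmon : forall t, t1 <= t <= t2 -> sg t <= sg t2).
  { intros t Htt; apply Rle_Rpower_l; [lra|].
    pose proof (exp_opp_lt1 t ltac:(lra)); pose proof (exp_le_compat (- t2) (- t) ltac:(lra)); lra. }
  pose proof (Hsg t2 ltac:(lra)) as Hx2; set (x2 := sg t2) in *.
  set (r := ((1 + x2) / 2)%R); assert (Hr : x2 < r < 1) by (unfold r; lra).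
  destruct (cseries_terms_bounded _ _ (HS r ltac:(lra))) as [K HK].
  assert (HK' : forall k, Cmod (c k) * r ^ k <= K).
  { intros k; specialize (HK k); rewrite Cmod_mult, Cmod_pow, Cmod_R, Rabs_pos_eq in HK by lra; exact HK. }
  assert (K0 : 0 <= K) by (eapply Rle_trans; [apply Cmod_ge_0|apply (HK 0%nat)]).
  set (y := (x2 / r)%R).
  assert (Hy : 0 <= y < 1).
  { apply div_lt1; lra. }
  set (W := om t1); assert (HW : 0 < W) by apply exp_pos.
  assert (Hpt : forall N t, t1 <= t <= t2 ->
    (Cmod (f t - csum (fun n => (c n * bint z (INR (S n) / INR m) t)%C) N) <= W * (K * y ^ N / (1 - y)))%R).
  { intros N t Htt; assert (Htp : 0 < t) by lra.
    pose proof (exp_opp_lt1 t Htp) as Hs; pose proof (Hsg t Htp) as Hx.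
    set (x := sg t) in *; set (E := cexp (- z * RtoC t)).
    (* The weight [om t = sigma^(1-m)] removes the factor [sigma^(m-1)] built into [H] and also
       shifts the exponent of each term to [(n+1)/m - 1]. *)
    assert (Eom : (om t * x ^ (m - 1) = 1)%R).
    { rewrite <- Rpower_pow by lra; unfold om, x, sg; rewrite Rpower_mult, <- Rpower_plus, minus_INR by lia.
      replace (/ INR m - 1 + / INR m * (INR m - INR 1))%R with 0%R by (simpl; field; lra).
      apply Rpower_O; lra. }
    assert (Ef : f t = E * RtoC (om t) * (F (wch m (RtoC x)) * RtoC x ^ (m - 1))).
    { unfold x at 1, sg; rewrite wch_real by assumption.
      replace (E * RtoC (om t) * (F (RtoC (Rpower t (/ INR m))) * RtoC x ^ (m - 1)))
        with (F (RtoC (Rpower t (/ INR m))) * E * (RtoC (om t) * RtoC x ^ (m - 1))) by ring.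
      rewrite <- RtoC_pow, <- RtoC_mult, Eom; unfold f, E.
      replace (- (z * RtoC t)) with (- z * RtoC t) by ring; ring. }
    assert (Eb : forall n, c n * bint z (INR (S n) / INR m) t = E * RtoC (om t) * (c n * RtoC x ^ n)).
    { intros n; unfold bint; fold E.
      replace (Rpower (1 - exp (- t)) (INR (S n) / INR m - 1)) with (om t * x ^ n)%R.
      - rewrite RtoC_mult, RtoC_pow; ring.
      - rewrite <- Rpower_pow by lra; unfold om, x, sg; rewrite Rpower_mult, <- Rpower_plus, S_INR; f_equal; field; lra. }
    rewrite (csum_ext _ (fun n => E * RtoC (om t) * (c n * RtoC x ^ n))) by (intros; apply Eb).
    rewrite csum_scal, Ef.
    match goal with |- (Cmod ?X <= _) => replace X with (E * RtoC (om t) *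
      (F (wch m (RtoC x)) * RtoC x ^ (m - 1) - csum (fun n => c n * RtoC x ^ n) N)) by ring end.
    rewrite !Cmod_mult.
    apply Rmult_le_compat; [apply Rmult_le_pos; apply Cmod_ge_0|apply Cmod_ge_0| |].
    - rewrite Cmod_R, Rabs_pos_eq by (left; apply exp_pos).
      unfold E; rewrite Cmod_cexp.
      assert (E1 : exp (Re (- z * RtoC t)) <= 1).
      { apply exp_le1.
        replace (Re (- z * RtoC t)) with (- (Re z * t))%R by (destruct z; simpl; ring).
        assert (0 < Re z * t) by (apply Rmult_lt_0_compat; lra). lra. }
      assert (E2 : om t <= W).
      { unfold W, om; replace (/ INR m - 1)%R with (- (1 - / INR m))%R by ring.
        pose proof (exp_opp_lt1 t1 ltac:(lra)); pose proof (exp_le_compat (- t) (- t1) ltac:(lra)).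
        apply Rpower_neg_le; lra. }
      assert (0 < om t) by apply exp_pos.
      pose proof (exp_pos (Re (- z * RtoC t))); nra.
    - apply (cseries_geo_tail c (RtoC x) _ r K y N); [lra|exact Hy|exact K0|exact HK'| |apply HS; exact Hx].
      rewrite Cmod_R, Rabs_pos_eq by lra; specialize (Hmon t Htt); fold x in Hmon; fold x2 in Hmon.
      replace (y * r)%R with x2 by (unfold y; field; lra). exact Hmon. }
  assert (Hint : forall N, is_CInt (fun t => f t - csum (fun n => c n * bint z (INR (S n) / INR m) t) N) t1 t2
     (CInt f t1 t2 - csum (fun n => c n * CInt (bint z (INR (S n) / INR m)) t1 t2) N)).
  { intros N; apply is_CInt_minus.
    - apply pcont_CInt; [apply borel_integrand_cont; assumption|lra].
    - apply (is_CInt_csum (fun n t => c n * bint z (INR (S n) / INR m) t)); intros n; apply is_CInt_scal, pcont_CInt; [apply bint_cont|lra]. }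
  set (Q := ((t2 - t1) * (W * (K / (1 - y))))%R).
  assert (HQ : 0 <= Q).
  { unfold Q; apply Rmult_le_pos; [lra|]; apply Rmult_le_pos; [lra|].
    apply Rmult_le_pos; [exact K0|left; apply Rinv_0_lt_compat; lra]. }
  destruct (pow_lt_1_zero y) with (y := (e / (Q + 1))%R) as [N HN].
  { rewrite Rabs_pos_eq; lra. }
  { apply Rdiv_lt_0_compat; lra. }
  exists N; intros n Hn; specialize (HN n Hn); rewrite Rabs_pos_eq in HN by (apply pow_le; lra).
  rewrite Cmod_sub_sym; fold f.
  eapply Rle_lt_trans; [eapply is_CInt_norm_const; [|apply Hpt|apply Hint]; lra|].
  replace ((t2 - t1) * (W * (K * y ^ n / (1 - y))))%R with (Q * y ^ n)%R by (unfold Q; field; lra).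
  apply Rle_lt_trans with (Q * (e / (Q + 1)))%R; [apply Rmult_le_compat_l; lra|apply mul_div_succ_lt; lra].
Qed.

Lemma gen_lim_csum (u : nat -> R -> R -> C) (L : nat -> C) N :
  (forall n, gen_lim (u n) (L n)) -> gen_lim (fun a b => csum (fun n => u n a b) N) (csum L N).
Proof.
  intros H; induction N; simpl.
  - intros e He; exists 1%R, 1%R; repeat split; try lra; intros.
    replace (0 - 0) with (RtoC 0) by ring; rewrite Cmod_0; exact He.
  - apply gen_lim_plus; [exact IHN|apply H].
Qed.

(** The tail is small uniformly in the truncation, and the head is a finite sum of limits. Existence
    of the limit of [Phi] is part of the conclusion, so the Borel integral needs no majorant of its
    own. *)
Lemma tannery (T : nat -> R -> R -> C) (L : nat -> C) (Phi : R -> R -> C) S del E :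
  (0 < del) -> 0 <= E ->
  (forall n, gen_lim (T n) (L n)) -> cseries L S ->
  (forall t1 t2, 0 < t1 < t2 -> cseries (fun n => T n t1 t2) (Phi t1 t2)) ->
  (forall n t1 t2, 0 < t1 <= t2 -> Cmod (T n t1 t2) <= E * Rpower (INR n + 2) (- 1 - del)) ->
  gen_lim Phi S.
Proof.
  intros Hd HE HT HL HP HB e He.
  assert (HK : 0 <= E / del) by (apply Rmult_le_pos; [exact HE|left; now apply Rinv_0_lt_compat]).
  destruct (Rpower_neg_small del (E / del) (e / 8) Hd HK ltac:(lra)) as [N1 H1].
  destruct (HL (e / 4)%R ltac:(lra)) as [N2 H2].
  set (N := (N1 + N2)%nat).
  specialize (H1 N ltac:(lia)); specialize (H2 N ltac:(lia)).
  destruct (gen_lim_csum T L N HT (e / 4)%R ltac:(lra)) as [al [be [Ha [Hb HH]]]].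
  exists al, be; split; [exact Ha|split; [exact Hb|]]; intros t1 t2 Ht1 Ht2.
  specialize (HH t1 t2 Ht1 Ht2).
  assert (H3 : (Cmod (Phi t1 t2 - csum (fun n => T n t1 t2) N) <= e / 4)%R).
  { destruct (HP t1 t2 ltac:(lra) (e / 8)%R ltac:(lra)) as [N3 H3].
    specialize (H3 (N + N3)%nat ltac:(lia)); rewrite Cmod_sub_sym in H3.
    pose proof (csum_zeta_tail (fun n => T n t1 t2) del E N N3 Hd HE (fun n => HB n t1 t2 ltac:(lra))) as H4.
    pose proof (Cmod_sub_tri (Phi t1 t2) (csum (fun n => T n t1 t2) (N + N3)) (csum (fun n => T n t1 t2) N)). lra. }
  pose proof (Cmod_sub_tri (Phi t1 t2) (csum (fun n => T n t1 t2) N) S) as A1.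
  pose proof (Cmod_sub_tri (csum (fun n => T n t1 t2) N) (csum L N) S) as A2. lra.
Qed.

Theorem proposition5p2 (m : nat) (a d : nat -> C) (F : C -> C) (A B : R) :
  (1 <= m)%nat ->
  gevrey1 m a ->
  (* the Borel transform extends analytically to Omega^star (F is the extension,
     read in the chart w = zeta^{1/m}) *)
  (forall w : C, in_Omega_chart m w -> @ex_derive C_AbsRing C_NormedModule F w) ->
  (exists rho : R, (0 < rho)%R /\
     forall w : C, in_Omega_chart m w -> (Cmod w < rho)%R ->
       is_series (borel_term m a w) (F w)) ->
  (* exponential bound |f~(zeta) zeta^{(m-1)/m}| <= A e^{B|zeta|} on Omega^star *)
  (0 < A)%R -> (0 < B)%R ->
  (forall w : C, in_Omega_chart m w ->
     (Cmod (F w * w ^ (m - 1)) <= A * exp (B * Cmod w ^ m))%R) ->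
  (* definition of the coefficients d_n *)
  (forall l : nat, (1 <= l <= m)%nat -> taylor_coeffs_d m a d l) ->
  forall z : C, (Rmax B 1 < Re z)%R ->
    ex_series (fun k => Cmod (fact_term m d z (S k))) /\
    exists Ssum I : C,
      is_series (fun k => fact_term m d z (S k)) Ssum /\
      is_RInt_gen (fun t : R => F (RtoC (Rpower t (/ INR m))) * cexp (- (z * RtoC t)))
                  (at_right 0) (Rbar_locally p_infty) I /\
      a 0%nat + Ssum = a 0%nat + I.
Proof.
  intros Hm _ HF Hser HA HB Hbd Hd z Hz.
  set (x := Re z) in *; pose proof (Rmax_l B 1) as M1; pose proof (Rmax_r B 1) as M2.
  (* [B' > 1] is needed by the kernel integral, [B' >= B] by the growth hypothesis, and [B' < Re z]
     leaves the margin [del] that makes the terms [O(n^(-1-del))]. *)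
  set (B' := ((Rmax B 1 + x) / 2)%R).
  assert (HB' : (1 < B' < x) /\ (B <= B')) by (unfold B'; lra).
  destruct HB' as [HB1 HB2].
  assert (Hx : 0 < x) by lra.
  destruct (chart_bound m F A B B' Hm HA HB2 ltac:(lra) Hbd) as [C0 [HC0 HCb]].
  destruct (chart_series m a d F Hm Hser Hd) as [r0 [Hr0 Hs0]].
  set (H := fun q => F (wch m q) * q ^ (m - 1)).
  set (c := fun k => d (S k)).
  assert (H_diff : forall q, 0 < Cmod q < 1 -> cdiff H q).
  { intros q Hq; apply cdiff_mult; [|apply (cdiff_pow (fun q => q)), cdiff_id].
    apply (cdiff_comp (wch m) F); [now apply wch_diff|now apply cdiff_of_ex_derive, HF, wch_Omega]. }
  destruct (coef_growth H c r0 m C0 B' H_diff Hr0 Hs0 Hm (proj1 HB1) HC0 HCb) as [D [HD0 HD]].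
  assert (HS : forall y, 0 < y < 1 -> cseries (fun k => c k * RtoC y ^ k) (H (RtoC y))).
  { intros y Hy; apply (power_series_identity H c r0); auto.
    intros rho Hrho; apply (circle_bounded H m C0 B'); auto; lra. }
  destruct (bint_uniform_decay m z Hm Hx) as [M [HM0 HM]]; fold x in HM.
  set (del := (x - B')%R); assert (Hdel : 0 < del) by (unfold del; lra).
  set (T := fun n t1 t2 => c n * CInt (bint z (INR (S n) / INR m)) t1 t2).
  set (L := fun n => c n * CBeta z (INR (S n) / INR m)).
  assert (HT : forall n, gen_lim (T n) (L n)).
  { intros n; apply gen_lim_scal, CBeta_lim; [exact Hx|].
    apply Rdiv_lt_0_compat; apply lt_0_INR; lia. }
  assert (HTb : forall n t1 t2, 0 < t1 <= t2 -> Cmod (T n t1 t2) <= D * M * Rpower (INR n + 2) (- 1 - del)).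
  { intros n t1 t2 Ht; unfold T; rewrite Cmod_mult.
    eapply Rle_trans; [apply Rmult_le_compat; [apply Cmod_ge_0|apply Cmod_ge_0|apply HD|apply HM, Ht]|].
    right; replace (- 1 - del)%R with ((B' - 1) + - x)%R by (unfold del; ring); rewrite Rpower_plus; ring. }
  assert (HDM : 0 <= D * M) by now apply Rmult_le_pos.
  assert (HLb : forall n, Cmod (L n) <= D * M * Rpower (INR n + 2) (- 1 - del)).
  (* The bound is uniform in the truncation and therefore passes to the complete Beta integrals,
     which gives absolute convergence. *)
  { intros n; apply (gen_lim_bound (T n)); [apply HT|apply HTb]. }
  assert (HEx : ex_series (fun n => D * M * Rpower (INR n + 2) (- 1 - del))%R).
  { exact (ex_series_scal (V := R_NormedModule) (D * M)%R _ (zeta_ex_series del Hdel)). }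
  assert (EL : forall n, fact_term m d z (S n) = L n) by (intros n; now apply fact_term_CBeta).
  split.
  - apply (ex_series_le (V := R_CompleteNormedModule) _ (fun n => D * M * Rpower (INR n + 2) (- 1 - del))%R); [|exact HEx].
    intros n; rewrite EL; change (Rabs (Cmod (L n)) <= D * M * Rpower (INR n + 2) (- 1 - del)).
    rewrite Rabs_pos_eq by apply Cmod_ge_0; apply HLb.
  - destruct (ex_series_le (V := C_CompleteNormedModule) L (fun n => D * M * Rpower (INR n + 2) (- 1 - del))%R HLb HEx) as [S HS0].
    assert (HSc : cseries L S) by (apply is_series_cseries; exact HS0).
    (* Tannery's theorem identifies the improper integral with the sum [S] itself, so one witness
       serves twice. *)
    exists S, S; split; [|split; [|reflexivity]].
    + apply is_series_cseries; apply (cseries_ext L); [intros; symmetry; apply EL|exact HSc].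
    + apply is_CInt_gen_intro; [now apply borel_integrand_cont|].
      apply (tannery T L _ S del (D * M)); auto.
      intros t1 t2 Ht; apply borel_integral_series; assumption.
Qed.
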